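(* Let $\alpha\geq\omega$ be a cardinal. The following are equivalent: (a) $\alpha$ is Ulam-measurable; (b) there exists a non-compact, connected, sequentially complete, minimal Hausdorff topological Abelian group of weight $\alpha$; (c) there exists a non-compact, connected, $\omega$-bounded, minimal, torsion-free Hausdorff topological Abelian group of weight $\alpha$. Moreover, if $\alpha$ is the least Ulam-measurable cardinal, then there exists a connected, non-compact, minimal, torsion-free Hausdorff topological Abelian group of weight $\alpha$ that is $\beta$-bounded for every cardinal $\beta<\alpha$.
   Context: A cardinal $|X|$ is Ulam-measurable if there exists a free ultrafilter on $X$ closed under countable intersections. A Hausdorff topological group is minimal if there is no strictly coarser Hausdorff group topology on it. A topological Abelian group $G$ is sequentially complete if it is sequentially closed in its completion (equivalently, every Cauchy sequence in $G$ converges). For an infinite cardinal $\beta$, a topological group $G$ is $\beta$-bounded if every subset of $G$ of cardinality $\leq\beta$ is contained in a compact subgroup of $G$. Weight means the minimal cardinality of a base of the topology. *)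

(* Defs.v *)
From HB Require Import structures.
From mathcomp Require Import all_boot all_order all_algebra.
From mathcomp Require Import all_classical all_reals topology tvs.

Set Implicit Arguments.
Unset Strict Implicit.
Unset Printing Implicit Defensive.

Import GRing.Theory.
Local Open Scope classical_set_scope.
Local Open Scope card_scope.
Local Open Scope ring_scope.

(* A cardinal is represented by a type of that cardinality, compared through
   `#<=` and `#=`.  The abbreviation puts all cardinals in a single universe, so
   that "the least" and "every smaller" cardinal range over the types among
   which alpha itself is chosen. *)
Definition cardinal := Type.

Definition card_lt (B A : cardinal) : Prop :=
  [set: B] #<= [set: A] /\ ~ ([set: A] #<= [set: B]).

Definition free_filter (X : Type) (F : set_system X) : Prop :=
  \bigcap_(U in F) U = set0.

Definition countably_complete (X : Type) (F : set_system X) : Prop :=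
  forall U : nat -> set X, (forall n, F (U n)) -> F (\bigcap_n U n).

Definition Ulam_measurable (A : cardinal) : Prop :=
  exists F : set_system A,
    [/\ UltraFilter F, free_filter F & countably_complete F].

Definition least_Ulam_measurable (A : cardinal) : Prop :=
  Ulam_measurable A /\
  forall B : cardinal, Ulam_measurable B -> [set: A] #<= [set: B].

Definition has_weight (T : topologicalType) (A : cardinal) : Prop :=
  (exists2 B : set (set T), basis B & B #= [set: A]) /\
  (forall B : set (set T), basis B -> [set: A] #<= B).

(* `topologicalType` carries one canonical topology per type, whereas minimality
   quantifies over all topologies on a fixed group; [retopologized t] is the
   group G with its topology replaced by t. *)
Record topology_on (T : Type) := TopologyOn {
  opens :> set (set T) ;
  opens_setT : opens setT ;
  opens_setI : forall U V, opens U -> opens V -> opens (U `&` V) ;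
  opens_bigcup : forall D : set (set T),
    D `<=` opens -> opens (\bigcup_(U in D) U)
}.

Definition retopologized (G : zmodType) (t : topology_on G) : Type := G.

Section Retopologized.
Variables (G : zmodType) (t : topology_on G).

HB.instance Definition _ := GRing.Zmodule.on (retopologized t).

Let opens_bigcup_fam (I : Type) (f : I -> set (retopologized t)) :
  (forall i, opens t (f i)) -> opens t (\bigcup_i f i).
Proof.
move=> tf; have -> : \bigcup_i f i = \bigcup_(U in range f) U.
  by rewrite bigcup_image.
by apply: opens_bigcup => _ [i _ <-].
Qed.

HB.instance Definition _ := isOpenTopological.Build (retopologized t)
  (opens_setT t) (@opens_setI _ t) opens_bigcup_fam.

Lemma open_retopologized : @open (retopologized t) = opens t.
Proof. by []. Qed.

End Retopologized.

Definition is_group_topology (G : zmodType) (t : topology_on G) : Prop :=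
  let Gt := retopologized t in
  continuous (fun x : Gt * Gt => x.1 + x.2) /\ continuous (-%R : Gt -> Gt).

Definition minimal_group (G : topologicalZmodType) : Prop :=
  hausdorff_space G /\
  ~ exists t : topology_on G,
      [/\ is_group_topology t, hausdorff_space (retopologized t)
        & opens t `<` @open G].

Definition Cauchy_seq (G : topologicalZmodType) (u : nat -> G) : Prop :=
  forall U : set G, nbhs (0 : G) U ->
    exists N : nat, forall m n : nat, (N <= m)%N -> (N <= n)%N -> U (u m - u n).

Definition sequentially_complete (G : topologicalZmodType) : Prop :=
  forall u : nat -> G, Cauchy_seq u -> exists l : G, u @ \oo --> l.

Definition is_subgroup (G : zmodType) (K : set G) : Prop :=
  K 0 /\ forall x y, K x -> K y -> K (x - y).

Definition card_bounded (B : cardinal) (G : topologicalZmodType) : Prop :=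
  forall S : set G, S #<= [set: B] ->
    exists K : set G, [/\ is_subgroup K, compact K & S `<=` K].

Definition torsion_free (G : zmodType) : Prop :=
  forall (x : G) (n : nat), (0 < n)%N -> x *+ n = 0 -> x = 0.

(* Main.v *)
From HB Require Import structures.
From mathcomp Require Import all_boot all_order all_algebra.
From mathcomp Require Import all_classical all_reals topology normedtype tvs.
From mathcomp Require Import sequences derive realfun exp trigo.
From mathcomp Require Import ring lra zify.
Require Import Defs.

Set Implicit Arguments.
Unset Strict Implicit.
Unset Printing Implicit Defensive.

Import Order.TTheory GRing.Theory Num.Theory.
Import numFieldTopology.Exports numFieldNormedType.Exports.
Local Open Scope classical_set_scope.
Local Open Scope ring_scope.

(** From a countably complete free ultrafilter [F] on [A] one takes the group of the
families [x] of characters of the rationals, indexed by [A], such that [x i 1 = 0] for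
[F]-almost all [i].  It is dense in the compact product of all families, and it is essential
there, because countable completeness makes every family constant almost everywhere; density
and essentiality in a compact group give minimality.

Conversely, let [G] be minimal, connected and sequentially complete.  If [G] is not
precompact, a sufficiently generic sequence [x] can be made to converge to [0] in a coarser
Hausdorff group topology; the neighbourhoods consist of combinations of the [x i] which are
small for finitely many characters of a free group, and they separate points by Foelner's
theorem on differences of big sets.  So [G] is precompact, its topology comes from its group
[X] of continuous characters, and [X] is torsion-free by connectedness.  Choosing a maximal
independent set [J] in [X], one views [G] as a sequentially closed subgroup of the product
over [J] of the groups of characters of the rationals.  Minimality puts a multiple by a power
of 2 of each family with 2-power torsion values into [G].  The subsets of [J] such that all
these families supported on them lie in [G] form a countably complete ideal, and by a Baire
category argument there is no infinite disjoint sequence of sets outside the ideal.  If [J] is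
not measurable, the ideal then contains a cofinite set, and [G] is compact.  Finally [J] maps
to a base of [G] with finite fibers, since few characters are small on a given big set. *)

(** * Ultrafilters *)

(** Why the prime 2: a nonzero 2-adic integer divides a power of 2, so every nonzero closed subgroup
    of the 2-adic integers is open. For a family [y] with 2-power torsion values, the closure [N] of
    its multiples is an image of the 2-adic integers. If [N] met [G] only in 0, then [N] plus small
    balls would define a strictly coarser Hausdorff group topology on [G]. So a nonzero 2-adic
    multiple of [y] lies in [G], and a sequence of integer multiples of it converges to [2 ^ k]
    times [y]. Sequences also suffice to leave the torsion values: the rationals are countable, so
    each of their characters is a sequential limit of characters with 2-power torsion values.

    Why the construction asks for [x i 1 = 0] and not for [x i = 0]: a closed subgroup may consist
    of constant families only, and essentiality needs a nonzero member of it in the group. Among the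
    values at 1 of an almost constant family, either some multiple is 0 or the multiples are dense
    in the circle; in both cases a nonzero member vanishing at 1 almost everywhere appears, because
    families of rational characters have no torsion. *)

Lemma ultraI (T : Type) (F : set_system T) : ProperFilter F ->
  (forall A, F A \/ F (~` A)) -> UltraFilter F.
Proof.
move=> PF FC; split=> // H PH FH; rewrite eqEsubset; split=> // A HA.
have [//|/FH HnA] := FC A.
by case: (@filter_not_empty _ H _); rewrite -(setICr A); apply: filterI.
Qed.

Lemma ultra_fmap (T U : Type) (f : T -> U) (F : set_system T) :
  UltraFilter F -> UltraFilter (f @ F).
Proof.
move=> UF; apply: ultraI => A.
exact: (in_ultra_setVsetC (f @^-1` A) UF).
Qed.

Lemma ultra_setN (T : Type) (F : set_system T) (A : set T) :
  UltraFilter F -> ~ F A -> F (~` A).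
Proof. by move=> UF nFA; have [|] := in_ultra_setVsetC A UF. Qed.

(** Compactness is mostly used in this form: a directed family of nonempty sets of approximate
    solutions lies in one ultrafilter, and a limit along it solves all the conditions at once. *)
Lemma ultra_base (T I : Type) (D : set I) (B : I -> set T) :
  (exists i, D i) ->
  (forall i j, D i -> D j -> exists2 k, D k & B k `<=` B i `&` B j) ->
  (forall i, D i -> B i !=set0) ->
  exists F : set_system T, UltraFilter F /\ forall i, D i -> F (B i).
Proof.
move=> Dn0 DI Bn0.
have FF : ProperFilter (filter_from D B) by apply: filter_from_proper => //;
  apply: filter_from_filter.
have [F [UF FB]] := ultraFilterLemma FF.
by exists F; split=> // i Di; apply: FB; exists i.
Qed.

Lemma ultra_bounded_cvg (R : realType) (J : Type) (F : set_system J)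
    (u : J -> R) (B : R) : UltraFilter F ->
  F [set j | `|u j| <= B] -> exists l : R, u @ F --> l.
Proof.
move=> UF uB.
have := @segment_compact R (- B) B; rewrite compact_ultra.
move=> /(_ (u @ F) (ultra_fmap u UF))[|l [_ ul]].
  by near=> j; rewrite /= in_itv /= -ler_norml; near: j.
by exists l.
Unshelve. all: by end_near. Qed.

Lemma free_ultra_nat : exists F : set_system nat, UltraFilter F /\
  forall n, F [set k | (n <= k)%N].
Proof.
have [||i _|F [UF FB]] := @ultra_base nat nat setT (fun n => [set k | (n <= k)%N]).
- by exists 0%N.
- move=> i j _ _; exists (maxn i j) => // k /=.
  by rewrite geq_max => /andP[].
- by exists i => /=.
by exists F; split=> // n; apply: FB.
Qed.

Lemma archi_small (R : realType) (K e : R) : 0 < e -> exists n, K / n.+1%:R < e.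
Proof.
move=> e0; exists (Num.bound (`|K| / e)); rewrite ltr_pdivrMr ?ltr0n// mulrC -ltr_pdivrMr//.
apply: (@le_lt_trans _ _ (`|K| / e)); first by apply: ler_wpM2r; [rewrite invr_ge0 ltW|exact: ler_norm].
apply: lt_le_trans (archi_boundP _) _; first by rewrite divr_ge0// ltW.
by rewrite ler_nat.
Qed.

(** * Normalization of linear expressions in a Z-module *)

Inductive zexp := ZVar of nat | ZZero | ZAdd of zexp & zexp | ZOpp of zexp
  | ZMuln of zexp & nat.

Section ZExp.
Variable M : zmodType.

Fixpoint zeval (env : seq M) e : M := match e with
  | ZVar n => nth 0 env n | ZZero => 0
  | ZAdd e1 e2 => zeval env e1 + zeval env e2
  | ZOpp e1 => - zeval env e1
  | ZMuln e1 n => zeval env e1 *+ n end.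

Fixpoint zcoef e (i : nat) : int := match e with
  | ZVar n => (n == i)%:R | ZZero => 0
  | ZAdd e1 e2 => zcoef e1 i + zcoef e2 i
  | ZOpp e1 => - zcoef e1 i
  | ZMuln e1 n => zcoef e1 i *+ n end.

Lemma zevalE env e :
  zeval env e = \sum_(i < size env) nth 0 env i *~ zcoef e i.
Proof.
elim: e => [n||e1 IH1 e2 IH2|e IH|e IH n] /=.
- have [nenv|nenv] := ltnP n (size env); last first.
    rewrite nth_default// big1// => i _.
    by rewrite gtn_eqF ?mulr0z// (leq_trans _ nenv).
  rewrite (bigD1 (Ordinal nenv))//= eqxx mulr1z big1 ?addr0// => i.
  rewrite -val_eqE /= => /negPf; rewrite eq_sym => ->; exact: mulr0z.
- by rewrite big1// => i _; rewrite mulr0z.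
- by rewrite IH1 IH2 -big_split; apply: eq_bigr => i _; rewrite mulrzDr.
- by rewrite IH -sumrN; apply: eq_bigr => i _; rewrite mulrNz.
- by rewrite IH -sumrMnl; apply: eq_bigr => i _; 
  rewrite -[in RHS]mulr_natr natz mulrzA -pmulrn.
Qed.

Lemma zeval_eq env e1 e2 :
  all (fun i => zcoef e1 i == zcoef e2 i) (iota 0 (size env)) ->
  zeval env e1 = zeval env e2.
Proof.
move=> /allP h; rewrite !zevalE; apply: eq_bigr => i _.
by rewrite (eqP (h i _))// mem_iota ltn_ord.
Qed.

End ZExp.

Ltac zm_index x env := match env with
  | ?y :: _ => let _ := match goal with _ => unify x y end in constr:(0%N)
  | _ :: ?env' => let n := zm_index x env' in constr:(n.+1) end.
Ltac zm_mem x env := match env with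
  | ?y :: _ => unify x y | _ :: ?env' => zm_mem x env' end.
(** Only multiples by a numeral are expanded; [x *+ n] with a variable [n] counts as an atom. *)
Ltac zm_isnat n := match n with O => idtac | S ?k => zm_isnat k end.
Ltac zm_env t env := match t with
  | (?a + ?b)%R => let env1 := zm_env a env in zm_env b env1
  | (- ?a)%R => zm_env a env
  | (?a *+ ?n)%R => let _ := match goal with _ => zm_isnat n end in zm_env a env
  | 0%R => env
  | _ => match env with
         | _ => let _ := match goal with _ => zm_mem t env end in env
         | _ => constr:(t :: env) end end.
Ltac zm_reify t env := match t with
  | (?a + ?b)%R => let u := zm_reify a env in let v := zm_reify b env in
      constr:(ZAdd u v)
  | (- ?a)%R => let u := zm_reify a env in constr:(ZOpp u)
  | (?a *+ ?n)%R => let _ := match goal with _ => zm_isnat n end in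
      let u := zm_reify a env in constr:(ZMuln u n)
  | 0%R => constr:(ZZero)
  | _ => let n := zm_index t env in constr:(ZVar n) end.
Ltac zmod := match goal with |- @eq ?M ?a ?b =>
  let env0 := zm_env a (@nil M) in let env := zm_env b env0 in
  let u := zm_reify a env in let v := zm_reify b env in
  change (zeval env u = zeval env v); apply: zeval_eq; vm_compute; reflexivity end.

(** * Homomorphisms *)

Definition hom (M M' : zmodType) (f : M -> M') := {morph f : x y / x + y}.

Section Hom.
Variables (M M' : zmodType) (f : M -> M').
Hypothesis hf : hom f.

Lemma hom0 : f 0 = 0.
Proof. by apply: (addrI (f 0)); rewrite -hf !addr0. Qed.

Lemma homN x : f (- x) = - f x.
Proof. by apply: (addrI (f x)); rewrite -hf !subrr hom0. Qed.

Lemma homB x y : f (x - y) = f x - f y.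
Proof. by rewrite hf homN. Qed.

Lemma homMn x n : f (x *+ n) = f x *+ n.
Proof. by elim: n => [|n IH]; rewrite ?mulr0n ?hom0// !mulrS hf IH. Qed.

Lemma homMz x n : f (x *~ n) = f x *~ n.
Proof. by case: n => n; rewrite ?NegzE ?mulrNz -?pmulrn ?homN homMn. Qed.

Lemma hom_sum (I : Type) (r : seq I) (P : pred I) (F : I -> M) :
  f (\sum_(i <- r | P i) F i) = \sum_(i <- r | P i) f (F i).
Proof. by apply: (big_morph f hf hom0). Qed.

End Hom.

(** * The circle group *)

Section Circle.
Variable R : realType.

(** The unit circle is written additively, complex multiplication being the addition, so that
    characters are additive maps. *)
Record circle := Circle { cpair : R * R;
  circleP : cpair.1 ^+ 2 + cpair.2 ^+ 2 == 1 }.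

HB.instance Definition _ := [isSub for cpair].
HB.instance Definition _ := [Choice of circle by <:].

Definition re (t : circle) : R := (cpair t).1.
Definition im (t : circle) : R := (cpair t).2.

Lemma reim1 t : re t ^+ 2 + im t ^+ 2 = 1.
Proof. exact/eqP/circleP. Qed.

Lemma circle_eq s t : re s = re t -> im s = im t -> s = t.
Proof.
move=> rst ist; apply: val_inj => /=.
by case: s t rst ist => [[a b] p] [[c d] q]; rewrite /re /im /= => -> ->.
Qed.

Lemma circle_ex (a b : R) : a ^+ 2 + b ^+ 2 = 1 -> exists t, re t = a /\ im t = b.
Proof. by move=> /eqP h; exists (@Circle (a, b) h). Qed.

Fact cadd_subproof s t : (re s * re t - im s * im t) ^+ 2 +
  (re s * im t + im s * re t) ^+ 2 == 1.
Proof.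
apply/eqP; have := reim1 s; have := reim1 t => ht hs.
transitivity ((re s ^+ 2 + im s ^+ 2) * (re t ^+ 2 + im t ^+ 2)); first ring.
by rewrite hs ht mulr1.
Qed.
Definition cadd s t := @Circle (_, _) (cadd_subproof s t).

Fact copp_subproof s : re s ^+ 2 + (- im s) ^+ 2 == 1.
Proof. by rewrite sqrrN reim1. Qed.
Definition copp s := @Circle (_, _) (copp_subproof s).

Fact czero_subproof : (1 : R) ^+ 2 + 0 ^+ 2 == 1.
Proof. by rewrite expr1n expr0n addr0. Qed.
Definition czero := @Circle (_, _) czero_subproof.

Fact caddA : associative cadd.
Proof. by move=> s t u; apply: circle_eq; rewrite /cadd/re/im/=; ring. Qed.
Fact caddC : commutative cadd.
Proof. by move=> s t; apply: circle_eq; rewrite /cadd/re/im/=; ring. Qed.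
Fact cadd0 : left_id czero cadd.
Proof. by move=> s; apply: circle_eq; rewrite /cadd/re/im/=; ring. Qed.
Fact caddN : left_inverse czero copp cadd.
Proof.
move=> s; have := reim1 s => hs; apply: circle_eq; rewrite /cadd /re /im /= in hs *.
  by rewrite -[RHS]hs; ring.
by ring.
Qed.

HB.instance Definition _ := GRing.isZmodule.Build circle caddA caddC cadd0 caddN.

Lemma re0 : re 0 = 1. Proof. by []. Qed.
Lemma reN t : re (- t) = re t. Proof. by []. Qed.
Lemma imN t : im (- t) = - im t. Proof. by []. Qed.
Lemma reD s t : re (s + t) = re s * re t - im s * im t. Proof. by []. Qed.
Lemma imD s t : im (s + t) = re s * im t + im s * re t. Proof. by []. Qed.
Lemma reB s t : re (s - t) = re s * re t + im s * im t.
Proof. by rewrite reD reN imN; ring. Qed.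
Lemma re_le1 t : `|re t| <= 1.
Proof. by have := reim1 t; have := sqr_ge0 (im t); rewrite ler_norml; nra. Qed.
Lemma im_le1 t : `|im t| <= 1.
Proof. by have := reim1 t; have := sqr_ge0 (re t); rewrite ler_norml; nra. Qed.

Lemma re_eq1 t : re t = 1 -> t = 0.
Proof.
move=> h; apply: circle_eq => //; have := reim1 t; rewrite h expr1n.
by move=> /eqP; rewrite -subr_eq0 addrAC subrr add0r sqrf_eq0 => /eqP ->.
Qed.

(** The length of the chord from [t] to the neutral element: [|z - 1| ^ 2 = 2 - 2 re z] on the unit
    circle. *)
Definition cnorm t : R := Num.sqrt (2 - 2 * re t).

Lemma cnorm_arg t : 0 <= 2 - 2 * re t.
Proof. by have := re_le1 t; rewrite ler_norml; lra. Qed.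

Lemma sqr_cnorm t : cnorm t ^+ 2 = 2 - 2 * re t.
Proof. by rewrite /cnorm sqr_sqrtr // cnorm_arg. Qed.

Lemma cnorm_ge0 t : 0 <= cnorm t. Proof. exact: sqrtr_ge0. Qed.

Lemma cnorm0 : cnorm 0 = 0.
Proof. by rewrite /cnorm re0 mulr1 subrr sqrtr0. Qed.

Lemma cnorm_eq0 t : cnorm t = 0 -> t = 0.
Proof.
by move=> h; apply: re_eq1; have := sqr_cnorm t; rewrite h expr0n /=; lra.
Qed.

Lemma cnormN t : cnorm (- t) = cnorm t. Proof. by []. Qed.

Lemma cnorm_distC s t : cnorm (s - t) = cnorm (t - s).
Proof. by rewrite -opprB cnormN. Qed.

Lemma cnormD s t : cnorm (s + t) <= cnorm s + cnorm t.
Proof.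
rewrite -(@ler_pXn2r _ 2) ?nnegrE ?addr_ge0 ?cnorm_ge0 //.
rewrite sqrrD !sqr_cnorm reD.
have hs := reim1 s; have ht := reim1 t.
have s1 := re_le1 s; have t1 := re_le1 t; rewrite !ler_norml in s1 t1.
have p0 : 0 <= cnorm s * cnorm t by rewrite mulr_ge0 ?cnorm_ge0.
have pE : (cnorm s * cnorm t) ^+ 2 = (2 - 2 * re s) * (2 - 2 * re t).
  by rewrite exprMn !sqr_cnorm.
move: (cnorm s * cnorm t) p0 pE => p p0 pE.
have hb : (im s * im t) ^+ 2 = (1 - re s ^+ 2) * (1 - re t ^+ 2).
  have -> : 1 - re s ^+ 2 = im s ^+ 2 by rewrite -hs; ring.
  have -> : 1 - re t ^+ 2 = im t ^+ 2 by rewrite -ht; ring.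
  by rewrite exprMn.
(* The squares of the two sides of the triangle inequality differ by [2 (1 - re s) (1 - re t) + 2 (p
   - im s * im t)]. The bound on the last product follows by comparing squares, as
   [(1 + re s) (1 + re t) <= 4]. *)
have : im s * im t <= p.
  have [//|lt] := leP (im s * im t) p.
  have : p ^+ 2 < (im s * im t) ^+ 2 by rewrite ltr_pXn2r ?nnegrE//; apply: le_trans p0 (ltW lt).
  have : 0 <= (1 - re s) * (1 - re t) by apply: mulr_ge0; lra.
  have : 0 <= (1 - re s) * (1 - re t) * (4 - (1 + re s) * (1 + re t)).
    by apply: mulr_ge0; nra.
  by rewrite pE hb; nra.
by nra.
Qed.

Lemma cnormB s t : cnorm (s - t) <= cnorm s + cnorm t.
Proof. by rewrite -(cnormN t) cnormD. Qed.

Lemma cnorm_tri t s u : cnorm (s - u) <= cnorm (s - t) + cnorm (t - u).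
Proof. by rewrite (le_trans _ (cnormD _ _))// addrA subrK. Qed.

Lemma cnormMn t n : cnorm (t *+ n) <= cnorm t *+ n.
Proof.
elim: n => [|n IH]; first by rewrite !mulr0n cnorm0.
by rewrite !mulrS (le_trans (cnormD _ _))// lerD2l.
Qed.

Lemma cnormMz t n : cnorm (t *~ n) <= cnorm t *+ `|n|%N.
Proof. by case: n => n; rewrite ?NegzE ?mulrNz ?cnormN -?pmulrn cnormMn. Qed.

Lemma cnorm_lt1_re t : cnorm t < 1 -> 0 < re t.
Proof.
move=> h; have : cnorm t ^+ 2 < 1 by rewrite expr_lt1 ?cnorm_ge0.
by rewrite sqr_cnorm; lra.
Qed.

Lemma cnorm_re t (e : R) : 0 < e -> 1 - e ^+ 2 / 2 < re t -> cnorm t < e.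
Proof.
move=> e0 h; rewrite -(@ltr_pXn2r _ 2) ?nnegrE ?cnorm_ge0 ?(ltW e0) //.
by rewrite sqr_cnorm; lra.
Qed.

Lemma dist_re s t : `|re s - re t| <= cnorm (s - t).
Proof.
rewrite -(@ler_pXn2r _ 2) ?nnegrE ?cnorm_ge0 ?normr_ge0// real_normK ?num_real//.
rewrite sqr_cnorm reB.
by have := reim1 s; have := reim1 t; have := sqr_ge0 (im s - im t); nra.
Qed.

(* doubling expands the distance to 0 by at least sqrt 2 on the half circle *)
Lemma no_small_subgroup t : (forall n, cnorm (t *+ n) < 1) -> t = 0.
Proof.
move=> h; apply: contrapT => tn0.
have lt1 : re t < 1.
  have := re_le1 t; rewrite ler_norml => /andP[_]; rewrite le_eqVlt => /orP[/eqP/re_eq1//|//].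
have step u : cnorm u < 1 -> 2 * (1 - re u) <= 1 - re (u *+ 2).
  move=> /cnorm_lt1_re u0; rewrite mulr2n reD -!expr2.
  by have := reim1 u; have := re_le1 u; rewrite ler_norml; nra.
have grow n : 2 ^+ n * (1 - re t) <= 1 - re (t *+ (2 ^ n)).
  elim: n => [|n IH]; first by rewrite expr0 mul1r expn0 mulr1n.
  rewrite expnSr mulrnA; apply: le_trans (step _ (h _)).
  by rewrite exprS -mulrA ler_wpM2l.
have bnd n : n%:R * (1 - re t) <= 2.
  have : (1 - re (t *+ (2 ^ n))) <= 2 by have := re_le1 (t *+ (2 ^ n)); rewrite ler_norml; lra.
  apply: le_trans; apply: le_trans (grow n).
  by apply: ler_wpM2r; [lra|rewrite -natrX ler_nat ltnW// ltn_expl].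
have d0 : 0 < 1 - re t by lra.
have := bnd (Num.bound (3 / (1 - re t))).
rewrite -ler_pdivlMr// leNgt => /negP; apply.
apply: lt_trans (archi_boundP _); last by rewrite divr_ge0 ?(ltW d0).
by rewrite ltr_pM2r ?invr_gt0 //; lra.
Qed.

(** The circle is given no topology of its own: convergence is measured by [cnorm], and its
    compactness is [ultra_tlim]. *)
Definition tlim (J : Type) (F : set_system J) (u : J -> circle) (t : circle) :=
  forall e : R, 0 < e -> F [set j | cnorm (u j - t) < e].

Lemma ultra_tlim (J : Type) (F : set_system J) (u : J -> circle) :
  UltraFilter F -> exists t, tlim F u t.
Proof.
move=> UF.
have [a ra] : exists a : R, (re \o u) @ F --> a.
  by apply: (@ultra_bounded_cvg _ _ _ _ 1); apply: filterE => j; exact: re_le1.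
have [b ib] : exists b : R, (im \o u) @ F --> b.
  by apply: (@ultra_bounded_cvg _ _ _ _ 1); apply: filterE => j; exact: im_le1.
have ab1 : a ^+ 2 + b ^+ 2 = 1.
  have : (fun j => re (u j) ^+ 2 + im (u j) ^+ 2) @ F --> a ^+ 2 + b ^+ 2.
    by rewrite !expr2; apply: cvgD; apply: cvgM.
  under eq_fun do rewrite reim1.
  by move=> /(cvg_unique (@Rhausdorff R))/(_ (cvg_cst _)).
have [t [ta tb]] := circle_ex ab1.
exists t => e e0.
have : (fun j => re (u j - t)) @ F --> (1 : R).
  under eq_fun do rewrite reB ta tb.
  by rewrite -ab1 !expr2; apply: cvgD; apply: cvgMl.
move=> /cvgrPdist_lt/(_ (e ^+ 2 / 2)) h.
have {}h := h (divr_gt0 (exprn_gt0 2 e0) (ltr0Sn _ 1)).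
near=> j; apply: cnorm_re => //.
have : `|1 - re (u j - t)| < e ^+ 2 / 2 by near: j.
by rewrite ltr_norml; lra.
Unshelve. all: by end_near. Qed.

Section Tlim.
Context (J : Type) (F : set_system J) {PF : ProperFilter F}.
Implicit Types u v : J -> circle.

Lemma tlim_unique u s t : tlim F u s -> tlim F u t -> s = t.
Proof.
move=> us ut; apply/eqP; rewrite -subr_eq0; apply/eqP/cnorm_eq0/le_anti.
rewrite cnorm_ge0 andbT; apply/ler_addgt0Pr => e e0; rewrite add0r.
have e20 : 0 < e / 2 by rewrite divr_gt0.
have [j [/= h1 h2]] := filter_ex (filterI (us _ e20) (ut _ e20)).
apply: le_trans (cnorm_tri (u j) _ _) _; rewrite (cnorm_distC s).
by rewrite (splitr e) lerD// ltW.
Qed.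

Lemma tlimD u v s t : tlim F u s -> tlim F v t -> tlim F (fun j => u j + v j) (s + t).
Proof.
move=> us vt e e0; have e20 : 0 < e / 2 by rewrite divr_gt0.
apply: filterS (filterI (us _ e20) (vt _ e20)) => j [/= h1 h2].
rewrite opprD addrACA (le_lt_trans (cnormD _ _))// (splitr e) ltrD//.
Qed.

Lemma tlim_cst s : tlim F (fun=> s) s.
Proof. by move=> e e0; apply: filterE => j /=; rewrite subrr cnorm0. Qed.

Lemma tlim_near u v s : F [set j | u j = v j] -> tlim F u s -> tlim F v s.
Proof.
by move=> uv us e e0; apply: filterS (filterI uv (us _ e0)) => j [/= ->].
Qed.

Lemma tlim_sum (I : Type) (r : seq I) (u : I -> J -> circle) (s : I -> circle) :
  (forall i, tlim F (u i) (s i)) ->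
  tlim F (fun j => \sum_(i <- r) u i j) (\sum_(i <- r) s i).
Proof.
move=> us; elim: r => [|i r IH].
  rewrite big_nil; apply: tlim_near (tlim_cst 0).
  by apply: filterE => j /=; rewrite big_nil.
rewrite big_cons; apply: tlim_near (tlimD (us i) IH).
by apply: filterE => j /=; rewrite big_cons.
Qed.

Lemma tlimMz u s n : tlim F u s -> tlim F (fun j => u j *~ n) (s *~ n).
Proof.
move=> us e e0; have e1 : 0 < e / (`|n|%N.+1)%:R by rewrite divr_gt0 ?ltr0n.
apply: filterS (us _ e1) => j /=; rewrite -mulrzBl => h.
apply: le_lt_trans (cnormMz _ _) _; rewrite -mulr_natr.
apply: (@le_lt_trans _ _ (cnorm (u j - s) * (`|n|%N.+1)%:R)).
  by rewrite ler_wpM2l ?cnorm_ge0// ler_nat.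
by rewrite -ltr_pdivlMr ?ltr0n.
Qed.

End Tlim.

Lemma hom_tlim (J : Type) (F : set_system J) (M : zmodType)
    (u : J -> M -> circle) (h : M -> circle) : ProperFilter F ->
  F [set j | hom (u j)] -> (forall x, tlim F (u ^~ x) (h x)) -> hom h.
Proof.
move=> PF hu uh x y; apply: tlim_unique (uh _) _.
apply: tlim_near (tlimD (uh x) (uh y)).
by apply: filterS hu => j /= ->.
Qed.

Fact expi_subproof (x : R) : cos x ^+ 2 + sin x ^+ 2 == 1.
Proof. by rewrite cos2Dsin2. Qed.
Definition expi (x : R) := @Circle (_, _) (expi_subproof x).

Lemma re_expi x : re (expi x) = cos x. Proof. by []. Qed.
Lemma expiD : {morph expi : x y / x + y}.
Proof.
move=> x y; apply: circle_eq; rewrite ?reD ?imD /re /im /= ?cosD ?sinD //.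
by rewrite addrC.
Qed.

Lemma expi_surj t : exists x, expi x = t.
Proof.
have /andP[h1 h2] : -1 <= re t <= 1 by rewrite -ler_norml re_le1.
have hh : re t \in `[(-1 : R), 1] by rewrite in_itv /= h1.
have [i0|i0] := leP 0 (im t).
  exists (acos (re t)); apply: circle_eq; rewrite /re/im/=; first exact: acosK.
  rewrite sin_acos -/(re t) ?h1//.
  have -> : 1 - re t ^+ 2 = im t ^+ 2 by rewrite -(reim1 t); ring.
  by rewrite sqrtr_sqr ger0_norm.
exists (- acos (re t)); apply: circle_eq; rewrite /re/im/= ?cosN; first exact: acosK.
rewrite sinN sin_acos -/(re t) ?h1//.
have -> : 1 - re t ^+ 2 = im t ^+ 2 by rewrite -(reim1 t); ring.
by rewrite sqrtr_sqr ltr0_norm // opprK.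
Qed.

Lemma expi2pi : expi (pi *+ 2) = 0.
Proof. by apply: circle_eq; rewrite /re/im/= ?cos2pi ?sin2pi. Qed.

Lemma expi_small (e : R) : 0 < e -> exists2 d : R, 0 < d & forall x, `|x| < d ->
  cnorm (expi x) < e.
Proof.
move=> e0; have := @continuous_cos R 0; rewrite /continuous_at cos0.
move=> /cvgrPdist_lt/(_ (e ^+ 2 / 2)) h.
have /nbhs_ballP[d /= d0 hd] := h (divr_gt0 (exprn_gt0 2 e0) (ltr0Sn _ 1)).
exists d => // x xd; apply: cnorm_re => //; rewrite re_expi.
have /= := hd x; rewrite /ball /= sub0r normrN => /(_ xd).
by rewrite ltr_norml; lra.
Qed.

Lemma circle_div t n : (0 < n)%N -> exists s : circle, s *+ n = t.
Proof.
move=> n0; have [x <-] := expi_surj t; exists (expi (x / n%:R)).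
rewrite -(homMn expiD) -[_ *+ n]mulr_natr divfK//.
by rewrite pnatr_eq0 -lt0n.
Qed.

Definition tors2 (t : circle) := exists n, t *+ 2 ^ n = 0.

Lemma tors2_dense t (e : R) : 0 < e -> exists2 s, tors2 s & cnorm (t - s) < e.
Proof.
move=> e0; have [x <-] := expi_surj t.
have [d d0 hd] := expi_small e0.
pose p : R := pi *+ 2; have p0 : 0 < p by rewrite /p mulr2n addr_gt0 ?pi_gt0.
have [n hn] : exists n, p / (2 ^ n)%:R < d.
  exists (Num.bound (p / d)); rewrite ltr_pdivrMr ?ltr0n ?expn_gt0//.
  rewrite mulrC -ltr_pdivrMr//.
  apply: lt_le_trans (archi_boundP _) _; first by rewrite divr_ge0 ?ltW.
  by rewrite ler_nat ltnW// ltn_expl.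
set q : R := p / (2 ^ n)%:R; have q0 : 0 < q by rewrite divr_gt0 ?ltr0n ?expn_gt0.
pose k := Num.floor (x / q).
exists (expi (q *~ k)).
  have qp : q *+ 2 ^ n = p.
    by rewrite -[_ *+ _]mulr_natr /q divfK// pnatr_eq0 -lt0n expn_gt0.
  exists n; rewrite -(homMn expiD) pmulrn mulrzAC -pmulrn qp.
  by rewrite (homMz expiD) expi2pi mul0rz.
rewrite -(homB expiD); apply: hd.
have /andP[h1 h2] : k%:~R <= x / q < (k + 1)%:~R by rewrite floor_le_tmp lt_succ_floor.
rewrite -mulrzr ger0_norm ?subr_ge0; last by rewrite mulrC -ler_pdivlMr.
apply: le_lt_trans hn; rewrite -/q lerBlDr.
by move: h2; rewrite ltr_pdivrMr// intrD mulrDl mul1r [q * _]mulrC addrC => /ltW.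
Qed.

Lemma tors2_sub s t : tors2 s -> tors2 t -> tors2 (s - t).
Proof.
move=> [n hn] [m hm]; exists (n + m)%N.
by rewrite expnD mulrnBl mulrnA hn mul0rn mulnC mulrnA hm mul0rn subr0.
Qed.

Lemma mulrn_eqmod (M : zmodType) (x : M) N m m' : x *+ N = 0 ->
  m = m' %[mod N] -> x *+ m = x *+ m'.
Proof.
move=> xN mm'; rewrite (divn_eq m N) (divn_eq m' N) mm' !mulrnDr.
by rewrite !(mulnC _ N) !mulrnA xN !mul0rn.
Qed.

(** The power of 2 in [n] is divided out in the circle, and the odd part of [n] is invertible modulo
    the order of the result. *)
Lemma tors2_div t n : (0 < n)%N -> tors2 t -> exists2 s, tors2 s & s *+ n = t.
Proof.
move=> n0 [k hk]; have [b b2 nE] := pfactor_coprime (isT : prime 2) n0.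
set a := logn 2 n in nE.
have [s0 hs0] := circle_div t (expn_gt0 2 a : (0 < 2 ^ a)%N).
have s0N : s0 *+ 2 ^ (a + k) = 0 by rewrite expnD mulrnA hs0.
have b0 : (0 < b)%N by case: b b2 nE => // _ nE; rewrite nE in n0.
have cop : coprime b (2 ^ (a + k)) by rewrite coprime_sym coprimeXl.
case: (egcdnP (2 ^ (a + k)) b0) => u v; rewrite (eqnP cop) => hu _.
exists (s0 *+ u); first by exists (a + k)%N; rewrite mulrnAC s0N mul0rn.
rewrite nE -mulrnA mulnA mulrnA -hs0; congr (_ *+ _).
by rewrite -[RHS]mulr1n; apply: mulrn_eqmod s0N _; rewrite hu modnMDl.
Qed.

End Circle.

(** * Invariant means *)

Section Mean.
Variables (R : realType) (M : zmodType).
Implicit Types (phi psi : M -> R) (A B C : seq M).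

Definition avg A phi : R := (\sum_(a <- A) phi a) / (size A)%:R.

Definition ssum A B : seq M := [seq a + b | a <- A, b <- B].

Lemma avg_ssum A B phi :
  avg (ssum A B) phi = avg B (fun b => avg A (fun a => phi (a + b))).
Proof.
rewrite /avg /ssum size_allpairs natrM invfM mulrA [in RHS]mulrC.
rewrite big_allpairs_dep exchange_big /= [LHS]mulrC; congr (_ * _).
by rewrite mulr_suml.
Qed.

Lemma eq_avg A phi psi : phi =1 psi -> avg A phi = avg A psi.
Proof. by move=> e; rewrite /avg; under eq_bigr do rewrite e. Qed.

Lemma avgD A phi psi : avg A (fun x => phi x + psi x) = avg A phi + avg A psi.
Proof. by rewrite /avg big_split mulrDl. Qed.

Lemma avgZ A c phi : avg A (fun x => c * phi x) = c * avg A phi.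
Proof. by rewrite /avg -mulr_sumr mulrA. Qed.

Lemma avg_cst A c : A != [::] -> avg A (fun=> c) = c.
Proof.
move=> A0; rewrite /avg big_const_seq count_predT iter_addr_0 -[c *+ _]mulr_natr mulfK// pnatr_eq0.
by rewrite size_eq0.
Qed.

Lemma ler_avg A phi psi : (forall x, phi x <= psi x) -> avg A phi <= avg A psi.
Proof.
move=> h; rewrite /avg ler_wpM2r ?invr_ge0 ?ler0n//.
by apply: ler_sum => x _; exact: h.
Qed.

Lemma avg_norm A phi b : A != [::] -> (forall x, `|phi x| <= b) -> `|avg A phi| <= b.
Proof.
move=> A0 h; rewrite ler_norml; apply/andP; split.
  rewrite -[leLHS](@avg_cst A)//; apply: ler_avg => x.
  by have := h x; rewrite ler_norml => /andP[].
rewrite -[leRHS](@avg_cst A)//; apply: ler_avg => x.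
by have := h x; rewrite ler_norml => /andP[].
Qed.

Definition bdd phi := exists b, forall x, `|phi x| <= b.

(** Averaging over [A] factors through averaging over translates of [B], so [A] inherits every
    near-invariance of [B]. *)
Definition refines B A := A != [::] /\ exists2 C, C != [::] &
  forall phi, avg A phi = avg C (fun c => avg B (fun b => phi (b + c))).

Lemma refines_refl B : B != [::] -> refines B B.
Proof.
move=> B0; split=> //; exists [:: 0] => // phi.
by rewrite [RHS]/avg big_seq1 divr1; apply: eq_avg => x; rewrite addr0.
Qed.

Lemma ssum_neq0 A B : A != [::] -> B != [::] -> ssum A B != [::].
Proof. by rewrite -!size_eq0 size_allpairs muln_eq0 negb_or => -> ->. Qed.

(** Commutativity lets either summand be averaged first. This makes refinement directed, as
    [ultra_base] requires. *)
Lemma refines_ssum B1 B2 A : B1 != [::] -> B2 != [::] ->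
  refines (ssum B1 B2) A -> refines B1 A /\ refines B2 A.
Proof.
move=> B10 B20 [A0 [C C0 h]]; split; split=> //.
  exists (ssum B2 C); first exact: ssum_neq0.
  move=> phi; rewrite h avg_ssum; apply: eq_avg => c; rewrite avg_ssum.
  by apply: eq_avg => b; apply: eq_avg => b'; rewrite addrA.
exists (ssum B1 C); first exact: ssum_neq0.
move=> phi; rewrite h avg_ssum; apply: eq_avg => c; rewrite avg_ssum.
rewrite /avg; under eq_bigr do rewrite mulr_suml.
rewrite exchange_big /= mulr_suml [RHS]mulr_suml; apply: eq_bigr => b _.
rewrite !mulr_suml; apply: eq_bigr => b' _.
by rewrite mulrAC addrCA addrA.
Qed.

Definition prog (s : M) n := [seq s *+ i | i <- iota 0 n.+1].

Lemma prog_neq0 s n : prog s n != [::].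
Proof. by rewrite -size_eq0 size_map size_iota. Qed.

Lemma avg_prog s n phi : avg (prog s n) (fun x => phi (x + s) - phi x) =
  (phi (s *+ n.+1) - phi 0) / n.+1%:R.
Proof.
rewrite /avg /prog size_map size_iota big_map; congr (_ / _).
rewrite -/(index_iota 0 n.+1) -[in RHS](mulr0n s) -(@telescope_sumr _ 0 n.+1 (fun i => phi (s *+ i)))//.
by apply: eq_bigr => i _; rewrite mulrSr.
Qed.

Lemma refines_prog s n A phi b : refines (prog s n) A -> (forall x, `|phi x| <= b) ->
  `|avg A (fun x => phi (x + s) - phi x)| <= (b *+ 2) / n.+1%:R.
Proof.
move=> [A0 [C C0 h]] hb; rewrite h; apply: avg_norm => // c.
under eq_avg do rewrite addrAC.
rewrite (avg_prog s n (fun x => phi (x + c))) normrM [`|_^-1|]ger0_norm ?invr_ge0 ?ler0n//.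
rewrite ler_wpM2r ?invr_ge0 ?ler0n//.
by rewrite mulr2n (le_trans (ler_normB _ _))// lerD.
Qed.

(** The mean is the limit of the averages along an ultrafilter that eventually refines each finite
    set. Averages refining the progression [0, s, ..., n s] change under translation by [s] by at
    most [2 b / (n + 1)], by telescoping; hence the limit is invariant. *)
Lemma mean_ex : exists m : (M -> R) -> R,
  [/\ forall phi psi, bdd phi -> bdd psi ->
        m (fun x => phi x + psi x) = m phi + m psi,
      forall c phi, bdd phi -> m (fun x => c * phi x) = c * m phi,
      forall phi, bdd phi -> (forall x, 0 <= phi x) -> 0 <= m phi,
      m (fun=> 1) = 1 &
      forall phi s, bdd phi -> m (fun x => phi (x + s)) = m phi].
Proof.
have [|B1 B2 b1 b2|B B0|U [UU UB]] :=
    @ultra_base (seq M) (seq M) [set B | B != [::]] (fun B => refines B).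
- by exists [:: 0].
- exists (ssum B1 B2); first exact: ssum_neq0.
  by move=> A /(refines_ssum b1 b2).
- by exists B; apply: refines_refl.
have UN : U [set A | A != [::]].
  by apply: filterS (UB [:: 0] isT) => A [].
pose m phi : R := lim ((avg ^~ phi) @ U).
have cvm phi : bdd phi -> (avg ^~ phi) @ U --> m phi.
  move=> [b hb]; have [l hl] : exists l : R, (avg ^~ phi) @ U --> l.
    apply: (ultra_bounded_cvg (B := b)).
    by apply: filterS UN => A A0 /=; apply: avg_norm.
  by rewrite /m (cvg_lim _ hl).
have mE phi (l : R) : (avg ^~ phi) @ U --> l -> m phi = l.
  by move=> h; apply: cvg_lim.
exists m; split.
- move=> phi psi bphi bpsi; apply: mE.
  under eq_fun do rewrite avgD.
  by apply: cvgD; apply: cvm.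
- move=> c phi bphi; apply: mE.
  under eq_fun do rewrite avgZ.
  by apply: cvgMr; apply: cvm.
- move=> phi bphi p0; apply: limr_ge; first by apply/cvg_ex; exists (m phi); exact: cvm.
  near=> A; rewrite -(@avg_cst A 0); first exact: ler_avg.
  by near: A.
- apply: mE; apply: cvg_near_cst; near=> A; rewrite avg_cst//.
  by near: A.
- move=> phi s [b hb].
  have bd : bdd (fun x => phi (x + s)) by exists b.
  apply: mE; rewrite -[m phi]add0r.
  have -> : (fun A => avg A (fun x => phi (x + s))) =
      (fun A => avg A (fun x => phi (x + s) - phi x) + avg A phi).
    by apply/funext => A; rewrite -avgD; apply: eq_avg => x; rewrite subrK.
  apply: cvgD; last by apply: cvm; exists b.
  have b0 : 0 <= b by apply: le_trans (hb 0).
  apply/cvgrPdist_le => e e0.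
  have [n hn] := archi_small (b *+ 2) e0.
  apply: filterS (UB _ (prog_neq0 s n)) => A rA; rewrite /= sub0r normrN.
  exact: le_trans (refines_prog rA hb) (ltW hn).
Unshelve. all: by end_near. Qed.

Lemma mean_sum (m : (M -> R) -> R) :
  (forall phi psi, bdd phi -> bdd psi -> m (fun x => phi x + psi x) = m phi + m psi) ->
  (forall c phi, bdd phi -> m (fun x => c * phi x) = c * m phi) ->
  forall (I : Type) (r : seq I) (F : I -> M -> R), (forall i, bdd (F i)) ->
  m (fun x => \sum_(i <- r) F i x) = \sum_(i <- r) m (F i).
Proof.
move=> mD mZ I r F bF.
have b0 : bdd (fun=> 0) by exists 0 => x; rewrite normr0.
have m0 : m (fun=> 0) = 0.
  by have := mZ 0 (fun=> 0) b0; rewrite !mul0r.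
have bs s : bdd (fun x => \sum_(i <- s) F i x).
  elim: s => [|i s [b hb]]; first by exists 0 => x; rewrite big_nil normr0.
  have [c hc] := bF i; exists (c + b) => x; rewrite big_cons.
  by rewrite (le_trans (ler_normD _ _))// lerD.
elim: r => [|i r IH].
  by rewrite big_nil -m0; congr m; apply/funext => x; rewrite big_nil.
rewrite big_cons -IH -mD//; congr m.
by apply/funext => x; rewrite big_cons.
Qed.

End Mean.

(** * Positive definite functions *)

Section PosDef.
Variables (R : realType) (M : zmodType).
Implicit Types (f g phi psi : M -> R) (w : seq (R * M)).

(** A list of weighted points stands for a finitely supported real measure, and [Bf f] is the
    bilinear form that [f] defines on such measures. *)
Definition Bf f w v := \sum_(x <- w) \sum_(y <- v) x.1 * y.1 * f (x.2 - y.2).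

Definition pd f := (forall t, f (- t) = f t) /\ forall w, 0 <= Bf f w w.

Lemma Bf_cat f w v : (forall t, f (- t) = f t) ->
  Bf f (w ++ v) (w ++ v) = Bf f w w + Bf f w v *+ 2 + Bf f v v.
Proof.
move=> ev; rewrite /Bf big_cat /=.
under eq_bigr do rewrite big_cat /=.
under [X in _ + X]eq_bigr do rewrite big_cat /=.
rewrite !big_split /= mulr2n -!addrA; congr (_ + (_ + _)).
congr (_ + _); rewrite exchange_big /=.
apply: eq_bigr => x _; apply: eq_bigr => y _.
by rewrite mulrAC mulrC mulrA -ev opprB mulrAC [x.1 * _]mulrC.
Qed.

Lemma pd_bound f t : pd f -> `|f t| <= f 0.
Proof.
move=> [ev h]; rewrite ler_norml.
have := h [:: (1, t); (1, 0)]; have := h [:: (1, t); (-1, 0)].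
rewrite /Bf !big_cons !big_nil /= !subrr subr0 sub0r ev; lra.
Qed.

Lemma pd_ge0 f : pd f -> 0 <= f 0.
Proof. by move=> /(@pd_bound _ 0); apply: le_trans. Qed.

Lemma BfD f g w v : Bf (fun x => f x + g x) w v = Bf f w v + Bf g w v.
Proof.
rewrite /Bf -big_split; apply: eq_bigr => x _; rewrite -big_split.
by apply: eq_bigr => y _; rewrite mulrDr.
Qed.

Lemma BfZ c f w v : Bf (fun x => c * f x) w v = c * Bf f w v.
Proof.
rewrite /Bf mulr_sumr; apply: eq_bigr => x _; rewrite mulr_sumr.
by apply: eq_bigr => y _; rewrite mulrCA.
Qed.

Lemma pdZ c f : 0 <= c -> pd f -> pd (fun x => c * f x).
Proof.
by move=> c0 [fe fp]; split=> [t|w]; rewrite ?fe// BfZ mulr_ge0.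
Qed.

Definition dil (e : R) (s : M) w := [seq (e * x.1, x.2 + s) | x <- w].

Lemma Bf_dil e s f w v : Bf f w (dil e s v) = e * Bf (fun t => f (t - s)) w v.
Proof.
rewrite /Bf mulr_sumr; apply: eq_bigr => x _; rewrite big_map mulr_sumr.
by apply: eq_bigr => y _ /=; rewrite opprD addrA; ring.
Qed.

Lemma Bf_dil2 e s f w : Bf f (dil e s w) (dil e s w) = e ^+ 2 * Bf f w w.
Proof.
rewrite /Bf big_map mulr_sumr; apply: eq_bigr => x _; rewrite big_map mulr_sumr.
by apply: eq_bigr => y _ /=; rewrite opprD addrACA subrr addr0; ring.
Qed.

Lemma Bf_even f w s : (forall t, f (- t) = f t) ->
  Bf (fun t => f (t + s)) w w = Bf (fun t => f (t - s)) w w.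
Proof.
move=> ev; rewrite /Bf exchange_big; apply: eq_bigr => x _; apply: eq_bigr => y _.
by rewrite -ev opprD opprB mulrC [_ * y.1]mulrC mulrC.
Qed.

(** The form of the new function at [w] is half the form of [f] at [w] plus [e] times a translate of
    [w]. For [e = 1] and [e = -1] the two functions average to [f], which is how extreme points get
    tested. *)
Lemma pd_shift e s f : e ^+ 2 = 1 -> pd f ->
  pd (fun t => f t + e / 2 * (f (t + s) + f (t - s))).
Proof.
move=> e1 [ev fp]; split=> [t|w].
  rewrite ev; congr (_ + _ * _).
  by rewrite addrC; congr (_ + _); rewrite -[LHS]ev; congr f; zmod.
have := fp (w ++ dil e s w); rewrite Bf_cat// Bf_dil Bf_dil2 e1 mul1r.
rewrite BfD BfZ BfD (Bf_even w s ev).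
set B := Bf (fun t => f (t - s)) w w; have -> : e / 2 * (B + B) = e * B by field.
by lra.
Qed.

(** The Cauchy-Schwarz inequality for [w] and its translate. *)
Lemma pd_shift_bound f w s : pd f -> `|Bf (fun t => f (t + s)) w w| <= Bf f w w.
Proof.
move=> [ev fp]; rewrite ler_norml (Bf_even _ _ ev).
have := fp (w ++ dil 1 s w); have := fp (w ++ dil (-1) s w).
rewrite !Bf_cat// !Bf_dil2 !Bf_dil ?sqrrN ?expr1n; lra.
Qed.

(** By the cosine formula for a difference, the form splits into those of [w] reweighted by [re chi]
    and by [im chi]. *)
Lemma pd_mul_re f (chi : M -> circle R) : hom chi -> pd f ->
  pd (fun t => f t * re (chi t)).
Proof.
move=> hc [ev fp]; split=> [t|w]; first by rewrite ev (homN hc) reN.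
pose wr := [seq (x.1 * re (chi x.2), x.2) | x <- w].
pose wi := [seq (x.1 * im (chi x.2), x.2) | x <- w].
have -> : Bf (fun t => f t * re (chi t)) w w = Bf f wr wr + Bf f wi wi.
  rewrite /Bf !big_map -big_split; apply: eq_bigr => x _.
  rewrite !big_map -big_split; apply: eq_bigr => y _ /=.
  by rewrite (homB hc) reB; ring.
by rewrite addr_ge0.
Qed.

Lemma pd_cst (c : R) : 0 <= c -> pd (fun=> c).
Proof.
move=> c0; split=> // w; rewrite /Bf.
under eq_bigr do rewrite -mulr_suml -mulr_sumr.
by rewrite -mulr_suml -mulr_suml mulr_ge0// -expr2 sqr_ge0.
Qed.

Lemma pd_re (chi : M -> circle R) : hom chi -> pd (fun t => re (chi t)).
Proof.
move=> hc; have := pd_mul_re hc (pd_cst ler01).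
by congr pd; apply/funext => t; rewrite mul1r.
Qed.

(** The last hypothesis is d'Alembert's functional equation of the cosine. If all values are 1 or
    -1, then [a] is itself a character; otherwise a point [s0] with [a s0 ^ 2 != 1] provides a
    sine. *)
Lemma dalembert_char (a : M -> R) : a 0 = 1 -> (forall t, `|a t| <= 1) ->
  (forall t, a (- t) = a t) ->
  (forall t s, a (t + s) + a (t - s) = 2 * (a s * a t)) ->
  exists2 chi : M -> circle R, hom chi & forall t, re (chi t) = a t.
Proof.
move=> a0 a1 ev da.
have [h|/existsNP[s0 hs0]] := pselect (forall s, a s ^+ 2 = 1).
  have hh t : a t ^+ 2 + 0 ^+ 2 == 1 by rewrite h expr0n addr0.
  exists (fun t => @Circle R (a t, 0) (hh t)) => // t s.
  apply: circle_eq; rewrite ?reD ?imD /re /im /=; last by ring.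
  have := da t s; have := a1 (t + s); have := a1 (t - s); rewrite !ler_norml.
  have : (a t * a s) ^+ 2 = 1 by rewrite exprMn !h mulr1.
  rewrite [a s * _]mulrC; move: (a t * a s) => p /eqP; rewrite sqrf_eq1 => /orP[] /eqP ->; lra.
(* If [a] is a cosine, this is [sin t * sin s0], and [b2] below is [sin s0 ^ 2]; dividing by its
   root gives the sine up to sign. [cc] and [cs] are the addition formulas of cosine and sine. *)
pose c t := a (t - s0) - a t * a s0.
have cE t : c t = (a (t - s0) - a (t + s0)) / 2.
  by rewrite /c; have := da t s0; lra.
pose b2 := 1 - a s0 ^+ 2.
have b20 : 0 < b2.
  rewrite /b2; have := a1 s0; rewrite ler_norml => h.
  have : a s0 ^+ 2 <> 1 by [].
  move=> /eqP; rewrite sqrf_eq1 negb_or => /andP[/eqP n1 /eqP n2].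
  have : a s0 < 1 by rewrite lt_neqAle; apply/andP; split; [apply/eqP|lra].
  have : -1 < a s0 by rewrite lt_neqAle; apply/andP; split; [apply/eqP => e; apply: n2|lra].
  by nra.
have a2s : 1 - a (s0 + s0) = 2 * b2.
  by have := da s0 s0; rewrite subrr a0 /b2; lra.
have cc t s : c t * c s = b2 * (a t * a s - a (t + s)).
  have e1 := da (t - s0) (s - s0); have e2 := da (t - s0) (s + s0).
  have e3 := da (t + s0) (s - s0); have e4 := da (t + s0) (s + s0).
  have e5 := da (t + s) (s0 + s0); have e6 := da (t - s) (s0 + s0).
  have e7 := da t s.
  have r1 : t - s0 + (s - s0) = t + s - (s0 + s0) by zmod.
  have r2 : t - s0 - (s - s0) = t - s by zmod.
  have r3 : t - s0 + (s + s0) = t + s by zmod.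
  have r4 : t - s0 - (s + s0) = t - s - (s0 + s0) by zmod.
  have r5 : t + s0 + (s - s0) = t + s by zmod.
  have r6 : t + s0 - (s - s0) = t - s + (s0 + s0) by zmod.
  have r7 : t + s0 + (s + s0) = t + s + (s0 + s0) by zmod.
  have r8 : t + s0 - (s + s0) = t - s by zmod.
  rewrite r1 r2 in e1; rewrite r3 r4 in e2; rewrite r5 r6 in e3; rewrite r7 r8 in e4.
  by rewrite !cE; nra.
have cs t s : c (t + s) = c t * a s + a t * c s.
  have e1 := da (t - s0) s; have e2 := da (t + s0) s.
  have e3 := da (s - s0) t; have e4 := da (s + s0) t.
  have r1 : t - s0 + s = t + s - s0 by rewrite addrAC.
  have r2 : t + s0 + s = t + s + s0 by rewrite addrAC.
  have r3 : s - s0 + t = t + s - s0 by rewrite addrC addrA.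
  have r4 : s + s0 + t = t + s + s0 by rewrite addrC addrA.
  have r5 : a (s - s0 - t) = a (t + s0 - s).
    by rewrite -ev; congr a; zmod.
  have r6 : a (s + s0 - t) = a (t - s0 - s) by rewrite -ev; congr a; zmod.
  rewrite r1 in e1; rewrite r2 in e2; rewrite r3 r5 in e3; rewrite r4 r6 in e4.
  by rewrite !cE; lra.
pose b := Num.sqrt b2; have bE : b ^+ 2 = b2 by rewrite sqr_sqrtr// ltW.
have b0 : b != 0 by rewrite -(sqrf_eq0 b) bE gt_eqF.
have hc t : a t ^+ 2 + (- (c t) / b) ^+ 2 == 1.
  have := cc t (- t); rewrite subrr a0 ev => h.
  have cn : c (- t) = - c t.
    rewrite !cE -(ev (- t - s0)) opprD !opprK -(ev (- t + s0)) opprD opprK; lra.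
  rewrite cn in h.
  apply/eqP; rewrite expr_div_n bE sqrrN.
  have -> : c t ^+ 2 = b2 * (1 - a t ^+ 2) by rewrite expr2; nra.
  by field; rewrite gt_eqF.
exists (fun t => @Circle R (a t, _) (hc t)) => // t s.
apply: circle_eq; rewrite ?reD ?imD /re /im /=.
  have -> : a (t + s) = a t * a s - c t * c s / b2.
    by rewrite cc; field; rewrite gt_eqF.
  by rewrite -bE; field.
by rewrite cs; field.
Qed.

End PosDef.

(** * Extreme points of the set of normalized positive definite functions *)

Section KreinMilman.
Variables (R : realType) (M : zmodType).
Implicit Types (f g phi psi : M -> R) (w : seq (R * M)) (F : set (M -> R)).

Definition npd f := pd f /\ f 0 = 1.

Definition plim (U : set_system (M -> R)) f :=
  forall t, (fun g => g t) @ U --> f t.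

Definition ell w f := \sum_(x <- w) x.1 * f x.2.

Lemma ell_cvg U f w : Filter U -> plim U f -> ell w @ U --> ell w f.
Proof.
move=> FU h; rewrite /ell; elim: w => [|x w IH].
  rewrite big_nil; under eq_fun do rewrite big_nil; exact: cvg_cst.
rewrite big_cons; under eq_fun do rewrite big_cons.
by apply: cvgD => //; apply: cvgMr; exact: h.
Qed.

Lemma npd_plim U f : UltraFilter U -> U npd -> plim U f -> npd f.
Proof.
move=> UU Un h; split; last first.
  apply: (cvg_unique (@Rhausdorff R) (h 0)); apply: cvg_near_cst.
  by apply: filterS Un => g [].
split=> [t|w].
  apply: (cvg_unique (@Rhausdorff R) (h (- t))); apply: cvg_trans (h t).
  apply: near_eq_cvg; near=> g; have [[-> //]] : npd g by near: g.
have Bell g : Bf g w w = ell [seq (x.1 * y.1, x.2 - y.2) | x <- w, y <- w] g.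
  by rewrite /ell big_allpairs_dep.
rewrite Bell -(cvg_lim _ (ell_cvg _ h))//; apply: limr_ge.
  by apply/cvg_ex; exists (ell [seq (x.1 * y.1, x.2 - y.2) | x <- w, y <- w] f); exact: ell_cvg.
by near=> g; rewrite -Bell; have [[]] : npd g by near: g.
Unshelve. all: by end_near. Qed.

Lemma plim_ex U : UltraFilter U -> U npd -> exists f, plim U f.
Proof.
move=> UU Un; suff : forall t, exists l : R, (fun g => g t) @ U --> l.
  by move=> /choice[f hf]; exists f.
move=> t; apply: (ultra_bounded_cvg (B := 1)).
by apply: filterS Un => g [gp g0] /=; rewrite -g0 pd_bound.
Qed.

(** A nonempty extreme subset of [npd], closed for pointwise convergence; closedness is phrased with
    ultrafilters so that [plim_ex] plays the role of compactness. *)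
Definition face F := [/\ F !=set0, F `<=` npd,
  forall U f, UltraFilter U -> U F -> plim U f -> F f &
  forall f g (c : R), npd f -> npd g -> 0 < c < 1 ->
    F (fun t => c * f t + (1 - c) * g t) -> F f].

Lemma face_npd : face npd.
Proof.
split=> //; last by move=> U f UU Un h; exact: npd_plim Un h.
by exists (fun=> 1); split=> //; apply: pd_cst.
Qed.

Definition argmax F w := [set f | F f /\ forall g, F g -> ell w g <= ell w f].

Lemma face_argmax F w : face F -> face (argmax F w).
Proof.
move=> [Fn0 FP Fc Ff]; split.
- have [||f Ff'|U [UU UF]] := @ultra_base (M -> R) (M -> R) F
      (fun g => [set f | F f /\ ell w g <= ell w f]).
  + by [].
  + move=> f g Ff' Fg; have [fg|gf] := leP (ell w f) (ell w g).
      by exists g => // h [/= Fh gh]; do 2 split=> //; apply: le_trans gh.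
    by exists f => // h [/= Fh fh]; do 2 split=> //; apply: le_trans fh; exact: ltW.
  + by exists f; split.
  have [f0 Ff0] := Fn0.
  have UF0 : U F by apply: filterS (UF _ Ff0) => g [].
  have [f hf] := plim_ex UU (filterS FP UF0).
  exists f; split; first exact: Fc hf.
  move=> g Fg; rewrite -(cvg_lim _ (ell_cvg (w := w) _ hf))//; apply: limr_ge.
    by apply/cvg_ex; exists (ell w f); exact: ell_cvg.
  by apply: filterS (UF _ Fg) => h [].
- by move=> f [/FP].
- move=> U f UU Ua hf; have UF0 : U F by apply: filterS Ua => g [].
  split; first exact: Fc hf.
  move=> g Fg; rewrite -(cvg_lim _ (ell_cvg (w := w) _ hf))//; apply: limr_ge.
    by apply/cvg_ex; exists (ell w f); exact: ell_cvg.
  by apply: filterS Ua => h [_]; apply.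
move=> f g c nf ng c01 [Fc' hmax]; have Ff' := Ff f g c nf ng c01 Fc'; split=> //.
have Fg : F g.
  apply: (Ff g f (1 - c)) => //; first by lra.
  by move: Fc'; congr F; apply/funext => t; ring.
have ellE : ell w (fun t => c * f t + (1 - c) * g t) = c * ell w f + (1 - c) * ell w g.
  rewrite /ell !mulr_sumr -big_split; apply: eq_bigr => x _ /=; ring.
move=> h Fh; apply: le_trans (hmax h Fh) _.
have := hmax _ Fg; rewrite ellE; nra.
Qed.

(** Zorn's lemma is applied to the removed part [X] of [F1], since it is available for unions of
    chains. The intersection of a chain of faces is nonempty by compactness. *)
Lemma min_face F1 : face F1 -> exists2 F0, face F0 &
  F0 `<=` F1 /\ forall F', face F' -> F' `<=` F0 -> F' = F0.
Proof.
move=> f1; have [C Ctot|A [fA maxA]] :=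
    @Zorn_bigcup _ [set X | face (F1 `\` X)].
  move=> totC /=.
  have [[X0 CX0]|C0] := pselect (C !=set0); last first.
    have -> : \bigcup_(X in C) X = set0.
      by apply/seteqP; split=> // x [X CX]; case: C0; exists X.
    by rewrite setD0.
  have [F1n0 F1P F1c F1f] := f1.
  have sub X : C X -> F1 `\` \bigcup_(X in C) X `<=` F1 `\` X.
    by move=> CX f [F1f' nf]; split=> // Xf; apply: nf; exists X.
  split.
  - have [||X CX|U [UU UF]] := @ultra_base _ _ C (fun X => F1 `\` X).
    + by exists X0.
    + move=> X Y CX CY; have [XY|YX] := totC _ _ CX CY.
        by exists Y => // f [F1f' nY]; do 2 split=> //; move/XY.
      by exists X => // f [F1f' nX]; do 2 split=> //; move/YX.
    + by have [] := Ctot _ CX.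
    have UF1 : U F1 by apply: filterS (UF _ CX0) => g [].
    have [f hf] := plim_ex UU (filterS F1P UF1).
    exists f; split; first exact: F1c hf.
    move=> [X CX Xf]; have [_ _ Xc _] := Ctot _ CX.
    by have [] := Xc U f UU (UF _ CX) hf.
  - by move=> f [/F1P].
  - move=> U f UU Uf hf; split.
      by apply: F1c hf => //; apply: filterS Uf => g [].
    move=> [X CX Xf]; have [_ _ Xc _] := Ctot _ CX.
    by have [] := Xc U f UU (filterS (sub _ CX) Uf) hf.
  - move=> f g c nf ng c01 h; split; first by apply: (F1f f g c) => //; case: h.
    move=> [X CX Xf]; have [_ _ _ Xff] := Ctot _ CX.
    by have [] := Xff f g c nf ng c01 (sub _ CX _ h).
exists (F1 `\` A) => //; split; first by move=> f [].
move=> F' fF' sub; apply: contrapT => ne.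
have [f [F1f nA] nF'] : exists2 f, (F1 `\` A) f & ~ F' f.
  apply: contrapT => h; apply: ne; apply/seteqP; split=> // f Af.
  by apply: contrapT => nf; apply: h; exists f.
apply: (maxA (~` F')).
  split; first by move=> g Ag F'g; have [] := sub _ F'g.
  by move=> /(_ f nF').
rewrite /=; move: fF'; congr face; apply/seteqP; split=> g.
  by move=> F'g; split; [have [] := sub _ F'g|move/(_ F'g)].
by move=> [_ /contrapT].
Qed.

(** The point [a] is the convex combination, with weights [(1 + a s) / 2] and [(1 - a s) / 2], of
    the normalizations of the two functions of [pd_shift]. Extremality makes the first one equal to
    [a], which is the equation. When a weight vanishes, the corresponding function is 0 by
    [pd_bound]. *)
Lemma face_dalembert F a : face F -> F = [set a] ->
  forall t s, a (t + s) + a (t - s) = 2 * (a s * a t).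
Proof.
move=> [_ FP _ Ff] FE t s.
have [pa a0] : npd a by apply: FP; rewrite FE.
have ev := pa.1.
have asE : a (0 + s) + a (0 - s) = 2 * a s by rewrite add0r sub0r ev; lra.
pose p (e : R) u := a u + e / 2 * (a (u + s) + a (u - s)).
have pp : pd (p 1) by apply: pd_shift => //; rewrite expr1n.
have pm : pd (p (-1)) by apply: pd_shift => //; rewrite sqrrN expr1n.
have p10 : p 1 0 = 1 + a s by rewrite /p asE a0; lra.
have pm0 : p (-1) 0 = 1 - a s by rewrite /p asE a0; lra.
have := pd_bound s pa; rewrite a0 ler_norml => /andP[h1 h2].
have [as1|as1] := eqVneq (a s) 1.
  have := pd_bound t pm; rewrite pm0 as1 subrr normr_le0 => /eqP.
  by rewrite /p; lra.
have [asm1|asm1] := eqVneq (a s) (-1).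
  have := pd_bound t pp; rewrite p10 asm1 subrr normr_le0 => /eqP.
  by rewrite /p; lra.
have l1 : 0 < 1 + a s by rewrite -ltrBlDl sub0r lt_neqAle eq_sym asm1.
have l2 : 0 < 1 - a s by rewrite subr_gt0 lt_neqAle as1.
have : F (fun u => (1 + a s)^-1 * p 1 u).
  apply: (Ff _ (fun u => (1 - a s)^-1 * p (-1) u) ((1 + a s) / 2)).
  - by split; [apply: pdZ => //; rewrite invr_ge0 ltW|rewrite p10 mulVf ?gt_eqF].
  - by split; [apply: pdZ => //; rewrite invr_ge0 ltW|rewrite pm0 mulVf ?gt_eqF].
  - by lra.
  - rewrite FE /=; apply/funext => u; rewrite /p.
    by field; rewrite !gt_eqF.
rewrite FE => /(congr1 (fun f => f t)) /= h.
have : p 1 t = (1 + a s) * a t by rewrite -h mulrA mulfV ?mul1r// gt_eqF.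
by rewrite /p; lra.
Qed.

(** Krein-Milman: the functional attains its maximum on a face, and a minimal face in it is a single
    point, because each evaluation at a [t] is maximal on a subface and hence constant. That point
    is the real part of a character. *)
Lemma char_max w f : npd f -> exists2 chi : M -> circle R, hom chi &
  ell w f <= ell w (fun t => re (chi t)).
Proof.
move=> nf; have f1 := face_argmax w face_npd.
have [F0 f0 [F01 Fmin]] := min_face f1.
have [[a F0a] F0P _ _] := f0.
have FE : F0 = [set a].
  apply/seteqP; split=> [g F0g|g ->//]; apply/funext => t.
  have /Fmin F0E : face (argmax F0 [:: (1, t)]) by exact: face_argmax.
  have {}F0E : argmax F0 [:: (1, t)] = F0 by apply: F0E => h [].
  - rewrite -F0E in F0a F0g.
    have := F0g.2 _ F0a.1; have := F0a.2 _ F0g.1.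
    by rewrite /ell !big_seq1 /= !mul1r => h1 h2; apply/eqP; rewrite eq_le h1 h2.
have [pa a0] := F0P _ F0a.
have a1 t : `|a t| <= 1 by rewrite -a0 pd_bound.
have [chi hc cE] := dalembert_char a0 a1 pa.1 (face_dalembert f0 FE).
exists chi => //; have [_ h] := F01 _ F0a.
have -> : (fun t => re (chi t)) = a by apply/funext.
exact: h.
Qed.

(** Schur's product theorem. The functional [h] to [- Bf (f h) w w] is at most as large at the
    normalized [g] as at the real part of some character, and there [pd_mul_re] applies. *)
Lemma pdM f g : pd f -> pd g -> pd (fun t => f t * g t).
Proof.
move=> pf pg; have := pd_ge0 pg; rewrite le_eqVlt => /orP[/eqP g0|g0].
  have -> : (fun t => f t * g t) = fun=> 0.
    apply/funext => t; have := pd_bound t pg; rewrite -g0 normr_le0 => /eqP ->.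
    by rewrite mulr0.
  exact: pd_cst.
split=> [t|w]; first by rewrite pf.1 pg.1.
have np : npd (fun t => (g 0)^-1 * g t).
  by split; [apply: pdZ => //; rewrite invr_ge0 ltW|rewrite mulVf ?gt_eqF].
pose v := [seq (- (x.1 * y.1 * f (x.2 - y.2)), x.2 - y.2) | x <- w, y <- w].
have ev h : ell v h = - Bf (fun t => f t * h t) w w.
  rewrite /ell big_allpairs_dep /Bf -sumrN; apply: eq_bigr => x _.
  by rewrite -sumrN; apply: eq_bigr => y _ /=; ring.
have [chi hc] := char_max v np; rewrite !ev lerN2 => h.
have := (pd_mul_re hc pf).2 w => h0; have := le_trans h0 h.
rewrite -(pmulr_rge0 _ g0) -BfZ; congr (_ <= _).
by congr Bf; apply/funext => t; field; rewrite gt_eqF.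
Qed.

(** * Averages of positive definite functions *)

(** For positive definite [f] these averages over differences do not increase when [A] is enlarged
    to a sum set ([La_ssum]); they approach the mean of [f] from above. *)
Definition La (A : seq M) f : R := avg A (fun a => avg A (fun b => f (a - b))).

Lemma La_Bf A f : La A f = Bf f [seq ((size A)%:R^-1, a) | a <- A]
  [seq ((size A)%:R^-1, a) | a <- A].
Proof.
rewrite /La /avg /Bf big_map mulr_suml; apply: eq_bigr => a _.
rewrite big_map mulr_suml mulr_suml; apply: eq_bigr => b _ /=; ring.
Qed.

Lemma La_shift A f s : pd f -> `|La A (fun t => f (t + s))| <= La A f.
Proof. by move=> pf; rewrite !La_Bf; exact: pd_shift_bound. Qed.

Lemma La_avg2 A B f : La (ssum A B) f =
  avg B (fun b => avg B (fun b' => La A (fun t => f (t + (b - b'))))).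
Proof.
rewrite /La avg_ssum; apply: eq_avg => b.
under eq_avg do rewrite avg_ssum.
rewrite /avg -!mulr_suml exchange_big /= !mulr_suml; apply: eq_bigr => b' _.
rewrite !mulr_suml; apply: eq_bigr => a _; rewrite mulrAC; congr (_ / _ / _).
by congr (_ / _); apply: eq_bigr => a' _; congr f; zmod.
Qed.

Lemma La_ssum A B f : B != [::] -> pd f -> La (ssum A B) f <= La A f.
Proof.
move=> B0 pf; rewrite La_avg2; apply: le_trans (ler_norm _) _.
by apply: avg_norm => // b; apply: avg_norm => // b'; exact: La_shift.
Qed.

Lemma La_ssumr A B f : A != [::] -> pd f -> La (ssum A B) f <= La B f.
Proof.
move=> A0 pf; suff -> : La (ssum A B) f = La (ssum B A) f by exact: La_ssum.
rewrite /La !avg_ssum.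
have sw (h : M -> M -> R) : avg A (fun b => avg B (h b)) = avg B (fun a => avg A (h^~ a)).
  rewrite /avg -!mulr_suml exchange_big /= mulrAC; congr (_ / _ / _).
rewrite sw; apply: eq_avg => a; apply: eq_avg => b.
by rewrite !avg_ssum sw; apply: eq_avg => a'; apply: eq_avg => b'; congr f; zmod.
Qed.

Lemma LaD A f g : La A (fun t => f t + g t) = La A f + La A g.
Proof. by rewrite !La_Bf BfD. Qed.
Lemma LaZ A c f : La A (fun t => c * f t) = c * La A f.
Proof. by rewrite !La_Bf BfZ. Qed.
Lemma ler_La A f g : (forall t, f t <= g t) -> La A f <= La A g.
Proof. by move=> h; apply: ler_avg => a; apply: ler_avg => b. Qed.
Lemma La_cst A c : A != [::] -> La A (fun=> c) = c.
Proof. by move=> A0; rewrite /La avg_cst ?avg_cst. Qed.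

(** * Characters extracted from positive definite functions *)

Lemma refines_trans (A B C : seq M) :
  refines R A B -> refines R B C -> refines R A C.
Proof.
move=> [_ [D D0 hD]] [C0 [D' D'0 hD']]; split=> //.
exists (ssum D D'); first exact: ssum_neq0.
move=> phi; rewrite hD' avg_ssum; apply: eq_avg => c; rewrite hD.
by apply: eq_avg => d; apply: eq_avg => a; rewrite addrA.
Qed.

Lemma refines_progs n (l : seq M) :
  exists2 A : seq M, A != [::] & forall t, t \in l -> refines R (prog t n) A.
Proof.
elim: l => [|t l [A A0 hA]]; first by exists [:: 0].
have A'0 : ssum (prog t n) A != [::] by rewrite ssum_neq0// prog_neq0.
have [r1 r2] := refines_ssum (prog_neq0 t n) A0 (refines_refl R A'0).
exists (ssum (prog t n) A) => // s; rewrite inE => /orP[/eqP ->//|/hA h].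
exact: refines_trans h r2.
Qed.

Lemma avg_sum (A : seq M) (I : Type) (r : seq I) (G : I -> M -> R) :
  avg A (fun s => \sum_(i <- r) G i s) = \sum_(i <- r) avg A (G i).
Proof. by rewrite /avg exchange_big mulr_suml. Qed.

Lemma avg_swap (A B : seq M) (h : M -> M -> R) :
  avg A (fun b => avg B (h b)) = avg B (fun a => avg A (h^~ a)).
Proof. by rewrite /avg -!mulr_suml exchange_big /= mulrAC. Qed.

(** The hypothesis bounds the Fourier coefficient of [f] at [chi] from below by [eta]. Take [A]
    nearly invariant under the differences of the points of [w], and smooth [f] against [chi] over
    [A]: the result [h] is close to [L * re chi] at those differences, with [L] at least [eta],
    while its form at [w] is at most that of [f]. *)
Lemma pd_sub_char f (chi : M -> circle R) eta : hom chi -> pd f -> 0 <= eta ->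
  (forall A, A != [::] -> eta <= La A (fun t => f t * re (chi t))) ->
  pd (fun t => f t - eta * re (chi t)).
Proof.
move=> hc pf eta0 hL; have [ev fp] := pf; split=> [t|w].
  by rewrite ev (homN hc) reN.
have -> : (fun t => f t - eta * re (chi t)) = (fun t => f t + (- eta) * re (chi t)).
  by apply/funext => t; rewrite mulNr.
rewrite BfD BfZ mulNr subr_ge0.
set X := Bf (fun t => re (chi t)) w w.
have X0 : 0 <= X by exact: (pd_re hc).2.
pose K := \sum_(x <- w) \sum_(y <- w) `|x.1 * y.1|.
have K0 : 0 <= K by apply: sumr_ge0 => x _; apply: sumr_ge0.
have f0 := pd_ge0 pf.
suff H n : eta * X <= Bf f w w + K * (f 0 *+ 2 / n.+1%:R).
  apply/ler_addgt0Pr => e e0.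
  have [n hn] := archi_small (K * (f 0 *+ 2)) e0.
  by apply: le_trans (H n) _; rewrite lerD2l mulrA ltW.
have [A A0 hA] := refines_progs n [seq x.2 - y.2 | x <- w, y <- w].
pose h t := avg A (fun s => avg A (fun s' => f (t + (s - s')) * re (chi (s - s')))).
set L := La A (fun t => f t * re (chi t)).
have hb t : t \in [seq x.2 - y.2 | x <- w, y <- w] ->
    `|h t - L * re (chi t)| <= f 0 *+ 2 / n.+1%:R.
  move=> /hA rA.
  pose G s' x := f (x - s') * re (chi (x - s' - t)).
  have -> : h t = avg A (fun s' => avg A (fun s => G s' (s + t))).
    rewrite /h avg_swap; apply: eq_avg => s'; apply: eq_avg => s; rewrite /G.
    by congr (f _ * re (chi _)); zmod.
  have -> : L * re (chi t) = avg A (fun s' => avg A (fun s => G s' s)).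
    (* The sine part vanishes because exchanging [s] and [s'] changes its sign. *)
    have z : avg A (fun s' => avg A (fun s => f (s - s') * im (chi (s - s')))) = 0.
      set z := avg _ _; suff : z = - z by lra.
      rewrite {1}/z avg_swap /z -mulN1r -avgZ; apply: eq_avg => s.
      rewrite -avgZ; apply: eq_avg => s'.
      by rewrite -[in LHS](opprB s') ev (homN hc) imN; ring.
    have e2 s' s : G s' s = re (chi t) * (f (s - s') * re (chi (s - s'))) +
       im (chi t) * (f (s - s') * im (chi (s - s'))).
      by rewrite /G (homB hc _ t) reB; ring.
    under [RHS]eq_avg do (under eq_avg do rewrite e2).
    under [RHS]eq_avg do rewrite avgD avgZ avgZ.
    by rewrite avgD !avgZ z mulr0 addr0 mulrC /L /La avg_swap.
  rewrite -mulN1r -avgZ -avgD; apply: avg_norm => // s'.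
  rewrite -avgZ -avgD.
  under eq_avg do rewrite mulN1r.
  apply: refines_prog rA _ => x; rewrite /G normrM -[f 0]mulr1.
  by apply: ler_pM => //; [exact: pd_bound|exact: re_le1].
have Bh : Bf h w w <= Bf f w w.
  have -> : Bf h w w = avg A (fun s => avg A (fun s' =>
      re (chi (s - s')) * Bf (fun t => f (t + (s - s'))) w w)).
    rewrite /Bf /h.
    transitivity (avg A (fun s => avg A (fun s' => \sum_(x <- w) \sum_(y <- w)
        (x.1 * y.1) * (f (x.2 - y.2 + (s - s')) * re (chi (s - s')))))).
      under [RHS]eq_avg do (rewrite avg_sum; under eq_bigr do rewrite avg_sum).
      rewrite avg_sum; apply: eq_bigr => x _; rewrite avg_sum; apply: eq_bigr => y _.
      by rewrite -avgZ; apply: eq_avg => s; rewrite -avgZ.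
    apply: eq_avg => s; apply: eq_avg => s'; rewrite mulr_sumr; apply: eq_bigr => x _.
    by rewrite mulr_sumr; apply: eq_bigr => y _; ring.
  apply: le_trans (ler_norm _) _; apply: avg_norm => // s; apply: avg_norm => // s'.
  rewrite normrM -[leRHS]mul1r; apply: ler_pM => //; first exact: re_le1.
  exact: pd_shift_bound.
apply: le_trans (_ : L * X <= _); first by rewrite ler_wpM2r// hL.
rewrite -lerBlDr (le_trans _ Bh)// lerBlDr addrC -lerBlDr.
rewrite /X -BfZ -mulN1r -BfZ -BfD /Bf.
rewrite /K mulr_suml; rewrite [leLHS]big_seq [leRHS]big_seq; apply: ler_sum => x xw.
rewrite mulr_suml; rewrite [leLHS]big_seq [leRHS]big_seq; apply: ler_sum => y yw.
apply: le_trans (ler_norm _) _; rewrite normrM ler_wpM2l//.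
rewrite mulN1r distrC; apply: hb; apply/allpairsP.
by exists (x, y).
Qed.

Lemma tlim_re (J : Type) (U : set_system J) (u : J -> circle R) t :
  ProperFilter U -> tlim U u t -> (fun j => re (u j)) @ U --> re t.
Proof.
move=> PU h; apply/cvgrPdist_lt => e e0; apply: filterS (h _ e0) => j /= hj.
by apply: le_lt_trans hj; rewrite distrC dist_re.
Qed.

Lemma La_ell A f g : La A (fun t => f t * g t) =
  ell [seq (f (a - b) / ((size A)%:R * (size A)%:R), a - b) | a <- A, b <- A] g.
Proof.
rewrite /La /avg /ell big_allpairs_dep mulr_suml; apply: eq_bigr => a _ /=.
rewrite !mulr_suml; apply: eq_bigr => b _ /=; rewrite invfM; ring.
Qed.

(** For each [A], [char_max] at [f / f 0] yields a character with coefficient at least [eta]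
    relative to [A]. These conditions get stronger as [A] grows, so a limit of the characters meets
    all of them. *)
Lemma char_step f eta : pd f -> f 0 <= 1 -> 0 < eta ->
  (forall A, A != [::] -> eta <= La A (fun t => f t * f t)) ->
  exists2 chi : M -> circle R, hom chi & pd (fun t => f t - eta * re (chi t)).
Proof.
move=> pf f01 eta0 hL.
have f0 : 0 < f 0.
  rewrite lt_neqAle (pd_ge0 pf) andbT; apply/eqP => f0.
  have := hL [:: 0] isT; rewrite /La /avg !big_seq1 !divr1 subrr -f0 mulr0; lra.
have np : npd (fun t => (f 0)^-1 * f t).
  by split; [apply: pdZ => //; rewrite invr_ge0 ltW|rewrite mulVf ?gt_eqF].
have [|A B A0 B0|A A0|U [UU UF]] := @ultra_base (M -> circle R) (seq M)
    [set A | A != [::]]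
    (fun A => [set chi | hom chi /\ eta <= La A (fun t => f t * re (chi t))]).
- by exists [:: 0].
- exists (ssum A B); first exact: ssum_neq0.
  move=> chi [/= hc h]; have := pd_mul_re hc pf => pc.
  by split; split=> //; apply: le_trans h _; [exact: La_ssum|exact: La_ssumr].
- have [chi hc h] := char_max
    [seq (f (a - b) / ((size A)%:R * (size A)%:R), a - b) | a <- A, b <- A] np.
  exists chi; split=> //; rewrite La_ell; apply: le_trans h; rewrite -La_ell.
  have -> : (fun t => f t * ((f 0)^-1 * f t)) = (fun t => (f 0)^-1 * (f t * f t)).
    by apply/funext => t; rewrite mulrCA.
  rewrite LaZ; apply: le_trans (hL A A0) _; rewrite ler_peMl ?invf_ge1//.
  by apply: le_trans (hL A A0); exact: ltW.
have /choice[chi lc] : forall t, exists s, tlim U (fun c => c t) s.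
  by move=> t; exact: ultra_tlim.
have hc : hom chi.
  by apply: hom_tlim lc; apply: filterS (UF [:: 0] isT) => c [].
exists chi => //; apply: pd_sub_char => // [|A A0]; first exact: ltW.
rewrite La_ell; set w := [seq _ | _ <- _, _ <- _].
have cv : (fun c : M -> circle R => ell w (fun t => re (c t))) @ U --> ell w (fun t => re (chi t)).
  pose V := (fun c : M -> circle R => (fun t => re (c t))) @ U.
  by apply: (@ell_cvg V) => t; exact: tlim_re.
rewrite -(cvg_lim _ cv)//; apply: limr_ge; first by apply/cvg_ex; eexists; exact: cv.
by apply: filterS (UF A A0) => c [_]; rewrite La_ell.
Qed.

(** Each extracted character lowers [f 0] by [eta], and [f 0] stays nonnegative, so the extraction
    stops within [n] steps. *)
Lemma pd_decomp eta n f : 0 < eta -> pd f -> f 0 <= 1 -> f 0 <= n%:R * eta ->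
  exists (k : nat) (chi : nat -> M -> circle R) (f1 : M -> R) (A : seq M),
  [/\ A != [::] /\ forall i, hom (chi i), pd f1, La A (fun t => f1 t * f1 t) <= eta &
  forall t, f t = f1 t + eta * \sum_(i < k) re (chi i t)].
Proof.
move=> eta0; have h0 : hom (fun _ : M => 0 : circle R) by move=> x y; rewrite addr0.
elim: n f => [|n IH] f pf f01 fn;
  have [[A [A0 hA]]|/forallNP hA] := pselect (exists A, A != [::] /\
     La A (fun t => f t * f t) <= eta).
- exists 0%N, (fun _ _ => 0), f, A; split=> // t.
  by rewrite big_ord0 mulr0 addr0.
- case: (hA [:: 0]); split=> //; rewrite /La /avg !big_seq1 !divr1 subrr.
  have -> : f 0 = 0 by apply/eqP; rewrite eq_le pd_ge0// andbT; move: fn; rewrite mul0r.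
  by rewrite mulr0 ltW.
- exists 0%N, (fun _ _ => 0), f, A; split=> // t.
  by rewrite big_ord0 mulr0 addr0.
- have [|chi hc pf'] := char_step pf f01 eta0.
    by move=> A A0; apply: ltW; rewrite ltNge; apply/negP => h; apply: (hA A).
  have e0 : re (chi 0) = 1 by rewrite (hom0 hc).
  have [||k [c [f1 [A [[A0 hcs] pf1 L1 E]]]]] := IH _ pf'.
  + by rewrite e0 mulr1; lra.
  + by rewrite e0 mulr1; move: fn; rewrite -addn1 natrD mulrDl mul1r; lra.
  exists k.+1, (fun i => if i is j.+1 then c j else chi), f1, A; split=> //.
    by split=> // -[|i].
  move=> t; rewrite big_ord_recl /=; have := E t.
  have -> : \sum_(i < k) re (c (0 + i)%N t) = \sum_(i < k) re (c i t) by [].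
  by lra.
Qed.

(** * Big sets and Bohr neighbourhoods *)

(** Such sets are also called syndetic. Precompactness of a group topology means that all
    neighbourhoods of 0 are big. *)
Definition big (E : set M) := exists F : seq M, forall x, exists2 a, a \in F & E (x - a).

(** [f] is the autocorrelation of the indicator of [E] under an invariant mean, and [d] is the
    square of the mean of [E]. That mean is positive because finitely many translates of [E] cover
    the group. *)
Lemma correlation_ex (E : set M) : big E -> exists f d, [/\ pd f, f 0 <= 1, 0 < d,
  forall A, A != [::] -> d <= La A f &
  forall s, f s != 0 -> exists2 x, E x & E (x + s)].
Proof.
move=> [F hF]; have [m [mD mZ m0 m1 mi]] := mean_ex R M.
pose e (x : M) : R := (`[< E x >])%:R.
have e01 x : 0 <= e x <= 1 by rewrite /e; case: `[< _ >]; rewrite /= lexx ler01.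
have ebd x : `|e x| <= 1 by have /andP[h1 h2] := e01 x; rewrite ger0_norm.
have be s : bdd (fun x => e (x + s)) by exists 1.
have be1 : bdd e by exists 1.
have mle phi psi : bdd phi -> bdd psi -> (forall x, phi x <= psi x) -> m phi <= m psi.
  move=> bp bq h; have bn : bdd (fun x => -1 * phi x).
    by have [b hb] := bp; exists b => x; rewrite mulN1r normrN.
  rewrite -subr_ge0 -mulN1r -mZ// -mD//; apply: m0.
    have [b hb] := bq; have [b' hb'] := bn; exists (b + b') => x.
    by rewrite (le_trans (ler_normD _ _))// lerD.
  by move=> x; rewrite mulN1r subr_ge0.
have bM (phi psi : M -> R) : bdd phi -> bdd psi -> bdd (fun x => phi x * psi x).
  move=> [b hb] [b' hb']; exists (b * b') => x.
  by rewrite normrM ler_pM.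
have bS (I : Type) (r : seq I) (G : I -> M -> R) : (forall i, bdd (G i)) ->
    bdd (fun x => \sum_(i <- r) G i x).
  move=> bG; elim: r => [|i r [b hb]]; first by exists 0 => x; rewrite big_nil normr0.
  have [c hc] := bG i; exists (c + b) => x; rewrite big_cons.
  by rewrite (le_trans (ler_normD _ _))// lerD.
have bZ c (phi : M -> R) : bdd phi -> bdd (fun x => c * phi x).
  by apply: bM; exists `|c|.
pose f t := m (fun x => e x * e (x + t)).
have fE u v : f (u - v) = m (fun x => e (x + u) * e (x + v)).
  rewrite /f -(mi (fun x => e x * e (x + (u - v))) v).
    by congr m; apply/funext => x; rewrite mulrC; congr (e _ * _); zmod.
  by apply: bM; [exists 1|exact: be].
have BE w : Bf f w w = m (fun x => (\sum_(y <- w) y.1 * e (x + y.2)) *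
    (\sum_(y <- w) y.1 * e (x + y.2))).
  rewrite /Bf.
  have -> : (fun x => (\sum_(y <- w) y.1 * e (x + y.2)) * (\sum_(y <- w) y.1 * e (x + y.2))) =
    (fun x => \sum_(y <- w) \sum_(z <- w) (y.1 * z.1) * (e (x + y.2) * e (x + z.2))).
    apply/funext => x; rewrite mulr_suml; apply: eq_bigr => y _; rewrite mulr_sumr.
    by apply: eq_bigr => z _; ring.
  have bb y z : bdd (fun x => e (x + y) * e (x + z)) by apply: bM; exact: be.
  rewrite (mean_sum mD mZ); last by move=> y; apply: bS => z; apply: bZ; exact: bb.
  apply: eq_bigr => y _; rewrite (mean_sum mD mZ); last by move=> z; apply: bZ; exact: bb.
  by apply: eq_bigr => z _; rewrite mZ// fE.
have pf : pd f.
  split=> [t|w].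
    by rewrite -[t]subr0 opprB !fE; congr m; apply/funext => x; rewrite mulrC.
  rewrite BE; apply: m0 => [|x]; last by rewrite -expr2 sqr_ge0.
  by apply: bM; apply: bS => y; apply: bZ; exact: be.
have bdd1 : bdd (fun _ : M => 1 : R) by exists 1 => x; rewrite normr1.
have me0 : m (fun x => e (x + 0)) = m e by rewrite mi//; exists 1.
have f0E : f 0 = m e.
  rewrite /f; congr m; apply/funext => x; rewrite addr0 /e.
  by case: `[< _ >]; rewrite /= ?mulr1 ?mulr0.
have f01 : f 0 <= 1.
  by rewrite f0E -m1; apply: mle => // x; case/andP: (e01 x).
have me_gt0 : 0 < m e.
  have : 1 <= (size F)%:R * m e.
    have -> : (size F)%:R * m e = m (fun x => \sum_(a <- F) e (x + - a)).
      rewrite (mean_sum mD mZ) => [|a]; last exact: be.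
      under eq_bigr do rewrite (mi e _ be1).
      by rewrite big_const_seq count_predT iter_addr_0 mulr_natl.
    rewrite -{1}m1; apply: mle => //; first by apply: bS => a; exact: be.
    move=> x; have [a aF Ea] := hF x; rewrite (big_rem a aF) /= -[leLHS]addr0 lerD//.
      by rewrite /e asboolT.
    by apply: sumr_ge0 => b _; case/andP: (e01 (x - b)).
  have : 0 <= m e by rewrite -f0E pd_ge0.
  by rewrite le_eqVlt => /orP[/eqP <-|//]; rewrite mulr0 ler10.
exists f, (m e ^+ 2); split=> //; first by rewrite exprn_gt0.
- move=> A A0; rewrite La_Bf BE.
  pose P x := \sum_(y <- [seq ((size A)%:R^-1, a) | a <- A]) y.1 * e (x + y.2).
  rewrite -/P.
  have bP : bdd P by apply: bS => y; apply: bZ; exact: be.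
  have mP : m P = m e.
    rewrite /P (mean_sum mD mZ) => [|y]; last by apply: bZ; exact: be.
    rewrite big_map.
    under eq_bigr do rewrite mZ ?(mi e _ be1)//.
    rewrite -mulr_suml big_const_seq count_predT iter_addr_0 -[_ *+ _]mulr_natr mulVf ?mul1r//.
    by rewrite pnatr_eq0 size_eq0.
  set c := m e.
  (* This is the mean of [(P - c) ^ 2 >= 0], where [P] averages translates of the indicator and has
     mean [c]. *)
  have : m (fun x => (2 * c) * P x + (- c ^+ 2) * 1) <= m (fun x => P x * P x).
    apply: mle; [|exact: bM|].
      have [b hb] := bZ (2 * c) _ bP; have [b' hb'] := bZ (- c ^+ 2) _ bdd1.
      exists (b + b') => x; apply: (le_trans (ler_normD _ _)).
      by apply: lerD; [exact: hb|exact: hb'].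
    by move=> x; have := sqr_ge0 (P x - c); nra.
  rewrite mD; [|exact: bZ|exact: bZ].
  by rewrite !mZ// m1 mP -/c; nra.
- move=> s /eqP fs; apply: contrapT => h; apply: fs.
  rewrite /f; have -> : (fun x => e x * e (x + s)) = (fun x => 0 * 1).
    apply/funext => x; rewrite mul0r /e.
    case: asboolP => [Ex|_]; last by rewrite mul0r.
    by case: asboolP => [Exs|_]; [case: h; exists x|rewrite mulr0].
  by rewrite mZ// mul0r.
Qed.

(** If [t] is not in [(E - E) + (E - E)], the autocorrelation satisfies [f s * f (s + t) = 0] for
    all [s]. Up to an error [f1] of small mean square, [f] is a combination of [k] characters, hence
    nearly invariant under any [t] at which these are small. Then [f] itself would have small mean
    square, but its mean square is at least [d ^ 2]. *)
Theorem folner (E : set M) : big E ->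
  exists (k : nat) (chi : nat -> M -> circle R) (e : R),
  [/\ 0 < e, forall i, hom (chi i) &
   forall t, (forall i, (i < k)%N -> cnorm (chi i t) < e) ->
     exists a b c d, [/\ E a, E b, E c & E d] /\ t = (a - b) + (c - d)].
Proof.
move=> /correlation_ex[f [d [pf f01 d0 hd hE]]].
have d2 : 0 < d ^+ 2 by rewrite exprn_gt0.
(* With [th = d / 4] the final estimate reads [d ^ 2 <= 3 eta + 3 eta + 3 th ^ 2 = 7 d ^ 2 / 16]. *)
pose eta := d ^+ 2 / 24; have eta0 : 0 < eta by rewrite divr_gt0.
have [n hn] : exists n : nat, f 0 <= n%:R * eta.
  have [n hn] := archi_small (f 0) eta0; exists n.+1.
  by move: hn; rewrite ltr_pdivrMr ?ltr0n// mulrC => /ltW.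
have [k [chi [f1 [A [[A0 hc] pf1 L1 fE]]]]] := pd_decomp eta0 pf f01 hn.
pose th := d / 4; have th0 : 0 < th by rewrite divr_gt0.
have ke0 : 0 < eta * k.+1%:R by rewrite mulr_gt0 ?ltr0n.
exists k, chi, (th / (eta * k.+1%:R)); split=> //; first by rewrite divr_gt0.
move=> t ht; apply: contrapT => hn4.
have zero s : f s = 0 \/ f (s + t) = 0.
  have [->|fs] := eqVneq (f s) 0; first by left.
  right; apply/eqP; apply: contraT => /hE[x Ex Ext]; case: hn4.
  have [y Ey Eys] := hE _ fs.
  by exists (x + (s + t)), x, y, (y + s); split=> //; zmod.
have small s : `|f (s + t) - f s - (f1 (s + t) - f1 s)| <= th.
  have -> : f (s + t) - f s - (f1 (s + t) - f1 s) =
      eta * \sum_(i < k) (re (chi i (s + t)) - re (chi i s)).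
    by rewrite !fE sumrB; ring.
  rewrite normrM (gtr0_norm eta0).
  apply: le_trans (_ : eta * \sum_(i < k) (th / (eta * k.+1%:R)) <= _).
    apply: ler_wpM2l; first exact: ltW.
    apply: le_trans (ler_norm_sum _ _ _) _.
    apply: ler_sum => i _; apply: le_trans (dist_re _ _) _.
    have -> : chi i (s + t) - chi i s = chi i t by rewrite (hc i); zmod.
    by apply/ltW/ht.
  rewrite sumr_const card_ord -[_ *+ k]mulr_natl.
  have -> : eta * (k%:R * (th / (eta * k.+1%:R))) = th * (k%:R / k.+1%:R).
    have aux (x y z v : R) : x != 0 -> v != 0 -> x * (y * (z / (x * v))) = z * (y / v).
      by move=> x0 v0; field; rewrite x0 v0.
    by apply: aux; [rewrite gt_eqF|rewrite pnatr_eq0].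
  apply: ler_piMr; first exact: ltW.
  by rewrite ler_pdivrMr ?ltr0n// mul1r ler_nat.
have sq s : f s * f s <= 3 * (f1 (s + t) * f1 (s + t)) + 3 * (f1 s * f1 s) + 3 * th ^+ 2.
  have h : f s * f s <= (f (s + t) - f s) ^+ 2.
    by have [->|->] := zero s; [rewrite mul0r sqr_ge0|rewrite sub0r sqrrN expr2].
  apply: le_trans h _; have := small s.
  set u := f (s + t) - f s; set a := f1 (s + t); set b := f1 s => hu.
  have : (u - (a - b)) ^+ 2 <= th ^+ 2.
    by rewrite -[leLHS]real_normK ?num_real// ler_pXn2r ?nnegrE// ltW.
  have := sqr_ge0 (a + b); have := sqr_ge0 (u - (a - b) - a); have := sqr_ge0 (u - (a - b) + b).
  by nra.
have pf2 := pdM pf1 pf1.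
have := ler_La A sq; rewrite !LaD !LaZ La_cst//.
have := La_shift A t pf2; rewrite ler_norml => /andP[_ hs].
have : d ^+ 2 <= La A (fun s => f s * f s).
  have h s : 2 * d * f s + (- d ^+ 2) <= f s * f s by have := sqr_ge0 (f s - d); nra.
  have := ler_La A h; rewrite LaD LaZ La_cst//.
  have := hd A A0; nra.
rewrite /th /eta in L1 *; nra.
Qed.

End KreinMilman.

(** * Subgroups as Z-modules *)

Section SubgroupType.
Variables (M : zmodType) (P : set M).

Record subgrp := Subgrp { sgval : M; sgP : `[< P sgval >] }.

HB.instance Definition _ := [isSub for sgval].
HB.instance Definition _ := [Choice of subgrp by <:].

(** The alias carries the proof that [P] is a subgroup, from which the group instance is built; the
    bare [subgrp P] exists for every set [P]. *)
Definition subgrp_of (hP : is_subgroup P) := subgrp.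

Variable hP : is_subgroup P.

Lemma subgroupN x : P x -> P (- x).
Proof. by move=> Px; rewrite -sub0r; apply: hP.2 => //; exact: hP.1. Qed.

Lemma subgroupD x y : P x -> P y -> P (x + y).
Proof. by move=> Px Py; rewrite -[y]opprK; apply: hP.2 => //; exact: subgroupN. Qed.

Lemma subgroupMn x n : P x -> P (x *+ n).
Proof.
by move=> Px; elim: n => [|n IH]; rewrite ?mulr0n ?mulrS; [exact: hP.1|exact: subgroupD].
Qed.

Lemma subgroupMz x n : P x -> P (x *~ n).
Proof.
by move=> Px; case: n => n; rewrite ?NegzE ?mulrNz -?pmulrn;
  [|apply: subgroupN]; exact: subgroupMn.
Qed.

HB.instance Definition _ := Choice.on (subgrp_of hP).

Definition sg0 : subgrp_of hP := Subgrp (asboolT hP.1).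
Definition sgopp (x : subgrp_of hP) : subgrp_of hP :=
  Subgrp (asboolT (subgroupN (asboolW (sgP x)))).
Definition sgadd (x y : subgrp_of hP) : subgrp_of hP :=
  Subgrp (asboolT (subgroupD (asboolW (sgP x)) (asboolW (sgP y)))).

Fact sgaddA : associative sgadd.
Proof. by move=> x y z; apply: val_inj; rewrite /= addrA. Qed.
Fact sgaddC : commutative sgadd.
Proof. by move=> x y; apply: val_inj; rewrite /= addrC. Qed.
Fact sgadd0 : left_id sg0 sgadd.
Proof. by move=> x; apply: val_inj; rewrite /= add0r. Qed.
Fact sgaddN : left_inverse sg0 sgopp sgadd.
Proof. by move=> x; apply: val_inj; rewrite /= addNr. Qed.

HB.instance Definition _ := GRing.isZmodule.Build (subgrp_of hP)
  sgaddA sgaddC sgadd0 sgaddN.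

Lemma sg_ex x : P x -> exists y : subgrp_of hP, sgval y = x.
Proof. by move=> Px; exists (Subgrp (asboolT Px)). Qed.

End SubgroupType.

(** * Density of the image of a group in its bidual *)

Lemma dep_choice_seq (T : Type) (P : seq T -> T -> Prop) :
  (forall s, exists x, P s x) ->
  exists u : nat -> T, forall n, P (mkseq u n) (u n).
Proof.
move=> /choice[ch hch].
pose pre := fix pre n := if n is k.+1 then rcons (pre k) (ch (pre k)) else [::].
pose u n := ch (pre n); exists u => n.
suff -> : mkseq u n = pre n by exact: hch.
by elim: n => // n IH; rewrite mkseqS IH.
Qed.

Section Density.
Variables (R : realType) (M : zmodType).

(** Otherwise there is a sequence none of whose later terms differs from an earlier one by an
    element of [B]; but two of its terms have nearly equal values in the compact torus of [r]
    coordinates. *)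
Lemma bohr_big (r : nat) (y : nat -> M -> circle R) (e : R) : 0 < e ->
  (forall i, hom (y i)) -> big [set g | forall i, (i < r)%N -> cnorm (y i g) < e].
Proof.
move=> e0 hy; set B := [set g | _]; apply: contrapT => nb.
have [s|u hu] := @dep_choice_seq M (fun s x => forall a, a \in s -> ~ B (x - a)).
  apply: contrapT => hs; apply: nb; exists s => x.
  apply: contrapT => hx; apply: hs; exists x => a as_ Bxa; apply: hx; by exists a.
have [U [UU UN]] := free_ultra_nat.
have /choice[t ht] : forall i, exists t, tlim U (fun n => y i (u n)) t.
  by move=> i; exact: ultra_tlim.
have e20 : 0 < e / 2 by rewrite divr_gt0.
have UA : U [set n | forall i, (i < r)%N -> cnorm (y i (u n) - t i) < e / 2].
  elim: r @B hu nb => [|k IH] B hu nb; first by apply: filterE.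
  have IHk : U [set n | forall i, (i < k)%N -> cnorm (y i (u n) - t i) < e / 2].
    elim: (k) => [|j IHj]; first by apply: filterE.
    apply: filterS (filterI IHj (ht j _ e20)) => n [/= h1 h2] i.
    by rewrite ltnS leq_eqVlt => /orP[/eqP ->|/h1].
  apply: filterS (filterI IHk (ht k _ e20)) => n [/= h1 h2] i.
  by rewrite ltnS leq_eqVlt => /orP[/eqP ->|/h1].
have [n /= hn] := filter_ex UA.
have [m [/= hm nm]] := filter_ex (filterI UA (UN n.+1)).
apply: (hu m (u n)); first by rewrite map_f// mem_iota.
move=> i ir; rewrite (homB (hy i)); apply: le_lt_trans (cnorm_tri (t i) _ _) _.
by rewrite (splitr e) ltrD ?hm// cnorm_distC hn.
Qed.

(** By invariance the pair of means of [re Y] and [im Y] is fixed by the nontrivial rotation [Y g0],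
    so it is 0. *)
Lemma mean_char0 (m : (M -> R) -> R) (Y : M -> circle R) (s : circle R) :
  (forall phi psi, bdd phi -> bdd psi -> m (fun x => phi x + psi x) = m phi + m psi) ->
  (forall c phi, bdd phi -> m (fun x => c * phi x) = c * m phi) ->
  (forall phi s, bdd phi -> m (fun x => phi (x + s)) = m phi) ->
  hom Y -> (exists g, Y g != 0) -> m (fun g => re (Y g - s)) = 0.
Proof.
move=> mD mZ mi hY [g0 Yg0].
have br : bdd (fun g => re (Y g)) by exists 1 => g; exact: re_le1.
have bi : bdd (fun g => im (Y g)) by exists 1 => g; exact: im_le1.
have bz c (phi : M -> R) : bdd phi -> bdd (fun x => c * phi x).
  by move=> [b hb]; exists (`|c| * b) => x; rewrite normrM ler_wpM2l.
have lin (c d : R) : m (fun g => c * re (Y g) + d * im (Y g)) =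
    c * m (fun g => re (Y g)) + d * m (fun g => im (Y g)).
  by rewrite mD ?mZ//; apply: bz.
set A := m (fun g => re (Y g)) in lin; set B := m (fun g => im (Y g)) in lin.
set t := Y g0 in Yg0.
have EA : A = re t * A + - im t * B.
  rewrite -lin /A -(mi _ g0 br); congr m; apply/funext => g.
  by rewrite hY reD -/t; ring.
have EB : B = im t * A + re t * B.
  rewrite -lin /B -(mi _ g0 bi); congr m; apply/funext => g.
  by rewrite hY imD -/t; ring.
have ret : re t < 1.
  rewrite lt_neqAle; apply/andP; split; first by apply/eqP => /re_eq1/eqP; apply/negP.
  by have := re_le1 t; rewrite ler_norml => /andP[].
have pos : 0 < (1 - re t) ^+ 2 + im t ^+ 2.
  by rewrite ltr_wpDr ?sqr_ge0// exprn_gt0 ?subr_gt0.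
have EA' : (1 - re t) * A = - im t * B by lra.
have EB' : im t * A = (1 - re t) * B by lra.
have A0 : A = 0.
  have : A * ((1 - re t) ^+ 2 + im t ^+ 2) = 0.
    transitivity ((1 - re t) * ((1 - re t) * A) + im t * (im t * A)); first ring.
    by rewrite EA' EB'; ring.
  by move=> /eqP; rewrite mulf_eq0 (gt_eqF pos) orbF => /eqP.
have B0 : B = 0.
  have : B * ((1 - re t) ^+ 2 + im t ^+ 2) = 0.
    transitivity ((1 - re t) * ((1 - re t) * B) - im t * (- im t * B)); first ring.
    by rewrite -EA' -EB'; ring.
  by move=> /eqP; rewrite mulf_eq0 (gt_eqF pos) orbF => /eqP.
have -> : (fun g => re (Y g - s)) = (fun g => re s * re (Y g) + im s * im (Y g)).
  by apply/funext => g; rewrite reB; ring.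
by rewrite lin A0 B0 !mulr0 addr0.
Qed.

Variables (r : nat) (y : nat -> M -> circle R).
Hypothesis hy : forall i, hom (y i).

Definition lc (n : nat -> int) (c : nat -> circle R) := \sum_(i < r) c i *~ n i.

Definition trig (l : seq (R * (nat -> int))) (c : nat -> circle R) g :=
  \sum_(a <- l) a.1 * re (lc a.2 (fun i => y i g - c i)).

(** It is 1 where the values of [y] are exactly [c], and at most [1 - e ^ 2 / 4] as soon as one of
    them is off by [e]. Its powers are trigonometric polynomials, so their means depend only on
    relations between the characters. *)
Definition bump (c : nat -> circle R) g : R := \prod_(j < r) ((1 + re (y j g - c j)) / 2).

Lemma trig_step j l : (j < r)%N -> exists l', forall c g,
  trig l' c g = trig l c g * ((1 + re (y j g - c j)) / 2).
Proof.
move=> jr; pose sh (n : nat -> int) (k : int) i := if i == j then n i + k else n i.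
have lcsh n k c : lc (sh n k) c = lc n c + c j *~ k.
  rewrite /lc (bigD1 (Ordinal jr))//= [in RHS](bigD1 (Ordinal jr))//=.
  rewrite /sh eqxx mulrzDr -!addrA; congr (_ + _); rewrite addrC; congr (_ + _).
  by apply: eq_bigr => i; rewrite -val_eqE /= => /negPf ->.
elim: l => [|[a n] l [l' IH]].
  by exists [::] => c g; rewrite /trig !big_nil mul0r.
exists [:: (a / 2, n), (a / 4, sh n 1), (a / 4, sh n (-1)) & l'] => c g.
have := IH c g; rewrite /trig !big_cons /= => ->.
rewrite !lcsh mulrN1z mulr1z; set s := lc _ _; set t := y j g - c j.
move: (\sum_(i <- l) _) => S.
by rewrite (reD s t) (reB s t); field.
Qed.

Lemma trig_bump N : exists l, forall c g, trig l c g = bump c g ^+ N.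
Proof.
suff H l0 k : (k <= r)%N -> exists l, forall c g,
    trig l c g = trig l0 c g * \prod_(j < k) ((1 + re (y j g - c j)) / 2).
  elim: N => [|N [l hl]].
    exists [:: (1, fun=> 0)] => c g; rewrite /trig big_seq1 /= mul1r expr0.
    by rewrite /lc big1 ?re0// => i _; rewrite mulr0z.
  by have [l' hl'] := H l r (leqnn r); exists l' => c g; rewrite hl' hl exprSr.
elim: k => [_|k IH kr]; first by exists l0 => c g; rewrite big_ord0 mulr1.
have [l hl] := IH (ltnW kr); have [l' hl'] := trig_step l kr.
by exists l' => c g; rewrite hl' hl big_ord_recr /= -mulrA.
Qed.

(** A Kronecker theorem. If [c] respects all integer relations between the [y i], then the powers of
    the bumps at [c] and at 0 have the same means. If [c] could not be approximated, the first mean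
    would be at most [q ^ N], while the second is at least a constant times [p ^ N] because the
    points with values near 0 form a big set; and [q < p]. *)
Lemma char_dense (c : nat -> circle R) (e : R) : 0 < e ->
  (forall n, (forall g, lc n (fun i => y i g) = 0) -> lc n c = 0) ->
  exists g, forall i, (i < r)%N -> cnorm (y i g - c i) < e.
Proof.
move=> e0 rel; apply: contrapT => /forallNP nex.
have {}nex g : exists2 j, (j < r)%N & e <= cnorm (y j g - c j).
  apply: contrapT => h; apply: (nex g) => i ir; rewrite ltNge; apply/negP => ei.
  by apply: h; exists i.
have [m [mD mZ m0 m1 mi]] := mean_ex R M.
have fac (t : circle R) : 0 <= (1 + re t) / 2 <= 1 by have := re_le1 t; rewrite ler_norml; lra.
have facE (t : circle R) : (1 + re t) / 2 = 1 - cnorm t ^+ 2 / 4 by rewrite sqr_cnorm; field.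
have prod01 (P : pred 'I_r) (F : 'I_r -> R) : (forall i, 0 <= F i <= 1) ->
    0 <= \prod_(i | P i) F i <= 1.
  move=> hF; apply: (big_ind (fun x => 0 <= x <= 1)) => //; first by rewrite ler01 lexx.
  by move=> u v /andP[u0 u1] /andP[v0 v1]; rewrite mulr_ge0// mulr_ile1.
have b01 (d : nat -> circle R) g : 0 <= bump d g <= 1.
  by apply: prod01 => i; exact: fac.
have bb (d : nat -> circle R) N : bdd (fun g => bump d g ^+ N).
  exists 1 => g; have /andP[h1 h2] := b01 d g.
  by rewrite ger0_norm ?exprn_ge0// exprn_ile1.
have mle phi psi : bdd phi -> bdd psi -> (forall x, phi x <= psi x) -> m phi <= m psi.
  move=> bp bq h; have bn : bdd (fun x => -1 * phi x).
    by have [b hb] := bp; exists b => x; rewrite mulN1r normrN.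
  rewrite -subr_ge0 -mulN1r -mZ// -mD//; apply: m0.
    have [b hb] := bq; have [b' hb'] := bn; exists (b + b') => x.
    by rewrite (le_trans (ler_normD _ _))// lerD.
  by move=> x; rewrite mulN1r subr_ge0.
have meq N : m (fun g => bump c g ^+ N) = m (fun g => bump (fun=> 0) g ^+ N).
  have [l hl] := trig_bump N.
  have -> : (fun g => bump c g ^+ N) = trig l c by apply/funext => g; rewrite hl.
  have -> : (fun g => bump (fun=> 0) g ^+ N) = trig l (fun=> 0).
    by apply/funext => g; rewrite hl.
  have bt (a : R * (nat -> int)) d : bdd (fun g => re (lc a.2 (fun i => y i g - d i))).
    by exists 1 => g; exact: re_le1.
  have bt' (a : R * (nat -> int)) d :
      bdd (fun g => a.1 * re (lc a.2 (fun i => y i g - d i))).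
    by have [b hb] := bt a d; exists (`|a.1| * b) => g; rewrite normrM ler_wpM2l.
  rewrite /trig !(mean_sum mD mZ)//; apply: eq_bigr => a _; rewrite !mZ//; congr (_ * _).
  pose Y g := lc a.2 (fun i => y i g).
  have hY : hom Y.
    move=> u v; rewrite /Y /lc -big_split; apply: eq_bigr => i _ /=.
    by rewrite hy mulrzDl.
  have YE d : (fun g => re (lc a.2 (fun i => y i g - d i))) = (fun g => re (Y g - lc a.2 d)).
    apply/funext => g; congr re; rewrite /Y /lc -sumrB; apply: eq_bigr => i _.
    by rewrite mulrzBl.
  rewrite !YE; have [Yn0|/forallNP Y0] := pselect (exists g, Y g != 0).
    by rewrite !(mean_char0 _ mD mZ mi hY Yn0).
  have Yz g : Y g = 0 by apply/eqP; rewrite -[_ == _]negbK; exact/negP/Y0.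
  rewrite (rel _ Yz); congr m; apply/funext => g; congr (re (_ - _)).
  by rewrite /lc big1// => i _; rewrite mul0rz.
pose q : R := 1 - e ^+ 2 / 4.
have sqle (u v : R) : 0 <= u -> u <= v -> u ^+ 2 <= v ^+ 2.
  by move=> u0 uv; rewrite ler_pXn2r ?nnegrE// (le_trans u0).
have facq t : e <= cnorm t -> (1 + re t) / 2 <= q.
  by move=> /(sqle _ _ (ltW e0)); rewrite facE /q; lra.
have q0 : 0 <= q.
  have [j jr hj] := nex 0; have /andP[h3 h4] := fac (y j 0 - c j).
  exact: le_trans h3 (facq _ hj).
have up N : m (fun g => bump c g ^+ N) <= q ^+ N.
  have -> : q ^+ N = m (fun _ : M => q ^+ N * 1).
    by rewrite mZ ?m1 ?mulr1//; exists 1 => g; rewrite normr1.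
  apply: mle => //; first by exists `|q ^+ N| => g; rewrite mulr1.
  move=> g; have /andP[h1 h2] := b01 c g; rewrite mulr1.
  apply: lerXn2r; rewrite ?nnegrE//.
  have [j jr hj] := nex g; rewrite /bump (bigD1 (Ordinal jr))//=.
  apply: le_trans (_ : (1 + re (y j g - c j)) / 2 <= _).
    apply: ler_piMr; first by case/andP: (fac (y j g - c j)).
    have /andP[] // := prod01 (fun i => i != Ordinal jr)
      (fun i : 'I_r => (1 + re (y i g - c i)) / 2) (fun i => fac _).
  exact: facq.
(* The smaller radius compensates for the [r] factors of the bump: by Bernoulli's inequality
   [p >= 1 - r e' ^ 2 / 4], and [r < (r + 1) ^ 2] gives [p > q]. *)
pose e' := e / r.+1%:R; have e'0 : 0 < e' by rewrite divr_gt0 ?ltr0n.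
pose p : R := (1 - e' ^+ 2 / 4) ^+ r.
have e'e : e' <= e.
  rewrite ler_pdivrMr ?ltr0n//; apply: ler_peMr; first exact: ltW.
  by rewrite ler1n.
have e2 : e' ^+ 2 <= e ^+ 2 by apply: sqle => //; exact: ltW.
have pq : q < p.
  apply: lt_le_trans (_ : 1 - r%:R * (e' ^+ 2 / 4) <= _).
    rewrite /q ltrD2l ltrN2 mulrA ltr_pM2r ?invr_gt0//.
    have -> : r%:R * e' ^+ 2 = e ^+ 2 * (r%:R / r.+1%:R ^+ 2).
      by rewrite /e' expr_div_n mulrCA.
    rewrite gtr_pMr ?exprn_gt0// ltr_pdivrMr ?exprn_gt0 ?ltr0n// mul1r -natrX ltr_nat.
    by rewrite expnS expn1 leq_pmulr.
  have x1 : 0 <= 1 - e' ^+ 2 / 4 by rewrite /q in q0; lra.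
  rewrite /p; elim: (r) => [|k IH]; first by rewrite mul0r subr0 expr0.
  rewrite [leRHS]exprS -natr1 mulrDl mul1r.
  have := mulr_ge0 (sqr_ge0 e') (ler0n R k) => hk.
  have : (1 - e' ^+ 2 / 4) * (1 - k%:R * (e' ^+ 2 / 4)) <= (1 - e' ^+ 2 / 4) * (1 - e' ^+ 2 / 4) ^+ k.
    by rewrite ler_wpM2l.
  apply: le_trans; have := mulr_ge0 (sqr_ge0 (e' ^+ 2)) (ler0n R k); nra.
have p0 : 0 < p by apply: le_lt_trans pq.
have [F hF] := @bohr_big r y e' e'0 hy.
have low N : p ^+ N <= (size F)%:R * m (fun g => bump (fun=> 0) g ^+ N).
  have -> : (size F)%:R * m (fun g => bump (fun=> 0) g ^+ N) =
      m (fun g => \sum_(a <- F) bump (fun=> 0) (g + - a) ^+ N).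
    rewrite (mean_sum mD mZ); last first.
      by move=> a; have [b hb] := bb (fun=> 0) N; exists b => g.
    under eq_bigr do rewrite (mi (fun g => bump (fun=> 0) g ^+ N) _ (bb _ _)).
    by rewrite big_const_seq count_predT iter_addr_0 mulr_natl.
  have -> : p ^+ N = m (fun _ : M => p ^+ N * 1).
    by rewrite mZ ?m1 ?mulr1//; exists 1 => g; rewrite normr1.
  apply: mle.
  - by exists `|p ^+ N| => g; rewrite mulr1.
  - elim: (F) => [|a s [b hb]]; first by exists 0 => x; rewrite big_nil normr0.
    have [b' hb'] := bb (fun=> 0) N; exists (b' + b) => x; rewrite big_cons.
    by rewrite (le_trans (ler_normD _ _))// lerD.
  - move=> g; have [a aF ha] := hF g; rewrite (big_rem a aF) /= -[leLHS]addr0 mulr1 lerD//.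
      have /andP[h1 h2] := b01 (fun=> 0) (g - a).
      apply: lerXn2r; rewrite ?nnegrE//; first exact: ltW.
      rewrite /p /bump -[X in _ ^+ X](card_ord r) -prodr_const.
      apply: ler_prod => i _; rewrite subr0 facE; apply/andP; split.
        by rewrite /q in q0; lra.
      by have := sqle _ _ (cnorm_ge0 _) (ltW (ha i (ltn_ord i))); lra.
    by apply: sumr_ge0 => b _; apply: exprn_ge0; case/andP: (b01 (fun=> 0) (g - b)).
have ratio N : 1 <= (size F)%:R * (q / p) ^+ N.
  have pN : 0 < p ^+ N by rewrite exprn_gt0.
  have -> : (size F)%:R * (q / p) ^+ N = ((size F)%:R * q ^+ N) / p ^+ N.
    by rewrite expr_div_n mulrA.
  rewrite (ler_pdivlMr _ _ pN) [1 * _]mul1r.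
  apply: le_trans (low N) _; rewrite ler_wpM2l// -meq; exact: up.
have qp0 : 0 <= q / p by rewrite divr_ge0// ltW.
have qp : `|q / p| < 1 by rewrite ger0_norm// ltr_pdivrMr// mul1r.
have := cvg_expr qp => /cvgrPdist_lt/(_ ((size F).+1%:R^-1)).
move=> []; first by rewrite invr_gt0 ltr0n.
move=> N _ /(_ N (leqnn N)) /=; rewrite sub0r normrN ger0_norm; last first.
  by rewrite exprn_ge0.
move=> hN; have := ratio N; apply/negP; rewrite -ltNge.
apply: le_lt_trans (_ : (size F).+1%:R * (q / p) ^+ N < _).
  by rewrite ler_wpM2r ?exprn_ge0// ler_nat.
by rewrite mulrC -ltr_pdivlMr ?ltr0n// div1r.
Qed.

End Density.

(** * Continuous characters of precompact groups *)

Definition gbase (M : zmodType) (D : set_system M) := [/\ exists U, D U,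
  forall U V, D U -> D V -> exists2 W, D W & W `<=` U `&` V,
  forall U, D U -> U 0 &
  forall U, D U -> exists2 V, D V & forall x y, V x -> V y -> U (x - y)].

Lemma gbaseD (M : zmodType) (D : set_system M) U : gbase D -> D U ->
  exists2 V, D V & (V `<=` U /\ forall x y, V x -> V y -> U (x + y)).
Proof.
move=> [_ _ D0 DB] DU; have [V DV hV] := DB U DU; have [W DW hW] := DB V DV.
exists W => //.
have WV x : W x -> V x by move=> Wx; rewrite -[x]subr0; apply: hW => //; exact: D0.
split=> [x /WV Vx|x y /WV Vx Wy]; first by rewrite -[x]subr0; apply: hV => //; exact: D0.
by rewrite -[y]opprK; apply: hV => //; rewrite -sub0r; apply: hW => //; exact: D0.
Qed.

Section PeterWeyl.
Variables (R : realType) (M : zmodType) (D : set_system M).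
Hypothesis gD : gbase D.

(** Foelner's theorem gives characters [chi i] whose common smallness forces membership in a
    neighbourhood, but they need not be continuous. If every continuous integer combination of them
    vanished at [g], then by [char_dense] the values at [g] would be approximated by values at
    points [v] near 0. So [g - v] would lie in the Bohr neighbourhood, and [g] in [V0]. *)
Lemma char_ex V0 g : (forall V, D V -> big V) -> D V0 -> ~ V0 g ->
  exists chi : M -> circle R, [/\ hom chi, chi g != 0 &
    forall e : R, 0 < e -> exists2 V, D V & forall v, V v -> cnorm (chi v) < e].
Proof.
move=> Dbig DV0 nV0g; have [_ DI D0 DB] := gD.
have [V1 DV1 hV1] := DB _ DV0; have [V2 DV2 hV2] := DB _ DV1.
have [V3 DV3 hV3] := DB _ DV2.
have V32 x : V3 x -> V2 x by move=> Vx; rewrite -[x]subr0; apply: hV3 => //; exact: D0.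
have [k [chi [e [e0 hc hB]]]] := folner R (Dbig _ DV3).
have e20 : 0 < e / 2 by rewrite divr_gt0.
(* The cluster values at 0 of the tuple of the [chi i]. They form a subgroup, and an integer
   combination of the [chi i] that annihilates it is continuous. *)
pose G := [set c : nat -> circle R | forall V, D V -> forall d : R, 0 < d ->
  exists2 v, V v & forall i, (i < k)%N -> cnorm (chi i v - c i) < d].
have hG : is_subgroup G.
  split.
    move=> V DV d d0; exists 0; first exact: D0.
    by move=> i ik; rewrite (hom0 (hc i)) subrr cnorm0.
  move=> c c' Gc Gc' V DV d d0; have [W DW hW] := DB _ DV.
  have d20 : 0 < d / 2 by rewrite divr_gt0.
  have [v Wv hv] := Gc W DW _ d20; have [v' Wv' hv'] := Gc' W DW _ d20.
  exists (v - v'); first exact: hW.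
  move=> i ik; rewrite (homB (hc i)) /=.
  have -> : chi i v - chi i v' - (c - c') i = (chi i v - c i) - (chi i v' - c' i).
    by have -> : (c - c') i = c i - c' i by []; zmod.
  by apply: le_lt_trans (cnormB _ _) _; rewrite (splitr d) ltrD ?hv ?hv'.
pose y (i : nat) (c : subgrp_of hG) : circle R := sgval c i.
have hy i : hom (y i) by [].
have [n [nG ng]] : exists n : nat -> int,
    (forall c, G c -> lc k n c = 0) /\ lc k n (fun i => chi i g) != 0.
  apply: contrapT => /forallNP hn.
  have [n nG|c hc'] := @char_dense R _ k y hy (fun i => chi i g) _ e20.
    apply/eqP; apply: contraT => ng; case: (hn n); split=> // c Gc.
    by have [c' <-] := sg_ex hG Gc; exact: nG.
  have [v V3v hv] := asboolW (sgP c) V2 DV2 _ e20.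
  have [|a [b [a' [b' [[Va Vb Va' Vb'] E]]]]] := hB (g - v).
    move=> i ik; rewrite (homB (hc i)); apply: le_lt_trans (cnorm_tri (y i c) _ _) _.
    by rewrite (splitr e) ltrD// cnorm_distC ?hc' ?hv.
  apply: nV0g; have -> : g = ((a - b) - (b' - a')) - (0 - v).
    by rewrite -[LHS](subrK v) E; zmod.
  by apply: hV1; [apply: hV2; apply: hV3 => //|apply: hV2 => //; exact: D0].
exists (fun x => lc k n (fun i => chi i x)); split=> //.
  move=> u v; rewrite /lc -big_split; apply: eq_bigr => i _ /=.
  by rewrite hc mulrzDl.
move=> d d0; apply: contrapT => hn.
have [|V W DV DW|V DV|U [UU UV]] := @ultra_base M (set M) D
    (fun V => [set v | V v /\ d <= cnorm (lc k n (fun i => chi i v))]).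
- by exists V0.
- have [Z DZ ZVW] := DI _ _ DV DW; exists Z => // v [/= Zv dv].
  by have [] := ZVW _ Zv.
- apply: contrapT => h0; apply: hn; exists V => // v Vv.
  by rewrite ltNge; apply/negP => dv; apply: h0; exists v.
have /choice[t ht] : forall i, exists t, tlim U (chi i) t.
  by move=> i; exact: ultra_tlim.
have Gt : G t.
  move=> V DV r r0.
  have Uk : U [set v | forall i, (i < k)%N -> cnorm (chi i v - t i) < r].
    elim: (k) => [|j IHj]; first by apply: filterE.
    apply: filterS (filterI IHj (ht j _ r0)) => v [/= h1 h2] i.
    by rewrite ltnS leq_eqVlt => /orP[/eqP ->|/h1].
  have [v [/= [Vv _] hv]] := filter_ex (filterI (UV _ DV) Uk).
  by exists v.
have lt : tlim U (fun v => lc k n (fun i => chi i v)) (lc k n t).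
  by apply: tlim_sum => i; exact: tlimMz.
have [v [/= [_ dv]]] := filter_ex (filterI (UV _ DV0) (lt _ d0)).
by rewrite (nG _ Gt) subr0 ltNge dv.
Qed.

End PeterWeyl.

(** * Group topologies defined by a base at the origin *)

Section GroupTop.
Variables (M : zmodType) (D : set_system M).
Hypothesis gD : gbase D.

Definition gopen : set (set M) :=
  [set O | forall x, O x -> exists2 U, D U & forall y, U y -> O (x + y)].

Fact gopenT : gopen setT.
Proof. by have [[U DU] _ _ _] := gD; move=> x _; exists U. Qed.

Fact gopenI U V : gopen U -> gopen V -> gopen (U `&` V).
Proof.
have [_ DI _ _] := gD.
move=> oU oV x [/oU[A DA AU] /oV[B DB BV]]; have [C DC CAB] := DI _ _ DA DB.
by exists C => // y /CAB[/AU ? /BV].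
Qed.

Fact gopenU (F : set (set M)) : F `<=` gopen -> gopen (\bigcup_(U in F) U).
Proof.
move=> Fo x [U FU Ux]; have [A DA AU] := Fo _ FU _ Ux.
by exists A => // y /AU ?; exists U.
Qed.

Definition gtop := TopologyOn gopenT gopenI gopenU.
Local Notation Gt := (retopologized gtop).

Lemma gtop_nbhs (x : Gt) (A : set Gt) :
  nbhs x A <-> exists2 U, D U & forall y, U y -> A (x + y).
Proof.
have [_ _ D0 DB] := gD.
rewrite nbhsE; split=> [[O [oO Ox] OA]|[U DU UA]].
  by have [U DU UO] := oO _ Ox; exists U => // y /UO/OA.
exists [set z : Gt | exists2 U, D U & forall y, U y -> A (z + y)].
  split; last by exists U.
  move=> z [V DV VA]; have [W DW [WV WW]] := gbaseD gD DV.
  exists W => // w Ww; exists W => // w' Ww'; rewrite -addrA; apply: VA; exact: WW.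
by move=> z [V DV VA]; rewrite -[z]addr0; apply: VA; exact: D0.
Qed.

Lemma gtop_group : is_group_topology gtop.
Proof.
have [_ _ D0 DB] := gD; split.
  move=> [x y] A /gtop_nbhs[U DU UA]; have [V DV [_ VV]] := gbaseD gD DU.
  exists ([set z | exists2 v, V v & z = x + v], [set z | exists2 v, V v & z = y + v]).
    split; apply/gtop_nbhs; exists V => // v Vv; exists v => //.
  move=> [u v] [/= [a Va ->] [b Vb ->]]; rewrite addrACA; apply: UA; exact: VV.
move=> x A /gtop_nbhs[U DU UA]; apply/gtop_nbhs; have [V DV hV] := DB _ DU.
by exists V => // v Vv; rewrite /= opprD; apply: UA; rewrite -sub0r; apply: hV => //; exact: D0.
Qed.

Lemma gtop_hausdorff : (forall x, x != 0 -> exists2 U, D U & ~ U x) ->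
  hausdorff_space Gt.
Proof.
have [_ _ D0 DB] := gD.
move=> sep p q pq; apply/eqP; apply: contraT; rewrite -subr_eq0 => /sep[U DU nU].
have [V DV hV] := DB _ DU.
have [||z [[u Vu ->] [v Vv E]]] := pq [set z | exists2 v, V v & z = p + v]
  [set z | exists2 v, V v & z = q + v].
- by apply/gtop_nbhs; exists V => // v Vv; exists v.
- by apply/gtop_nbhs; exists V => // v Vv; exists v.
case: nU; have -> : p - q = v - u by rewrite -[p](addrK u) E; zmod.
exact: hV.
Qed.

Fact gtop_add : continuous (fun x : Gt * Gt => x.1 + x.2).
Proof. exact: gtop_group.1. Qed.
Fact gtop_opp : continuous (-%R : Gt -> Gt).
Proof. exact: gtop_group.2. Qed.

Definition gtopType : Type := Gt.
HB.instance Definition _ := GRing.Zmodule.on gtopType.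
HB.instance Definition _ := Topological.on gtopType.
HB.instance Definition _ :=
  PreTopologicalNmodule_isTopologicalNmodule.Build gtopType gtop_add.
HB.instance Definition _ :=
  TopologicalNmodule_isTopologicalZmodule.Build gtopType gtop_opp.

End GroupTop.

Section TopGroup.
Variable G : topologicalZmodType.

Lemma nbhs_translate (x : G) (U : set G) :
  nbhs (0 : G) U -> nbhs x [set y | U (y - x)].
Proof.
move=> nU; have := @sub_continuous G (x, x); rewrite /continuous_at /= subrr.
move=> /(_ _ nU) [[A B] /= [nA nB] AB]; apply: filterS nA => y Ay /=.
by apply: (AB (y, x)); split=> //=; exact: nbhs_singleton.
Qed.

Lemma nbhs_translateN (x : G) (U : set G) :
  nbhs x U -> nbhs (0 : G) [set y | U (x + y)].
Proof.
move=> nU; have := @add_continuous G (x, 0); rewrite /continuous_at /= addr0.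
move=> /(_ _ nU) [[A B] /= [nA nB] AB]; apply: filterS nB => y By /=.
by apply: (AB (x, y)); split=> //=; exact: nbhs_singleton.
Qed.

Lemma gbase_nbhs : gbase (nbhs (0 : G)).
Proof.
split.
- by exists setT; exact: filterT.
- by move=> U V nU nV; exists (U `&` V) => //; exact: filterI.
- by move=> U /nbhs_singleton.
- move=> U nU; have := @sub_continuous G (0, 0); rewrite /continuous_at /= subrr.
  move=> /(_ _ nU) [[A B] /= [nA nB] AB]; exists (A `&` B); first exact: filterI.
  by move=> x y [Ax _] [_ By]; exact: (AB (x, y)).
Qed.

Lemma not_minimal (D : set_system G) : gbase D ->
  (forall U, D U -> nbhs (0 : G) U) ->
  (forall x, x != 0 -> exists2 U, D U & ~ U x) ->
  (exists2 W, nbhs (0 : G) W & forall U, D U -> ~ (U `<=` W)) ->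
  ~ minimal_group G.
Proof.
move=> gD Dn sep [W nW hW] [_]; apply; exists (gtop gD); split.
- exact: gtop_group.
- exact: gtop_hausdorff.
split.
  move=> O oO; rewrite /= openE => x Ox; have [U DU UO] := oO _ Ox.
  apply: filterS (nbhs_translate x (Dn _ DU)) => y /= /UO.
  by rewrite addrC subrK.
move=> /(_ (interior W) (@open_interior _ W)) /(_ 0) [|U DU UW].
  exact: nW.
by apply: (hW _ DU) => x /UW; rewrite add0r => /nbhs_singleton.
Qed.

End TopGroup.

Lemma hausdorff_nbhs0 (G : topologicalZmodType) (g : G) : hausdorff_space G -> g != 0 ->
  exists2 W, nbhs (0 : G) W & ~ W g.
Proof.
move=> hG gn0; apply: contrapT => h; move/eqP: gn0; apply; apply: (hG g 0) => A B nA nB.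
exists g; split; first exact: nbhs_singleton.
by apply: contrapT => nBg; apply: h; exists B.
Qed.

(** * Precompactness of minimal connected groups *)

Definition sdiff (M : zmodType) (E : set M) : set M :=
  [set z | exists x y, [/\ E x, E y & z = x - y]].

Lemma big_sub (M : zmodType) (E E' : set M) : E `<=` E' -> big E -> big E'.
Proof. by move=> EE' [F hF]; exists F => x; have [a aF /EE'] := hF x; exists a. Qed.

(** Induction on [s]. Choose [y] such that [y - (b - a)] is not in the difference set of [E j] for
    [a], [b] in [F], and [x] avoiding the other sets for [F] and for [F - y]. Then [x] and [x + y]
    both avoid the other sets, and they cannot both hit [E j]. *)
Lemma avoid_nonbig (M : zmodType) (J : eqType) (E : J -> set M) (s : seq J) :
  (forall j, j \in s -> ~ big (sdiff (E j))) ->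
  forall F : seq M, exists x, forall j a, j \in s -> a \in F -> ~ E j (x - a).
Proof.
elim: s => [|j s IH] nb F; first by exists 0.
have [y hy] : exists y, forall a b, a \in F -> b \in F -> ~ sdiff (E j) (y - (a - b)).
  apply: contrapT => h; apply: (nb j); first by rewrite mem_head.
  exists [seq a - b | a <- F, b <- F] => x; apply: contrapT => h'; apply: h.
  by exists x => a b aF bF Exab; apply: h'; exists (a - b) => //; apply: allpairs_f.
have [i js|x hx] := IH _ (F ++ [seq a - y | a <- F]).
  by apply: nb; rewrite inE js orbT.
have hx1 i a : i \in s -> a \in F -> ~ E i (x - a).
  by move=> si aF; apply: hx => //; rewrite mem_cat aF.
have hx2 i a : i \in s -> a \in F -> ~ E i (x + y - a).
  move=> si aF; have -> : x + y - a = x - (a - y) by zmod.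
  apply: hx => //; rewrite mem_cat; apply/orP; right.
  by apply/mapP; exists a.
have [[a aF Ea]|nE] := pselect (exists2 a, a \in F & E j (x - a)); last first.
  exists x => i a; rewrite inE => /orP[/eqP -> aF Ea|]; last exact: hx1.
  by apply: nE; exists a.
exists (x + y) => i b; rewrite inE => /orP[/eqP -> bF Eb|]; last exact: hx2.
apply: (hy b a bF aF); exists (x + y - b), (x - a); split=> //; zmod.
Qed.

(** The centres of the covering need not be images under [f]; replacing them by images costs the
    passage from [A] to its difference set. *)
Lemma big_preim (M M' : zmodType) (f : M -> M') (A : set M') (F : seq M') : hom f ->
  (forall x, exists2 a, a \in F & A (f x - a)) -> big [set x | sdiff A (f x)].
Proof.
move=> hf hF.
have /choice[c hc] : forall a, exists c, (exists x, A (f x - a)) -> A (f c - a).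
  move=> a; have [[x Ax]|n] := pselect (exists x, A (f x - a)); first by exists x.
  by exists 0 => /n.
exists (map c F) => x; have [a aF Aa] := hF x; exists (c a); first exact: map_f.
exists (f x - a), (f (c a) - a); split=> //; first by apply: hc; exists x.
by rewrite (homB hf); zmod.
Qed.

Lemma zrange b : exists s : seq int, forall k : int, (`|k| <= b)%N -> k \in s.
Proof.
exists [seq (k%:Z - b%:Z)%R | k <- iota 0 (b + b).+1] => k kb.
apply/mapP; exists `|(k + b%:Z)%R|%N; last by lia.
by rewrite mem_iota; lia.
Qed.

Lemma fin_sums (M : zmodType) (x : nat -> M) b n : exists L : seq M, forall p : nat -> int,
  (forall i, (i < n)%N -> (`|p i| <= b)%N) -> \sum_(i < n) x i *~ p i \in L.
Proof.
have [s hs] := zrange b.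
elim: n => [|n [L hL]]; first by exists [:: 0] => p _; rewrite big_ord0 mem_head.
exists [seq l + x n *~ k | l <- L, k <- s] => p hp; rewrite big_ord_recr /=.
apply: allpairs_f; first by apply: hL => i ni; apply: hp; apply: ltnW.
by apply: hs; apply: hp.
Qed.

Lemma last_index (Q : pred nat) n : (forall i, Q i -> (i < n)%N) -> (exists i, Q i) ->
  exists2 k, Q k & forall i, (k < i)%N -> ~~ Q i.
Proof.
move=> Qn [i0 Qi0].
have ub i : Q i -> (i <= n)%N by move=> /Qn/ltnW.
have [k Qk hk] := ex_maxnP (ex_intro _ i0 Qi0) ub.
by exists k => // i; rewrite ltnNge; apply: contra => /hk.
Qed.

Section Combinations.
Variables (M : zmodType) (x : nat -> M).
Implicit Types p : {poly int}.

(** Integer polynomials serve as the free abelian group on [nat], and [iot x] is the homomorphism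
    sending the generator ['X^i] to [x i]. *)
Definition iot (p : {poly int}) : M := \sum_(i < size p) x i *~ p`_i.

Lemma iotE n p : (size p <= n)%N -> iot p = \sum_(i < n) x i *~ p`_i.
Proof.
move=> pn; rewrite /iot (big_ord_widen n (fun i => x i *~ p`_i) pn) big_mkcond.
by apply: eq_bigr => i _; case: ltnP => // h; rewrite nth_default.
Qed.

Lemma iot_hom : hom iot.
Proof.
move=> p q; pose n := maxn (size p) (size q).
rewrite !(@iotE n) ?leq_maxl ?leq_maxr//; last exact: leq_trans (size_polyD _ _) _.
by rewrite -big_split; apply: eq_bigr => i _; rewrite coefD mulrzDr.
Qed.

Lemma iotX i : iot 'X^i = x i.
Proof.
rewrite /iot size_polyXn big_ord_recr /= coefXn eqxx mulr1z big1 ?add0r// => j _.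
by rewrite coefXn ltn_eqF ?mulr0z.
Qed.

Lemma iot_top d n p : (forall i, (n < i)%N -> (d %| p`_i)%Z) ->
  exists y, iot p = \sum_(i < n) x i *~ p`_i + x n *~ p`_n + y *~ d.
Proof.
move=> hd; pose N := maxn (size p) n.+1.
rewrite (@iotE N) ?leq_maxl// -(big_mkord xpredT (fun i => x i *~ p`_i)).
rewrite (@big_cat_nat _ _ _ n.+1)//= ?leq_maxr// big_nat_recr//= big_mkord.
exists (\sum_(n.+1 <= i < N) x i *~ (p`_i %/ d)%Z); congr (_ + _).
have hm : hom (fun z : M => z *~ d) by move=> a b; rewrite mulrzDl.
have /= -> := hom_sum hm (index_iota n.+1 N) xpredT (fun i => x i *~ (p`_i %/ d)%Z).
rewrite big_nat [RHS]big_nat.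
apply: eq_bigr => i /andP[ni _]; rewrite -mulrzA divzK//; exact: hd.
Qed.

End Combinations.

(* In [slow m], coefficient number i is at most 2^(i-m); it vanishes for i < m. *)
Definition slow m (p : {poly int}) := forall i, (`|(p`_i)%R| * 2 ^ m <= 2 ^ i)%N.

Lemma slow_coef0 m (p : {poly int}) i : slow m p -> (i < m)%N -> p`_i = 0.
Proof.
move=> /(_ i) h im; have : (2 ^ i < 2 ^ m)%N by rewrite ltn_exp2l.
case: (p`_i =P 0) => // pn0; have : (0 < `|(p`_i)%R|)%N by lia.
by move: h; nia.
Qed.

Lemma slow_le m m' p : (m <= m')%N -> slow m' p -> slow m p.
Proof.
move=> mm' h i; apply: leq_trans (h i); rewrite leq_mul2l leq_exp2l// mm'.
by rewrite orbT.
Qed.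

Lemma slowB m p q : slow m.+1 p -> slow m.+1 q -> slow m (p - q).
Proof.
have aux (a b c u v : nat) : (c <= a + b)%N -> (a * (2 * u) <= v)%N ->
  (b * (2 * u) <= v)%N -> (c * u <= v)%N by nia.
move=> hp hq i; rewrite coefB.
have h : (`|(p`_i - q`_i)%R| <= `|(p`_i)%R| + `|(q`_i)%R|)%N by lia.
by have := hp i; have := hq i; rewrite expnS => h1 h2; exact: aux h h2 h1.
Qed.

Lemma slow0 m : slow m 0.
Proof. by move=> i; rewrite coef0. Qed.

Section Destroy.
Variables (R : realType) (G : topologicalZmodType) (x : nat -> G).

(** [c i] lists the values of a character of the free group at the generators, and [iot (c i)] is
    that character. The growth bound in [slow] leaves finitely many combinations of the first terms
    of [x], so that each new term can be chosen to avoid trouble with all of them. *)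
Definition dset (V : set G) m k (c : nat -> nat -> circle R) (e : R) : set G :=
  [set g | exists p, [/\ slow m p, forall i, (i < k)%N -> cnorm (iot (c i) p) < e
    & V (g - iot x p)]].

Definition dbase : set_system G := [set W | exists V m k c (e : R),
  [/\ nbhs (0 : G) V, 0 < e & W = dset V m k c e]].

Lemma dbase_gbase : gbase dbase.
Proof.
have [_ DI D0 DB] := gbase_nbhs G; split.
- exists (dset setT 0 0 (fun _ _ => 0) 1), setT, 0%N, 0%N, (fun _ _ => 0), 1.
  by split=> //; exact: filterT.
- move=> _ _ [V [m [k [c [e [nV e0 ->]]]]]] [V' [m' [k' [c' [e' [nV' e0' ->]]]]]].
  pose c2 i := if (i < k)%N then c i else c' (i - k)%N.
  exists (dset (V `&` V') (maxn m m') (k + k') c2 (Num.min e e')).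
    exists (V `&` V'), (maxn m m'), (k + k')%N, c2, (Num.min e e'); split=> //.
      exact: filterI.
    by rewrite lt_min e0.
  move=> g [p [sp hp [Vg V'g]]]; split; exists p; split=> //.
  + exact: slow_le (leq_maxl _ _) sp.
  + move=> i ik; have := hp i; rewrite /c2 ik lt_min => /(_ (ltn_addr _ ik)).
    by case/andP.
  + exact: slow_le (leq_maxr _ _) sp.
  + move=> i ik; have := hp (k + i)%N; rewrite /c2 ltn_add2l addKn.
    have -> : (k + i < k)%N = false by lia.
    by rewrite lt_min => /(_ ik)/andP[].
- move=> _ [V [m [k [c [e [nV e0 ->]]]]]]; exists 0; split; first exact: slow0.
    by move=> i ik; rewrite (hom0 (iot_hom _)) cnorm0.
  by rewrite (hom0 (iot_hom _)) subr0; exact: D0.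
- move=> _ [V [m [k [c [e [nV e0 ->]]]]]]; have [W nW hW] := DB _ nV.
  have e20 : 0 < e / 2 by rewrite divr_gt0.
  exists (dset W m.+1 k c (e / 2)); first by exists W, m.+1, k, c, (e / 2).
  move=> g g' [p [sp hp Wp]] [p' [sp' hp' Wp']]; exists (p - p'); split.
  + exact: slowB.
  + move=> i ik; rewrite (homB (iot_hom _)); apply: le_lt_trans (cnormB _ _) _.
    by rewrite (splitr e) ltrD ?hp ?hp'.
  + rewrite (homB (iot_hom _)).
    have -> : g - g' - (iot x p - iot x p') = (g - iot x p) - (g' - iot x p') by zmod.
    exact: hW.
Qed.

(** The first hypothesis serves to separate points: it confines the combinations near a point [g] to
    one residue class modulo [d], and a combination divisible by [d] is [d] times one that Foelner's
    theorem controls. By the second hypothesis the differences of [x] stay away from 0 in [G],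
    whereas they come close to 0 in the new topology, which is therefore strictly coarser. *)
Lemma slow_not_minimal :
  (forall W, nbhs (0 : G) W -> exists d m V, [/\ nbhs (0 : G) V,
    forall p, slow m p -> V (iot x p) -> forall i, (d%:Z %| p`_i)%Z &
    d = 0%N \/ (0 < d)%N /\ big [set g | W (g *+ d)]]) ->
  (exists2 U, nbhs (0 : G) U & exists N, forall i j, (N <= i < j)%N -> ~ U (x j - x i)) ->
  hausdorff_space G -> ~ minimal_group G.
Proof.
move=> hd [U nU [N hU]] hG; have [_ DI D0 DB] := gbase_nbhs G.
apply: (not_minimal dbase_gbase).
- move=> _ [V [m [k [c [e [nV e0 ->]]]]]]; apply: filterS nV => g Vg; exists 0.
  split; first exact: slow0.
    by move=> i ik; rewrite (hom0 (iot_hom _)) cnorm0.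
  by rewrite (hom0 (iot_hom _)) subr0.
- move=> g gn0.
  have [W nW nWg] := hausdorff_nbhs0 hG gn0.
  have [W1 nW1 hW1] := DB _ nW; have [W2 nW2 hW2] := DB _ nW1.
  have [W3 nW3 hW3] := DB _ nW2.
  have W32 z : W3 z -> W2 z by move=> h; rewrite -[z]subr0; apply: hW3 => //; exact: D0.
  have W21 z : W2 z -> W1 z by move=> h; rewrite -[z]subr0; apply: hW2 => //; exact: D0.
  have W1W z : W1 z -> W z by move=> h; rewrite -[z]subr0; apply: hW1 => //; exact: D0.
  have [d [m [V [nV hV hdW]]]] := hd _ nW3.
  have [V1 nV1 hV1] := DB _ nV.
  pose V2 := V1 `&` W2; have nV2 : nbhs (0 : G) V2 by apply: filterI.
  pose D1 m' := dset V2 m' 0 (fun _ _ => 0) 1.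
  have DD1 m' : dbase (D1 m') by exists V2, m', 0%N, (fun _ _ => 0), 1.
  have [D1g|nD1g] := pselect (D1 m.+1 g); last by exists (D1 m.+1).
  have [p0 [sp0 _ [V1g W2g]]] := D1g.
  have hdiv p : slow m.+1 p -> V2 (g - iot x p) -> forall i, (d%:Z %| p`_i - p0`_i)%Z.
    move=> sp [V1g' _] i; rewrite -coefB; apply: hV; first exact: slowB.
    rewrite (homB (iot_hom _)).
    have -> : iot x p - iot x p0 = (g - iot x p0) - (g - iot x p) by zmod.
    exact: hV1.
  (* All combinations near [g] agree with [p0] modulo [d]. If the coefficient of [p0] at [i0] is not
     divisible by [d], taking the first parameter above [i0] makes that coefficient of [p] vanish,
     so [g] is excluded. *)
  have [dp0|ndp0] := pselect (forall i, (d%:Z %| p0`_i)%Z); last first.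
    have [i0 hi0] : exists i, ~~ (d%:Z %| p0`_i)%Z.
      by apply: contrapT => h; apply: ndp0 => i; apply: contraT => hi; case: h; exists i.
    exists (D1 (maxn m.+1 i0.+1)) => // -[p [sp _ Vp]].
    have := hdiv _ (slow_le (leq_maxl _ _) sp) Vp i0.
    rewrite (slow_coef0 sp) ?leq_maxr// sub0r rpredN.
    by apply/negP.
  have {}hdiv p : slow m.+1 p -> V2 (g - iot x p) -> forall i, (d%:Z %| p`_i)%Z.
    by move=> sp Vp i; have := rpredD (hdiv p sp Vp i) (dp0 i); rewrite subrK.
  case: hdW => [d0|[dgt0 bigW]].
    exists (D1 m.+1) => // -[p [sp _ Vp]]; apply: nWg.
    have p0' : p = 0.
      apply/polyP => i; rewrite coef0; apply/eqP.
      by have := hdiv p sp Vp i; rewrite d0 dvd0z.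
    by move: Vp => [_]; rewrite p0' (hom0 (iot_hom _)) subr0 => /W21/W1W.
  have [k [chi [e [e0 hchi hE]]]] := folner R bigW.
  (* Divide the values of [chi i] on the terms of [x] by [d]: then the character [c i] at [p] equals
     [chi i] at [t], where [d] times [t] is [iot x p]. *)
  have /choice[c hc] : forall i, exists c : nat -> circle R,
      forall j, c j *+ d = chi i (x j).
    move=> i; have /choice[c hc] : forall j, exists s : circle R, s *+ d = chi i (x j).
      by move=> j; exact: circle_div.
    by exists c.
  exists (dset V2 m.+1 k c e); first by exists V2, m.+1, k, c, e.
  move=> [p [sp hp Vp]]; have dp := hdiv p sp Vp; apply: nWg.
  pose t := \sum_(i < size p) x i *~ (p`_i %/ d%:Z)%Z.
  have td : t *+ d = iot x p.
    rewrite /t -sumrMnl; apply: eq_bigr => i _.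
    by rewrite pmulrn -mulrzA divzK.
  have [i ik|a [b [a' [b' [[Wa Wb Wa' Wb'] tE]]]]] := hE t.
    have -> : chi i t = iot (c i) p; last exact: hp.
    rewrite (hom_sum (hchi i)); apply: eq_bigr => j _.
    by rewrite (homMz (hchi i)) -hc pmulrn -mulrzA mulrC divzK.
  have -> : g = (a *+ d - b *+ d) - (b' *+ d - a' *+ d) - (iot x p - g).
    have -> : iot x p = (a *+ d - b *+ d) + (a' *+ d - b' *+ d).
      by rewrite -td tE mulrnDl !mulrnBl.
    zmod.
  have [V1p W2p] := Vp.
  apply: hW1; first by apply: hW2; apply: hW3.
  by rewrite -[iot x p - g]opprB -sub0r; apply: hW2 => //; exact: D0.
exists U => // _ [V [m [k [c [e [nV e0 ->]]]]]] sub.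
(* Pigeonhole for the [k] characters: two terms far out have nearly equal values, so their
   difference lies in the new neighbourhood but not in [U]. *)
have [F [UF FN]] := free_ultra_nat.
have /choice[t ht] : forall i, exists t, tlim F (fun n => c i n) t.
  by move=> i; exact: ultra_tlim.
have e20 : 0 < e / 2 by rewrite divr_gt0.
have FA : F [set n | forall i, (i < k)%N -> cnorm (c i n - t i) < e / 2].
  elim: (k) => [|j IHj]; first by apply: filterE.
  apply: filterS (filterI IHj (ht j _ e20)) => n [/= h1 h2] i.
  by rewrite ltnS leq_eqVlt => /orP[/eqP ->|/h1].
have [i [/= hi Ni]] := filter_ex (filterI FA (FN (maxn N m))).
have [j [/= hj ij]] := filter_ex (filterI FA (FN i.+1)).
move: Ni; rewrite geq_max => /andP[Ni mi].
have mj : (m <= j)%N by rewrite (leq_trans mi)// ltnW.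
apply: (hU i j); first by rewrite Ni.
apply: sub; exists ('X^j - 'X^i); split.
- move=> l; rewrite coefB !coefXn.
  have [->|lj] := eqVneq l j; first by rewrite gtn_eqF // mulr0n subr0 mul1n leq_exp2l.
  have [->|li] := eqVneq l i; first by rewrite mulr0n sub0r abszN mul1n leq_exp2l.
  by rewrite mulr0n subr0.
- move=> l lk; rewrite (homB (iot_hom _)) !iotX.
  apply: le_lt_trans (cnorm_tri (t l) _ _) _.
  by rewrite (splitr e) ltrD ?hj// cnorm_distC hi.
- by rewrite (homB (iot_hom _)) !iotX subrr; exact: nbhs_singleton.
Qed.

End Destroy.

Lemma open_subgroup_full (G : topologicalZmodType) (H U : set G) :
  connected [set: G] -> is_subgroup H -> nbhs (0 : G) U -> U `<=` H -> H = setT.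
Proof.
move=> cG hH nU UH.
have HU z : nbhs z [set y | U (y - z)] by exact: nbhs_translate.
have oH : open H.
  rewrite openE => z Hz; apply: filterS (HU z) => y /= /UH Hy.
  by rewrite -(subrK z y); exact: subgroupD.
have cH : closed H.
  move=> z /(_ _ (HU z))[y [Hy /= /UH Hyz]].
  have -> : z = y - (y - z) by zmod.
  exact: hH.2.
apply: cG; first by exists 0; exact: hH.1.
  by exists H => //; rewrite setTI.
by exists H => //; rewrite setTI.
Qed.

Lemma small_torsion (R : realType) (t : circle R) k : t *+ k.+1 = 0 ->
  cnorm t < k.+1%:R^-1 -> t = 0.
Proof.
move=> tk tlt; apply: no_small_subgroup => n.
have -> : t *+ n = t *+ (n %% k.+1) by apply: mulrn_eqmod tk _; rewrite modn_mod.
apply: le_lt_trans (cnormMn _ _) _; rewrite -mulr_natl.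
apply: (@le_lt_trans _ _ (k.+1%:R * cnorm t)).
  by rewrite ler_wpM2r ?cnorm_ge0// ler_nat ltnW// ltn_mod.
by rewrite mulrC -ltr_pdivlMr ?ltr0n// div1r.
Qed.

(** Multiplication by an inverse [r'] of [r] modulo [q] replaces the coefficient [m r] by [m], up to
    a multiple of [q m]. *)
Lemma bezout_mult (M : zmodType) (c d : M) (m q : nat) (r r' w : int) :
  r' * r = 1 - q%:Z * w ->
  (c *~ (m%:Z * r) - d *+ (q * m)) *~ r' = c *+ m - (d *~ r' + c *~ w) *+ (q * m).
Proof.
move=> E.
have -> : (c *~ (m%:Z * r) - d *+ (q * m)) *~ r' = c *~ (m%:Z * (r' * r)) - d *~ ((q * m)%:Z * r').
  by rewrite pmulrn mulrzBl -!mulrzA; congr (c *~ _ - _); ring.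
have -> : (d *~ r' + c *~ w) *+ (q * m) = d *~ ((q * m)%:Z * r') + c *~ (w * (q * m)%:Z).
  by rewrite pmulrn mulrzDl -!mulrzA [r' * _]mulrC.
have -> : m%:Z * (r' * r) = m%:Z - w * (q * m)%:Z by rewrite E PoszM; ring.
by rewrite mulrzBr -pmulrn; zmod.
Qed.

Section Precompact.
Variables (R : realType) (G : topologicalZmodType).
Hypothesis cG : connected [set: G].
Local Notation N0 := (nbhs (0 : G)).

Lemma nbhs_mulrn U n : N0 U -> exists2 V, N0 V & forall k z, (k <= n)%N -> V z -> U (z *+ k).
Proof.
move=> nU; elim: n => [|n [V nV hV]].
  by exists U => // k z; rewrite leqn0 => /eqP -> _; rewrite mulr0n; exact: nbhs_singleton.
suff [W nW hW] : exists2 W, N0 W & forall z, W z -> U (z *+ n.+1).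
  exists (V `&` W); first exact: filterI.
  by move=> k z; rewrite leq_eqVlt => /orP[/eqP -> [_ /hW]|kn [Vz _]] //; exact: hV.
elim: n.+1 U nU {hV} => [|m IH] U nU.
  by exists U => // z _; rewrite mulr0n; exact: nbhs_singleton.
have [W nW [WU hW]] := gbaseD (gbase_nbhs G) nU; have [W' nW' hW'] := IH _ nW.
exists (W `&` W'); first exact: filterI.
by move=> z [Wz /hW' Wz']; rewrite mulrS; exact: hW.
Qed.

Definition near_mult (m l : nat) (O : set G) : set G :=
  [set z | exists y, O (z *+ m - y *+ l)].

(* Otherwise there is a nonzero continuous character of exponent [q], which
   connectedness excludes. *)
Lemma big_near_mult m q : (0 < q)%N ->
  (forall O, N0 O -> big (near_mult m (q * m) O)) ->
  forall O, N0 O -> near_mult m (q * m) O = setT.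
Proof.
move=> q0 hb O nO; have [_ DI D0 DB] := gbase_nbhs G.
apply/seteqP; split=> // g _; apply: contrapT => ng.
pose D := [set S | exists2 O, N0 O & S = near_mult m (q * m) O].
have gD : gbase D; first split.
- by exists (near_mult m (q * m) O), O.
- move=> _ _ [U nU ->] [V nV ->]; exists (near_mult m (q * m) (U `&` V)).
    by exists (U `&` V) => //; exact: filterI.
  by move=> z [y [Uy Vy]]; split; exists y.
- by move=> _ [U nU ->]; exists 0; rewrite !mul0rn subr0; exact: D0.
- move=> _ [U nU ->]; have [V nV hV] := DB _ nU.
  exists (near_mult m (q * m) V); first by exists V.
  move=> z z' [y Vy] [y' Vy']; exists (y - y'); rewrite !mulrnBl.
  have -> : z *+ m - z' *+ m - (y *+ (q * m) - y' *+ (q * m)) =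
    (z *+ m - y *+ (q * m)) - (z' *+ m - y' *+ (q * m)) by zmod.
  exact: hV.
have [|||chi [hchi chig chic]] := @char_ex R _ _ gD (near_mult m (q * m) O) g.
- by move=> _ [U nU ->]; exact: hb.
- by exists O.
- exact: ng.
(* The point [q z] belongs to every member of [D], with witness [z]. *)
have chiq z : chi z *+ q = 0.
  rewrite -(homMn hchi); apply/cnorm_eq0/le_anti; rewrite cnorm_ge0 andbT.
  apply/ler_addgt0Pr => e e0; rewrite add0r.
  have [_ [U nU ->] hU] := chic _ e0; apply/ltW/hU; exists z.
  by rewrite -mulrnA subrr; exact: D0.
have q1 : q = q.-1.+1 by rewrite prednK.
have qi : 0 < (q.-1.+1%:R : R)^-1 by rewrite invr_gt0 ltr0n.
have [_ [U nU ->] hU] := chic _ qi.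
have [V nV hV] := nbhs_mulrn m nU.
have hker : is_subgroup [set z | chi z = 0].
  by split=> [|z y /= h1 h2]; rewrite /= ?(hom0 hchi)// (homB hchi) h1 h2 subr0.
have := open_subgroup_full cG hker nV; move=> H.
have /seteqP[_ /(_ g I) /= chig0] : [set z | chi z = 0] = setT.
  apply: H => z Vz /=; apply: (@small_torsion _ _ q.-1); first by rewrite -q1.
  by apply: hU; exists 0; rewrite mul0rn subr0; apply: hV.
by rewrite chig0 eqxx in chig.
Qed.

(** Each [x n] is chosen so that no combination ending in it, with coefficients within the bounds,
    lies in [V]. A nonzero slow combination near 0 would contradict this at its last index, so
    [slow_not_minimal] applies with [d = 0]. *)
Lemma not_minimal_unbounded U : N0 U ->
  (forall k, (0 < k)%N -> ~ big [set z | U (z *+ k)]) ->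
  hausdorff_space G -> ~ minimal_group G.
Proof.
move=> nU hU hG; have [_ DI D0 DB] := gbase_nbhs G.
have [V' nV' hV'] := DB _ nU; have [V nV hV] := DB _ nV'.
pose V1 := V `&` [set z | V (- z)].
have VN : N0 [set z : G | V (- z)].
  have [W nW hW] := DB _ nV; apply: filterS (nW) => z Wz /=.
  by rewrite -[- z]sub0r; apply: hW => //; exact: D0.
have nV1 : N0 V1 by apply: filterI.
pose P (s : seq G) z := forall (k : nat) (p : nat -> int), (0 < k <= 2 ^ size s)%N ->
  (forall i, (i < size s)%N -> (`|p i| <= 2 ^ i)%N) ->
  ~ V (z *+ k + \sum_(i < size s) nth 0 s i *~ p i).
have [s|x hx] := @dep_choice_seq G P.
  have [L hL] := fin_sums (nth 0 s) (2 ^ size s) (size s).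
  have /choice[c hc] : forall kl : nat * G, exists c,
      (exists z, V (z *+ kl.1 + kl.2)) -> V (c *+ kl.1 + kl.2).
    move=> kl; have [[z Az]|n] := pselect (exists z, V (z *+ kl.1 + kl.2)); first by exists z.
    by exists 0 => /n.
  have [k ks|z hz] := @avoid_nonbig G nat (fun k => [set z | V' (z *+ k)])
      (iota 1 (2 ^ size s)) _ [seq c (k, l) | k <- iota 1 (2 ^ size s), l <- L].
    move: ks; rewrite mem_iota => /andP[k0 _] b; apply: (hU k) => //.
    apply: big_sub b => _ [a [b [Va Vb ->]]] /=; rewrite mulrnBl; exact: hV'.
  exists z => k p /andP[k0 ks] hp Vz; set l := \sum_(_ < _) _ in Vz.
  have kI : k \in iota 1 (2 ^ size s) by rewrite mem_iota k0 add1n ltnS.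
  apply: (hz k (c (k, l)) kI).
    apply: (allpairs_f (fun k l => c (k, l))) => //; apply: hL => i si.
    by apply: leq_trans (hp _ si) _; rewrite leq_exp2l// ltnW.
  rewrite /= mulrnBl.
  have -> : z *+ k - c (k, l) *+ k = (z *+ k + l) - (c (k, l) *+ k + l) by zmod.
  by apply: hV => //; apply: (hc (k, l)); exists z.
have {}hx n k p : (0 < k <= 2 ^ n)%N -> (forall i, (i < n)%N -> (`|p i| <= 2 ^ i)%N) ->
    ~ V (x n *+ k + \sum_(i < n) x i *~ p i).
  move=> kn hp; have := hx n; rewrite /P size_mkseq => /(_ k p kn hp).
  by under eq_bigr => i _ do rewrite nth_mkseq//.
apply: (@slow_not_minimal R G x) => //; last first.
  exists V => //; exists 0%N => i j /andP[_ ij] Vji.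
  apply: (hx j 1%N (fun l => if l == i then -1 else 0)).
  - by rewrite expn_gt0.
  - by move=> l _; case: eqP => // _; rewrite expn_gt0.
  rewrite mulr1n (bigD1 (Ordinal ij))//= eqxx mulrN1z big1 ?addr0// => l.
  by rewrite -val_eqE /= => /negPf ->; rewrite mulr0z.
move=> W nW; exists 0%N, 0%N, V1; split=> //; last by left.
move=> p sp [Vp VNp]; apply: contrapT => hn.
have [i0 hi0] : exists i, ~~ (0%:Z %| p`_i)%Z.
  by apply: contrapT => h; apply: hn => i; apply: contraT => hi; case: h; exists i.
have [||n pn hpn] := @last_index (fun i => ~~ (0%:Z %| p`_i)%Z) (size p).
- by move=> i; rewrite dvd0z; apply: contraR; rewrite -leqNgt => h; rewrite nth_default.
- by exists i0.
have [|y E] := @iot_top _ x 0 n p; first by move=> i /hpn; rewrite negbK.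
rewrite mulr0z addr0 in E.
have bd i : (`|(p`_i)%R| <= 2 ^ i)%N by have := sp i; rewrite muln1.
have pn0 : p`_n <> 0 by move/negP: pn; rewrite dvd0z => h h'; apply: h; apply/eqP.
have [p0|p0] := leP 0 p`_n.
  apply: (hx n `|(p`_n)%R|%N (fun i => p`_i)) => //.
    by rewrite bd andbT; lia.
  by rewrite addrC pmulrn gez0_abs// -E.
apply: (hx n `|(p`_n)%R|%N (fun i => - p`_i)) => //.
- by rewrite bd andbT; lia.
- by move=> i _; rewrite abszN.
rewrite addrC pmulrn ltz0_abs// -[X in V X]opprK opprD mulrNz opprK -sumrN.
under eq_bigr do rewrite -mulrNz opprK.
by rewrite -E.
Qed.

(** A sequence of primes in which every prime occurs infinitely often, read off from the exponent of
    2 in [j + 1]. *)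
Definition pr_seq j : nat := let q := logn 2 j.+1 in if prime q then q else 2.

Lemma pr_seq_prime j : prime (pr_seq j).
Proof. by rewrite /pr_seq; case: ifP. Qed.

Lemma pr_seq_ex q N : prime q -> exists2 j, (N <= j)%N & pr_seq j = q.
Proof.
move=> pq; have n0 : (0 < 2 ^ q * N.*2.+1)%N by rewrite muln_gt0 expn_gt0.
exists (2 ^ q * N.*2.+1).-1.
  have : (0 < 2 ^ q)%N by rewrite expn_gt0.
  by rewrite -muln2; nia.
rewrite /pr_seq prednK// lognM ?expn_gt0// pfactorK// logn_coprime ?addn0 ?pq//.
by rewrite prime_coprime// dvdn2 /= odd_double.
Qed.

Definition nontrivial_step m q O := N0 O /\ ~ big (near_mult m (q * m) O).

(** A prime is multiplied in only when the multiples by [q m] are not precompactly thick among those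
    by [m]. A skipped prime does no harm: [big_near_mult] makes the multiples by [q m] dense among
    those by [m]. *)
Lemma step_seq : exists m : nat -> nat, m 0%N = 1%N /\ forall j, (0 < m j)%N /\
  ((m j.+1 = pr_seq j * m j)%N /\ (exists O, nontrivial_step (m j) (pr_seq j) O) \/
   m j.+1 = m j /\ forall O, N0 O -> big (near_mult (m j) (pr_seq j * m j) O)).
Proof.
pose st j m := if `[< exists O, nontrivial_step m (pr_seq j) O >] then (pr_seq j * m)%N else m.
pose m := fix m j := if j is j'.+1 then st j' (m j') else 1%N.
exists m; split=> // j; split.
  elim: j => //= j IH; rewrite /st; case: ifP => // _.
  by rewrite muln_gt0 IH prime_gt0 ?pr_seq_prime.
rewrite /= /st; case: asboolP => [h|h]; [by left|right]; split=> // O nO.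
by apply: contrapT => nb; apply: h; exists O.
Qed.

(** Equivalently, the multiples by [m] lie in the closure of the multiples by [l]. *)
Definition dense_mult m l := forall O, N0 O -> near_mult m l O = setT.

Lemma dense_mult_trans m l k : dense_mult m l -> dense_mult l k -> dense_mult m k.
Proof.
move=> ml lk O nO; have [V nV [_ hV]] := gbaseD (gbase_nbhs G) nO.
apply/seteqP; split=> // z _.
have [y Vy] : near_mult m l V z by rewrite ml.
have [w Vw] : near_mult l k V y by rewrite lk.
exists w; have -> : z *+ m - w *+ k = (z *+ m - y *+ l) + (y *+ l - w *+ k) by zmod.
exact: hV.
Qed.

Lemma dense_multM m l c : dense_mult m l -> dense_mult (c * m) (c * l).
Proof.
move=> ml O nO; have [V nV hV] := nbhs_mulrn c nO; apply/seteqP; split=> // z _.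
have [y Vy] : near_mult m l V z by rewrite ml.
by exists y; rewrite ![(c * _)%N]mulnC !mulrnA -mulrnBl; apply: hV.
Qed.

Lemma dense_mult_refl m : dense_mult m m.
Proof.
move=> O nO; apply/seteqP; split=> // z _; exists z; rewrite subrr.
exact: nbhs_singleton.
Qed.

Section Case2.
Variable m : nat -> nat.
Hypothesis m0 : m 0%N = 1%N.
Hypothesis m_gt0 : forall j, (0 < m j)%N.
Hypothesis mS : forall j,
  ((m j.+1 = pr_seq j * m j)%N /\ (exists O, nontrivial_step (m j) (pr_seq j) O) \/
   m j.+1 = m j /\ forall O, N0 O -> big (near_mult (m j) (pr_seq j * m j) O)).

Lemma m_dvd i j : (i <= j)%N -> (m i %| m j)%N.
Proof.
elim: j => [|j IH]; first by rewrite leqn0 => /eqP ->.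
rewrite leq_eqVlt => /orP[/eqP -> //|/IH h]; apply: dvdn_trans h _.
by case: (mS j) => -[-> _] //; exact: dvdn_mull.
Qed.

(** Remove one prime factor of [k] at a time. A later occurrence of that prime in [pr_seq] is either
    multiplied in or skipped, and when it is skipped density replaces the missing factor. *)
Lemma m_dense k : (0 < k)%N -> exists j l, (k %| l)%N /\ dense_mult (m j) l.
Proof.
elim/ltn_ind: k => k IH k0; have [k1|k1] := leqP k 1.
  by exists 0%N, (m 0%N); rewrite (@dvdn_trans 1) ?dvd1n ?dvdn1 ?eqn_leq ?k1//; split=> //; exact: dense_mult_refl.
have pk := pdiv_prime k1; set q := pdiv k in pk.
have kE : k = (q * (k %/ q))%N by rewrite mulnC divnK// pdiv_dvd.
have [||j [l [kl dl]]] := IH (k %/ q)%N.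
- by rewrite ltn_Pdiv// prime_gt1.
- by rewrite divn_gt0 ?prime_gt0// dvdn_leq// pdiv_dvd.
have [j' jj' qj'] := pr_seq_ex j pk.
have /dvdnP[c mc] := m_dvd jj'.
have dl' : dense_mult (m j') (c * l) by rewrite mc; exact: dense_multM.
have kq : (k %| q * (c * l))%N by rewrite kE dvdn_pmul2l ?prime_gt0// dvdn_mull.
case: (mS j') => -[mj' h].
  by exists j'.+1, (q * (c * l))%N; split=> //; rewrite mj' qj'; exact: dense_multM.
exists j', (q * (c * l))%N; split=> //.
apply: (@dense_mult_trans _ (q * m j')); last exact: dense_multM.
by move=> O nO; apply: big_near_mult => //; [exact: prime_gt0|rewrite -qj'].
Qed.

(** The integer [k] belonging to a smaller neighbourhood can be replaced by some [m j], whose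
    multiples are approximated by multiples by [k]. *)
Lemma m_big : (forall W, N0 W -> exists2 k, (0 < k)%N & big [set z | W (z *+ k)]) ->
  forall W, N0 W -> exists j, big [set z | W (z *+ m j)].
Proof.
move=> hk W nW; have [_ DI D0 DB] := gbase_nbhs G.
have [W1 nW1 hW1] := DB _ nW; have [W2 nW2 [W21 hW2]] := gbaseD (gbase_nbhs G) nW1.
have [W3 nW3 hW3] := DB _ nW2; have [k k0 [F hF]] := hk _ nW3.
have [j [l [/dvdnP[c lc] dl]]] := m_dense k0; exists j.
have hc : hom (fun z : G => z *+ c) by move=> a b; rewrite mulrnDl.
have := @big_preim G G (fun z => z *+ c) [set z | W3 (z *+ k)] F hc.
move=> [z|F' hF']; first exact: hF.
have hm : hom (fun z : G => z *+ m j) by move=> a b; rewrite mulrnDl.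
have := @big_preim G G (fun z => z *+ m j) W1 [seq y *+ l | y <- F'] hm.
case=> [z|F2 hF2]; last first.
  exists F2 => z; have [a aF [b [b' [Wb Wb' E]]]] := hF2 z; exists a => //=.
  by rewrite E; apply: hW1.
have [y Wy] : near_mult (m j) l W2 z by rewrite dl.
have [a aF [b [b' [/= Wb Wb' E]]]] := hF' y.
exists (a *+ l); first exact: (map_f (fun y => y *+ l)).
have -> : z *+ m j - a *+ l = (z *+ m j - y *+ l) + (b *+ k - b' *+ k).
  have -> : b *+ k - b' *+ k = y *+ l - a *+ l by rewrite -mulrnBl -E -mulrnA -lc mulrnBl.
  zmod.
by apply: hW2 => //; apply: hW3.
Qed.

(** Now the integer attached to [W] is some [m j]. The terms of [x] are chosen so that no
    combination whose last coefficient is [m i * r], with [q i] not dividing [r], comes near the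
    multiples by [q i * m i]. So divisibility of the coefficients by [m i] propagates to
    [m i.+1]. *)
Lemma not_minimal_bounded : hausdorff_space G ->
  (forall W, N0 W -> exists2 k, (0 < k)%N & big [set z | W (z *+ k)]) ->
  (exists2 U, N0 U & ~ big U) -> ~ minimal_group G.
Proof.
move=> hG hk [U nU nbU]; have [_ DI D0 DB] := gbase_nbhs G.
have hb := m_big hk.
pose q := pr_seq; have pq j : prime (q j) := pr_seq_prime j.
pose nt j := exists O, nontrivial_step (m j) (q j) O.
pose E (V' : set G) i (r : int) : set G :=
  [set z | exists y, V' (z *~ ((m i)%:Z * r) - y *+ (q i * m i))].
(* Genericity is required for [V.1], whose differences fall into [V.2]. By [bezout_mult] a general
   [r] reduces to [r = 1], where not being big is what a nontrivial step means; for trivial steps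
   [setT] is a dummy value. *)
have /choice[V hV] : forall i, exists V : set G * set G, N0 V.1 /\ (nt i ->
    (forall a b, V.1 a -> V.1 b -> V.2 (a - b)) /\
    forall r : int, ~~ ((q i)%:Z %| r)%Z -> ~ big (sdiff (E V.2 i r))).
  move=> i; have [[O [nO hO]]|n] := pselect (nt i); last first.
    by exists (setT, setT); split=> [|/n//]; exact: filterT.
  have [O1 nO1 hO1] := nbhs_mulrn (q i) nO.
  have [V' nV' hV'] := DB _ nO1; have [V nV hV] := DB _ nV'.
  exists (V, V'); split=> // _; split=> // r qr b; apply: hO.
  apply: big_sub b => _ [a [b [[y ya] [y' yb] ->]]].
  have cop : coprimez r (q i)%:Z.
    have qr' : ~~ (q i %| `|r|)%N by move: qr; rewrite dvdzE.
    by rewrite coprimez_sym coprimezE prime_coprime//; exact: pq.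
  case/coprimezP: cop => -[u v] /= uv.
  pose r' := (u %% (q i)%:Z)%Z; have q0 : (q i)%:Z != 0 by have := prime_gt0 (pq i); lia.
  have r'0 : 0 <= r' by rewrite modz_ge0.
  have r'q : (`|r'| <= q i)%N.
    have : r' < (q i)%:Z by apply: ltz_pmod; have := prime_gt0 (pq i); lia.
    by lia.
  pose w := v + (u %/ (q i)%:Z)%Z * r.
  have Er : r' * r = 1 - (q i)%:Z * w.
    have -> : r' = u - (u %/ (q i)%:Z)%Z * (q i)%:Z 
      by apply/eqP; rewrite eq_sym subr_eq addrC -divz_eq.
    by rewrite -uv /w; ring.
  exists ((y - y') *~ r' + (a - b) *~ w).
  have := hO1 _ _ r'q (hV' _ _ ya yb); congr O; rewrite pmulrn gez0_abs//.
  rewrite -(bezout_mult _ _ _ Er); congr (_ *~ _); rewrite mulrzBl mulrnBl; zmod.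
pose P (s : seq G) z := forall i (r : int) (p : nat -> int), (i <= size s)%N -> nt i ->
  ~~ ((q i)%:Z %| r)%Z -> (`|r| <= 2 ^ size s)%N ->
  (forall l, (l < size s)%N -> (`|p l| <= 2 ^ l)%N) ->
  forall y, ~ (V i).1 (\sum_(l < size s) nth 0 s l *~ p l + z *~ ((m i)%:Z * r) - y *+ (q i * m i)).
have [s|x hx] := @dep_choice_seq G P.
  have [L hL] := fin_sums (nth 0 s) (2 ^ size s) (size s).
  have [rs hrs] := zrange (2 ^ size s).
  pose Q (ir : nat * int) (l z y : G) :=
    (V ir.1).1 (l + z *~ ((m ir.1)%:Z * ir.2) - y *+ (q ir.1 * m ir.1)).
  have /choice[c hc] : forall j : (nat * int) * G, exists c,
      (exists z y, Q j.1 j.2 z y) -> exists y, Q j.1 j.2 c y.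
    move=> j; have [[z Az]|n] := pselect (exists z y, Q j.1 j.2 z y); first by exists z.
    by exists 0 => /n.
  pose js := [seq j <- [seq (i, r) | i <- iota 0 (size s).+1, r <- rs] |
    `[< nt j.1 >] && ~~ ((q j.1)%:Z %| j.2)%Z].
  have [j|z hz] := @avoid_nonbig G _ (fun j => E (V j.1).2 j.1 j.2) js _
      [seq c (j, l) | j <- js, l <- L].
    rewrite mem_filter => /andP[/andP[/asboolP ntj qj] _].
    by apply: ((hV j.1).2 ntj).2.
  exists z => i r p si nti qr rs2 hp y Vz; set l := \sum_(_ < _) _ in Vz.
  have jJ : (i, r) \in js.
    rewrite mem_filter; apply/andP; split; first by apply/andP; split=> //; apply/asboolP.
    by apply/allpairsP; exists (i, r); split=> //; [rewrite mem_iota|exact: hrs].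
  have [|y' Vy'] := hc ((i, r), l); first by exists z, y.
  apply: (hz (i, r) (c ((i, r), l)) jJ).
    apply: (allpairs_f (fun j l => c (j, l))) => //; apply: hL => k sk.
    by apply: leq_trans (hp _ sk) _; rewrite leq_exp2l// ltnW.
  exists (y - y') => /=.
  have := ((hV i).2 nti).1 _ _ Vz Vy'; rewrite /= mulrzBl mulrnBl.
  set a := (a in (V i).2 a -> _); set b := (b in _ -> (V i).2 b).
  suff -> : a = b by []; rewrite /a /b; zmod.
have {}hx n i r p : (i <= n)%N -> nt i -> ~~ ((q i)%:Z %| r)%Z -> (`|r| <= 2 ^ n)%N ->
    (forall l, (l < n)%N -> (`|p l| <= 2 ^ l)%N) ->
    forall y, ~ (V i).1 (\sum_(l < n) x l *~ p l + x n *~ ((m i)%:Z * r) - y *+ (q i * m i)).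
  move=> ni nti qr rn hp y; have := hx n; rewrite /P size_mkseq => /(_ i r p ni nti qr rn hp y).
  by under eq_bigr => l _ do rewrite nth_mkseq//.
apply: (@slow_not_minimal R G x) => //; last first.
  have hm : exists j, m j != 1%N.
    have [j bj] := hb _ nU; exists j; apply/eqP => mj; apply: nbU.
    by apply: big_sub bj => z /=; rewrite mj.
  (* Some [m j] differs from 1, since otherwise [U] would be big. At the first such step [m i = 1],
     and genericity with [r = 1] keeps the differences of [x] out of [(V i).1]. *)
  case: (ex_minnP hm) => -[|i] mi mini; first by rewrite m0 in mi.
  have mi1 : m i = 1%N by apply/eqP; apply: contraT => /mini; rewrite ltnn.
  have nti : nt i by case: (mS i) => -[h1 h2] //; rewrite h1 mi1 in mi.
  exists (V i).1; first by have [] := hV i.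
  exists i => a b /andP[ia ab] Vba.
  apply: (hx b i 1 (fun l => if l == a then -1 else 0) _ nti _ _ _ 0).
  - by rewrite (leq_trans ia)// ltnW.
  - by rewrite dvdz1 /= neq_ltn prime_gt1 ?orbT.
  - by rewrite expn_gt0.
  - by move=> l _; case: eqP => // _; rewrite expn_gt0.
  rewrite mi1 mulr1 mul0rn subr0 (bigD1 (Ordinal ab))//= eqxx mulrN1z big1 ?addr0.
    by rewrite addrC.
  by move=> l; rewrite -val_eqE /= => /negPf ->; rewrite mulr0z.
move=> W nW; have [j bj] := hb _ nW.
exists (m j), j, [set z | forall i, (i < j)%N -> (V i).1 z]; split; last by right.
  elim: (j) => [|k IH]; first exact: filterE.
  apply: filterS (filterI IH (hV k).1) => z [h1 h2] i.
  by rewrite ltnS leq_eqVlt => /orP[/eqP ->|/h1].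
move=> p sp Vp.
suff H i : (i <= j)%N -> forall l, ((m i)%:Z %| p`_l)%Z by exact: H.
elim: i => [_ l|i IH ij]; first by rewrite m0 dvd1z.
have {}IH := IH (ltnW ij).
case: (mS i) => -[mSi h]; last by rewrite mSi.
rewrite mSi; apply: contrapT => hn.
have [l0 hl0] : exists l, ~~ ((q i * m i)%:Z %| p`_l)%Z.
  by apply: contrapT => h'; apply: hn => l; apply: contraT => hl; case: h'; exists l.
have [||n pn hpn] := @last_index (fun l => ~~ ((q i * m i)%:Z %| p`_l)%Z) (size p).
- by move=> l; apply: contraR; rewrite -leqNgt => h'; rewrite nth_default ?dvdz0.
- by exists l0.
have [|y Ey] := @iot_top _ x (q i * m i)%:Z n p; first by move=> l /hpn; rewrite negbK.
have bd l : (`|(p`_l)%R| <= 2 ^ l)%N.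
  by apply: leq_trans (sp l); rewrite leq_pmulr// expn_gt0.
have pn0 : p`_n != 0 by apply: contraNneq pn => ->; rewrite dvdz0.
(* Slowness kills the coefficients below [j], so the last bad index [n] is large enough for the
   genericity of [x n] to cover step [i]. *)
have jn : (j <= n)%N.
  by rewrite leqNgt; apply: contraNN pn0 => nj; rewrite (slow_coef0 sp nj).
have /dvdzP[r pr] := IH n.
apply: (hx n i r (fun l => p`_l) _ h _ _ (fun l _ => bd l) (- y)).
- exact: leq_trans (ltnW ij) jn.
- apply: contraNN pn => /dvdzP[c rc]; apply/dvdzP; exists c.
  by rewrite pr rc PoszM; ring.
- by apply: leq_trans (bd n); rewrite pr abszM; apply: leq_pmulr; exact: m_gt0.
by rewrite mulNrn opprK pmulrn [_ * r]mulrC -pr -Ey; apply: Vp.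
Qed.

End Case2.

Theorem minimal_precompact : minimal_group G -> forall U, N0 U -> big U.
Proof.
move=> mG U nU; have hG := mG.1; apply: contrapT => nb.
have [[W nW hW]|h] := pselect (exists2 W, N0 W &
    forall k, (0 < k)%N -> ~ big [set z | W (z *+ k)]).
  exact: not_minimal_unbounded nW hW hG mG.
have [m [m0 hm]] := step_seq.
apply: (@not_minimal_bounded m m0 _ _ hG _ _ mG).
- by move=> j; case: (hm j).
- by move=> j; case: (hm j).
- move=> W nW; apply: contrapT => h'; apply: h; exists W => // k k0 bk.
  by apply: h'; exists k.
- by exists U.
Qed.

End Precompact.

(** * Extension of homomorphisms into divisible groups *)

Lemma Zorn_nonempty (T : Type) (P : set (set T)) (X0 : set T) : P X0 ->
  (forall F : set (set T), F !=set0 -> F `<=` P -> total_on F subset ->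
     P (\bigcup_(X in F) X)) ->
  exists A, P A /\ forall B, P B -> A `<=` B -> B `<=` A.
Proof.
move=> PX0 hP.
have [F FP Ft|A [PA mA]] := @Zorn_bigcup T [set X | X = set0 \/ P X].
  have [[X [FX PX]]|hF] := pselect (exists X, F X /\ P X); [right|left].
    have -> : \bigcup_(X in F) X = \bigcup_(X in F `&` P) X.
      apply/seteqP; split=> x [Y FY Yx]; exists Y => //; last by case: FY.
      by split=> //; case: (FP _ FY) => // Y0; rewrite Y0 in Yx.
    apply: hP; first by exists X.
    - by move=> Y [].
    - by move=> Y Z [FY _] [FZ _]; exact: Ft.
  apply/seteqP; split=> // x [Y FY Yx]; case: (FP _ FY) => [Y0|PY].
    by rewrite Y0 in Yx.
  by case: hF; exists Y.
have mA' B : P B -> A `<=` B -> B `<=` A.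
  move=> PB AB; apply: contrapT => nBA; apply: (mA B); last by right.
  by split.
have [PA'|nPA] := pselect (P A); first by exists A.
case: PA => // A0; have /mA' := PX0; rewrite A0 => /(_ (@sub0set _ _)) X00.
by exists X0; split=> // B /mA'; rewrite A0 => /(_ (@sub0set _ _)) B0 _ z /B0.
Qed.

Section Baer.
Variables (R : realType) (M : zmodType) (E : set (circle R)).
Hypothesis hE : is_subgroup E.
Hypothesis divE : forall t n, (0 < n)%N -> E t -> exists2 s, E s & s *+ n = t.

(** Zorn's lemma on graphs of partial homomorphisms. The divisible subgroup [E] of values is a
    parameter because extensions are needed both with 2-power torsion values and with arbitrary
    ones. *)
Lemma baer_ext (H : set M) (f : M -> circle R) : is_subgroup H ->
  (forall x y, H x -> H y -> f (x - y) = f x - f y) -> (forall x, H x -> E (f x)) ->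
  exists F, [/\ hom F, forall x, E (F x) & forall x, H x -> F x = f x].
Proof.
move=> hH fB fE.
pose G0 : set (M * circle R) := [set p | H p.1 /\ p.2 = f p.1].
have f0 : f 0 = 0 by have := fB 0 0 hH.1 hH.1; rewrite !subrr.
pose good (G : set (M * circle R)) := [/\ is_subgroup G, forall t, G (0, t) -> t = 0,
  forall p, G p -> E p.2 & G0 `<=` G].
have [|F [X FX] Fg Ft|G [[Gs G1 GE GG0] Gmax]] := @Zorn_nonempty _ good G0.
- split=> //.
  + split=> [|p q [Hp pf] [Hq qf]]; first by split; [exact: hH.1|rewrite f0].
    by split=> /=; [exact: hH.2|rewrite pf qf fB].
  + by move=> t [_ /= ->].
  + by move=> p [Hp ->]; exact: fE.
- split.
  + split; first by exists X => //; have [[]] := Fg _ FX.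
    move=> p q [Y FY Yp] [Z FZ Zq]; have [YZ|ZY] := Ft _ _ FY FZ.
      by exists Z => //; have [Zs _ _ _] := Fg _ FZ; apply: Zs.2 => //; exact: YZ.
    by exists Y => //; have [Ys _ _ _] := Fg _ FY; apply: Ys.2 => //; exact: ZY.
  + by move=> t [Y FY Yt]; have [_ h _ _] := Fg _ FY; exact: h.
  + by move=> p [Y FY Yp]; have [_ _ h _] := Fg _ FY; exact: h.
  + by move=> p pG0; exists X => //; have [_ _ _] := Fg _ FX; exact.
have Gfun x s t : G (x, s) -> G (x, t) -> s = t.
  move=> Gs' Gt; apply/eqP; rewrite -subr_eq0; apply/eqP/G1.
  by have := Gs.2 _ _ Gs' Gt; congr G; congr pair; rewrite /= ?subrr.
have GMz x t k : G (x, t) -> G (x *~ k, t *~ k).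
  move=> Gxt; have := subgroupMz Gs k Gxt; congr G.
  have hp1 : hom (fun p : M * circle R => p.1) by [].
  have hp2 : hom (fun p : M * circle R => p.2) by [].
  by rewrite [LHS]surjective_pairing (homMz hp1) (homMz hp2).
have dom x : exists t, G (x, t).
  apply: contrapT => ndom.
  (* The value for the new element [x]: if some positive multiple of [x] is in the domain, the value
     at the least one is divided; otherwise 0 will do. *)
  have [t Et ht] : exists2 t, E t & forall k u, G (x *~ k, u) -> u = t *~ k.
    have [hn|hn] := pselect (exists n, `[< (0 < n)%N /\ exists s, G (x *+ n, s) >]).
      case: (ex_minnP hn) => n /asboolP[n0 [s Gns]] nmin.
      have [t Et /= tn] := divE n0 (GE _ Gns); exists t => // k u Gku.
      have nz : n%:Z != 0 by lia.
      have kE := divz_eq k n%:Z; set q := (k %/ n%:Z)%Z in kE; set r := (k %% n%:Z)%Z in kE.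
      have Gr : G (x *~ r, u - s *~ q).
        have := Gs.2 _ _ Gku (GMz _ _ q Gns); congr G; congr pair => /=.
        by rewrite kE mulrzDr pmulrn -mulrzA [_ * q]mulrC addrC addKr.
      have r0 : r = 0.
        have rge : 0 <= r by rewrite modz_ge0.
        have rlt : r < n%:Z by apply: ltz_pmod; lia.
        case: (r =P 0) => // rn0.
        suff : (n <= `|r|)%N by lia.
        apply: nmin; apply/asboolP; split; first by lia.
        by exists (u - s *~ q); rewrite pmulrn gez0_abs.
      have /G1/eqP : G (0, u - s *~ q) by move: Gr; rewrite r0 mulr0z.
      rewrite subr_eq0 => /eqP ->; rewrite -tn pmulrn -mulrzA; congr (_ *~ _).
      by rewrite kE r0 addr0 mulrC.
    exists 0; first exact: hE.1.
    move=> k u Gku; rewrite mul0rz.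
    have [k0|kn0] := eqVneq k 0; first by apply: G1; rewrite k0 mulr0z in Gku.
    case: hn; exists `|k|%N; apply/asboolP; split; first by lia.
    have [k0|k0] := leP 0 k; first by exists u; rewrite pmulrn gez0_abs.
    exists (- u); rewrite pmulrn ltz0_abs// mulrNz.
    by have := subgroupN Gs Gku.
  pose G' : set (M * circle R) := [set p | exists g k, G g /\ p = (g.1 + x *~ k, g.2 + t *~ k)].
  have GG' : G `<=` G'.
    by move=> g Gg; exists g, 0; rewrite !mulr0z !addr0 -surjective_pairing.
  have gG' : good G'.
    split.
    - split; first exact: GG' Gs.1.
      move=> _ _ [g [k [Gg ->]]] [g' [k' [Gg' ->]]]; exists (g - g'), (k - k').
      split; first exact: Gs.2.
      congr pair => /=; rewrite mulrzBr; zmod.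
    - move=> u [g [k [Gg [/= e1 e2]]]].
      have /ht e3 : G (x *~ k, - g.2).
        have := subgroupN Gs Gg; congr G; congr pair => /=.
        by apply/eqP; rewrite eq_sym -subr_eq0 opprK addrC -e1.
      by rewrite e2 -e3 subrr.
    - move=> _ [g [k [Gg ->]]] /=; apply: subgroupD => //; first exact: GE.
      exact: subgroupMz.
    - exact: subset_trans GG0 GG'.
  apply: ndom; exists t; apply: Gmax gG' GG' _ _.
  by exists (0, 0), 1; rewrite !mulr1z !add0r; split=> //; exact: Gs.1.
have [F hF] := choice dom.
exists F; split.
- move=> x y; apply: Gfun (hF _) _.
  by have := subgroupD Gs (hF x) (hF y).
- by move=> x; have := GE _ (hF x).
- by move=> x Hx; apply: Gfun (hF x) _; apply: GG0.
Qed.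

End Baer.

Lemma tors2_subgroup (R : realType) : is_subgroup (@tors2 R).
Proof. by split; [exists 0%N; rewrite mul0rn|exact: tors2_sub]. Qed.

(** [u n] is prescribed at the generator [1 / n!] by a torsion point within [1 / ((n + 1) n!)] of
    the value of [f], and extended by [baer_ext]. At [q = k / n!] the error is then at most
    [|q| / (n + 1)]. *)
Lemma rat_char_approx (R : realType) (f : rat -> circle R) : hom f ->
  exists u : nat -> rat -> circle R, [/\ forall n, hom (u n), forall n q, tors2 (u n q)
    & forall q (e : R), 0 < e -> exists N, forall n, (N <= n)%N -> cnorm (u n q - f q) < e].
Proof.
move=> hf.
suff /choice[u hu] : forall n, exists u : rat -> circle R, [/\ hom u, forall q, tors2 (u q) &
    forall q (k : int), q * n`!%:R = k%:~R ->
      cnorm (u q - f q) <= `|k|%N%:R / (n.+1 * n`!)%:R].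
  exists u; split=> [n|n q|q e e0]; [by case: (hu n)|by case: (hu n)|].
  have [K hK] := archi_small (`|numq q|%N%:R : R) e0.
  pose b := `|denq q|%N; have b0 : (0 < b)%N by rewrite absz_gt0 denq_neq0.
  exists (maxn b K) => n; rewrite geq_max => /andP[bn Kn].
  have /dvdnP[c cE] : (b %| n`!)%N by apply: dvdn_fact; rewrite b0.
  have qE : q * n`!%:R = (numq q * c%:Z)%:~R.
    rewrite cE natrM -{1}(divq_num_den q) intrM.
    have -> : (b%:R : rat) = (denq q)%:~R by rewrite pmulrn /b gez0_abs// ltW// denq_gt0.
    have dn0 : (denq q)%:~R != 0 :> rat by rewrite intr_eq0 denq_neq0.
    rewrite -[(c%:Z)%:~R]pmulrn; set a : rat := (numq q)%:~R; set D : rat := (denq q)%:~R in dn0 *.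
    by rewrite [_ * D]mulrC mulrA mulfVK.
  have [_ _ /(_ q _ qE) h] := hu n; apply: le_lt_trans h _.
  apply: le_lt_trans hK; rewrite abszM /= !natrM.
  have cn : (c%:R : R) <= n`!%:R by rewrite ler_nat cE leq_pmulr.
  rewrite ler_pdivrMr ?mulr_gt0 ?ltr0n ?fact_gt0// -!mulrA ler_wpM2l//.
  apply: le_trans cn _; rewrite mulrA; apply: ler_peMl; first exact: ler0n.
  by rewrite mulrC ler_pdivlMr ?ltr0n// mul1r ler_nat.
move=> n; pose d : rat := n`!%:R; have d0 : d != 0 by rewrite pnatr_eq0 -lt0n fact_gt0.
have e0 : 0 < ((n.+1 * n`!)%:R : R)^-1 by rewrite invr_gt0 ltr0n muln_gt0 fact_gt0.
have [t t2 ht] := tors2_dense (f d^-1) e0.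
pose H : set rat := [set q | exists k : int, q * d = k%:~R].
have [|||F [hF tF FE]] := @baer_ext R rat (@tors2 R) (tors2_subgroup R)
    (@tors2_div R) H (fun q => t *~ numq (q * d)).
- split=> [|x y [k Hx] [l Hy]]; first by exists 0; rewrite mul0r.
  by exists (k - l); rewrite mulrBl Hx Hy intrB.
- by move=> x y [k Hx] [l Hy]; rewrite mulrBl Hx Hy -intrB !numq_int mulrzBr.
- by move=> x [k Hx]; apply: (subgroupMz (tors2_subgroup R)).
exists F; split=> // q k qk.
rewrite FE; last by exists k.
have -> : f q = f d^-1 *~ k.
  rewrite -(homMz hf); congr f.
  by rewrite -mulrzr -qk mulrC mulfK.
rewrite qk numq_int -mulrzBl; apply: le_trans (cnormMz _ _) _.
rewrite -[X in X <= _]mulr_natl ler_wpM2l// cnorm_distC; exact: ltW.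
Qed.

Lemma card_leTE (T U : Type) (A : set U) : ([set: T] #<= A)%card <->
  exists f : T -> U, injective f /\ forall x, A (f x).
Proof.
split=> [/card_leP[f]|[f [finj fA]]].
  exists (fun x => val (f (SigSub (mem_set (I : [set: T] x))))); split=> [x y /val_inj e|x].
    have /(congr1 val)// := inj (mem_set I) (mem_set I) e.
  exact/set_mem/valP.
have /injfunPex[g] : exists2 g : T -> U, set_fun [set: T] A g & set_inj [set: T] g.
  by exists f => // x y _ _; exact: finj.
exact: inj_card_le g.
Qed.

(** * Sequentially closed subgroups of products *)

Section Splitting.
Variables (R : realType) (J : choiceType).
Local Notation T := (circle R).
Implicit Types (h : J -> rat -> T) (S : set J).

Definition homfam h := forall j, hom (h j).
Definition tors2fam h := forall j q, tors2 (h j q).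
Definition supp S h := forall j, ~ S j -> h j = 0.
Definition restr S h : J -> rat -> T := fun j => if `[< S j >] then h j else 0.
Definition seqlim (u : nat -> J -> rat -> T) h := forall j q (e : R), 0 < e ->
  exists N, forall n, (N <= n)%N -> cnorm (u n j q - h j q) < e.

Lemma homfam0 : hom (0 : rat -> T).
Proof. by move=> x y; rewrite /= [RHS]addr0. Qed.

Lemma homfam_restr S h : homfam h -> homfam (restr S h).
Proof. by move=> hh j; rewrite /restr; case: asboolP => // _; exact: homfam0. Qed.

Lemma restrC S h : restr S h + restr (~` S) h = h.
Proof.
apply/funext => j; apply/funext => q; rewrite [LHS]/GRing.add/= /restr.
have [Sj|Sj] := asboolP (S j); first by rewrite asboolF ?addr0//= => /(_ Sj).
by rewrite asboolT// add0r.
Qed.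

Lemma seqlim_near (u : nat -> J -> rat -> T) h :
  (forall j, exists N, forall n, (N <= n)%N -> u n j = h j) -> seqlim u h.
Proof.
move=> hu j q e e0; have [N hN] := hu j; exists N => n /hN ->.
by rewrite subrr cnorm0.
Qed.

Variable G : set (J -> rat -> T).
Hypothesis subG : is_subgroup G.
Hypothesis seqG : forall u h, (forall n, G (u n)) -> seqlim u h -> G h.
Hypothesis torsG : forall h, homfam h -> tors2fam h -> exists k, G (h *+ 2 ^ k).

Definition null S := forall h, homfam h -> tors2fam h -> supp S h -> G h.

Lemma null_sub S S' : S `<=` S' -> null S' -> null S.
Proof. by move=> SS' nS' h hh th sh; apply: nS' => // j nSj; apply: sh => /SS'. Qed.

Lemma tors2fam_restr S h : tors2fam h -> tors2fam (restr S h).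
Proof.
move=> th j q; rewrite /restr; case: asboolP => // _.
by exists 0%N; rewrite mul0rn.
Qed.

Lemma null_setU S S' : null S -> null S' -> null (S `|` S').
Proof.
move=> nS nS' h hh th sh; rewrite -(restrC S h); apply: (subgroupD subG).
  apply: nS; [exact: homfam_restr|exact: tors2fam_restr|].
  by move=> j nSj; rewrite /restr asboolF.
apply: nS'; [exact: homfam_restr|exact: tors2fam_restr|].
move=> j nSj; rewrite /restr; case: asboolP => // nS1; apply: sh.
by case.
Qed.

Lemma null0 : null set0.
Proof.
move=> h hh th sh; have -> : h = 0 by apply/funext => j; exact: sh.
exact: subG.1.
Qed.

Lemma null_bigcup (S : nat -> set J) : (forall n, null (S n)) -> null (\bigcup_n S n).
Proof.
move=> nS h hh th sh.
pose W n : set J := [set j | exists2 k, (k < n)%N & S k j].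
have nW n : null (W n).
  elim: n => [|n IH]; first by apply: null_sub null0 => j [].
  apply: null_sub (null_setU IH (nS n)) => j [k]; rewrite ltnS leq_eqVlt.
  by move=> /orP[/eqP -> ? |kn Skj]; [right|left; exists k].
apply: (@seqG (fun n => restr (W n) h)) => [n|].
  apply: (nW n); [exact: homfam_restr|exact: tors2fam_restr|].
  by move=> j nj; rewrite /restr asboolF.
apply: seqlim_near => j; have [[k _ Skj]|nj] := pselect ((\bigcup_n S n) j).
  by exists k.+1 => n kn; rewrite /restr asboolT//; exists k.
by exists 0%N => n _; rewrite /restr; case: ifP => // _; rewrite sh.
Qed.

(** Rescaling the rational argument divides a family by [2 ^ n] and keeps its values of 2-power
    torsion. *)
Lemma nonnull_div S n : ~ null S -> exists h,
  [/\ homfam h, tors2fam h, supp S h & ~ G (h *+ 2 ^ n)].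
Proof.
move=> nS; apply: contrapT => hn; apply: nS => h hh th sh.
apply: contrapT => nG; apply: hn.
exists (fun j q => h j (q / (2 ^ n)%:R)); split.
- by move=> j x y; rewrite mulrDl hh.
- by move=> j q; exact: th.
- by move=> j /sh ->.
- suff -> : (fun j q => h j (q / (2 ^ n)%:R)) *+ 2 ^ n = h by [].
  have h1 (j : J) : hom (fun f : J -> rat -> T => f j) by [].
  have h2 (q : rat) : hom (fun f : rat -> T => f q) by [].
  apply/funext => j; apply/funext => q; rewrite (homMn (h1 j)) (homMn (h2 q)).
  rewrite -(homMn (hh j)); congr (h j _); rewrite -[LHS]mulr_natr mulfVK//.
  by rewrite pnatr_eq0 -lt0n expn_gt0.
Qed.

(** Baire's theorem for the Cantor space: one of countably many closed sets that cover it contains a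
    cylinder. *)
Lemma cantor_baire (C : nat -> set (nat -> bool)) :
  (forall k (Z : nat -> nat -> bool) z, (forall i, C k (Z i)) ->
     (forall i n, (n < i)%N -> Z i n = z n) -> C k z) ->
  (forall z, exists k, C k z) ->
  exists k s, forall z, (forall i, (i < size s)%N -> z i = nth false s i) -> C k z.
Proof.
move=> clC covC; apply: contrapT => hn.
pose ext (s : seq bool) (z : nat -> bool) := forall i, (i < size s)%N -> z i = nth false s i.
have step (ks : nat * seq bool) : exists s', [/\ (size ks.2 < size s')%N,
    forall i, (i < size ks.2)%N -> nth false s' i = nth false ks.2 i &
    forall z, ext s' z -> ~ C ks.1 z].
  case: ks => k s /=.
  have [z ez nCz] : exists2 z, ext s z & ~ C k z.
    apply: contrapT => h; apply: hn; exists k, s => z ez; apply: contrapT => nC.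
    by apply: h; exists z.
  have [N hN] : exists N, forall z', (forall i, (i < N)%N -> z' i = z i) -> ~ C k z'.
    apply: contrapT => h; apply: nCz.
    have /choice[Z hZ] : forall N, exists z', (forall i, (i < N)%N -> z' i = z i) /\ C k z'.
      move=> N; apply: contrapT => h'; apply: h; exists N => z' ez' Cz'.
      by apply: h'; exists z'.
    apply: (clC k Z) => [i|i n ni]; first by case: (hZ i).
    by apply: (hZ i).1.
  exists (mkseq z (maxn N (size s).+1)); rewrite size_mkseq; split.
  - by rewrite leq_maxr.
  - move=> i si; rewrite nth_mkseq ?ez//.
    by rewrite (leq_trans si)// (leq_trans (leqnSn _))// leq_maxr.
  - move=> z'; rewrite /ext size_mkseq => ez'; apply: hN => i iN.
    have im : (i < maxn N (size s).+1)%N by rewrite leq_max iN.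
    by rewrite ez'// nth_mkseq.
have [f hf] := choice step.
pose s := fix s k := if k is k'.+1 then f (k', s k') else [::].
have ssz k : (k <= size (s k))%N.
  elim: k => //= k IH; have [h _ _] := hf (k, s k); exact: leq_ltn_trans IH h.
have smono k l i : (k <= l)%N -> (i < size (s k))%N ->
    (i < size (s l))%N /\ nth false (s l) i = nth false (s k) i.
  move=> kl si; elim: l kl => [|l IH]; first by rewrite leqn0 => /eqP <-.
  rewrite leq_eqVlt => /orP[/eqP <- //|]; rewrite ltnS => /IH[h1 h2].
  have [h3 h4 _] := hf (l, s l); split; first exact: ltn_trans h1 h3.
  by rewrite /= h4.
pose z i := nth false (s i.+1) i.
have ez k : ext (s k) z.
  move=> i si; rewrite /z; have ii : (i < size (s i.+1))%N by exact: ssz.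
  have [ki|ik] := leqP k i.+1; first by have [] := smono k i.+1 i ki si.
  by have [_ ->] := smono i.+1 k i (ltnW ik) ii.
have [k Ck] := covC z; have [_ _ h] := hf (k, s k).
exact: (h z (ez k.+1)).
Qed.

(** If no [S n] were null, take [h n] supported on [S n] with [2 ^ n] times [h n] outside [G], and
    glue the [h n] with [n] in a subset [z] of [nat]. By [torsG] and Baire one exponent [k] serves a
    whole cylinder of subsets. Two of these that differ only at a large [n] put [2 ^ k] times [h n]
    into [G], a contradiction. *)
Lemma null_disjoint (S : nat -> set J) :
  (forall m n j, S m j -> S n j -> m = n) -> exists n, null (S n).
Proof.
move=> dS; apply: contrapT => hn.
have /choice[h hh] : forall n, exists h, [/\ homfam h, tors2fam h, supp (S n) h &
    ~ G (h *+ 2 ^ n)].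
  by move=> n; apply: nonnull_div => nSn; apply: hn; exists n.
have /choice[ix hix] : forall j, exists i, forall n, S n j -> i = n.
  move=> j; have [[n Sn]|nS] := pselect (exists n, S n j).
    by exists n => m Sm; exact: dS Sn Sm.
  by exists 0%N => n Sn; case: nS; exists n.
pose hZ (z : nat -> bool) : J -> rat -> T := fun j => if z (ix j) then h (ix j) j else 0.
have hZh z : homfam (hZ z).
  by move=> j; rewrite /hZ; case: ifP => _; [have [hj _ _ _] := hh (ix j)|exact: homfam0].
have hZt z : tors2fam (hZ z).
  move=> j q; rewrite /hZ; case: ifP => _; first by have [_ hj _ _] := hh (ix j).
  by exists 0%N; rewrite mul0rn.
have hJ (j : J) : hom (fun f : J -> rat -> T => f j) by [].
have [k Z z ZC Zz|z|k [s hs]] := @cantor_baire (fun k => [set z | G (hZ z *+ 2 ^ k)]).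
- apply: (@seqG (fun i => hZ (Z i) *+ 2 ^ k)) => [i|]; first exact: ZC.
  apply: seqlim_near => j; exists (ix j).+1 => n jn.
  by rewrite !(homMn (hJ j)) /hZ Zz.
- exact: torsG.
pose n := maxn k (size s).
have sn : (size s <= n)%N by rewrite leq_maxr.
have Gn : G (h n *+ 2 ^ k).
  have -> : h n = hZ (fun i => (i == n) || nth false s i) - hZ (nth false s).
    have [hnh hnt hns _] := hh n.
    apply/funext => j; rewrite [RHS]/GRing.add/= [X in _ + X]/GRing.opp/= /hZ.
    have [->|jn] := eqVneq (ix j) n => /=; first by rewrite nth_default// subr0.
    rewrite subrr hns// => Sj; move/eqP: jn; apply; exact: hix.
  rewrite mulrnBl; apply: subG.2; apply: hs => // i si.
  have -> : (i == n) = false by apply/negbTE; rewrite neq_ltn (leq_trans si).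
  by [].
have [_ _ _] := hh n; apply.
have -> : (2 ^ n = 2 ^ k * 2 ^ (n - k))%N by rewrite -expnD subnKC// leq_maxl.
by rewrite mulrnA; exact: subgroupMn.
Qed.

(** If every non-null subset split into two non-null parts, repeated splitting would produce an
    infinite disjoint sequence of non-null sets. *)
Lemma null_atom S : ~ null S -> exists A, [/\ A `<=` S, ~ null A &
  forall B, B `<=` A -> null B \/ null (A `\` B)].
Proof.
move=> nS; apply: contrapT => hn.
have /choice[f hf] : forall A, exists B, A `<=` S -> ~ null A ->
    [/\ B `<=` A, ~ null B & ~ null (A `\` B)].
  move=> A; have [AS|?] := pselect (A `<=` S); last by exists set0.
  have [?|nA] := pselect (null A); first by exists set0.
  apply: contrapT => h; apply: hn; exists A; split=> // B BA.
  apply: contrapT => /not_orP[h1 h2]; apply: h; exists B => _ _.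
  by split.
pose A := fix A n := if n is n'.+1 then f (A n') else S.
have AS n : A n `<=` S /\ ~ null (A n).
  elim: n => [|n [h1 h2]]; first by split.
  have [h3 h4 _] := hf _ h1 h2.
  by split=> //; exact: subset_trans h3 h1.
have Ale m n : (m <= n)%N -> A n `<=` A m.
  elim: n => [|n IH]; first by rewrite leqn0 => /eqP ->.
  rewrite leq_eqVlt => /orP[/eqP -> //|/IH h].
  by have [h3 _ _] := hf _ (AS n).1 (AS n).2; exact: subset_trans h3 h.
have [m n j [Am nAm] [An nAn]|n] := @null_disjoint (fun n => A n `\` A n.+1).
  case: (ltngtP m n) => // [mn|nm].
    by case: nAm; exact: (Ale m.+1 n).
  by case: nAn; exact: (Ale n.+1 m).
by have [] := hf _ (AS n).1 (AS n).2.
Qed.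

Hypothesis noU : ~ Ulam_measurable J.

(** The sets with non-null trace on an atom form a countably complete ultrafilter on [J]. Since [J]
    is not measurable, it is principal. *)
Lemma nonnull_point S : ~ null S -> exists2 j, S j & ~ null [set j].
Proof.
move=> nS; have [A [AS nA Aat]] := null_atom nS.
pose U : set_system J := [set B | ~ null (B `&` A)].
have nU B : ~ U B -> null (B `&` A) by move=> /contrapT.
have UC B : U B -> null (~` B `&` A).
  move=> UB; have [h|h] := Aat (B `&` A) (@subIsetr _ _ _); first by case: UB.
  by apply: null_sub h => j [nB Aj]; split=> // -[].
have CU B : null (~` B `&` A) -> U B.
  move=> h1 h2; apply: nA; apply: null_sub (null_setU h1 h2) => j Aj.
  by have [Bj|nBj] := pselect (B j); [right|left].
have Ucap (B : nat -> set J) : (forall n, U (B n)) -> U (\bigcap_n B n).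
  move=> UB; apply: CU; apply: null_sub (null_bigcup (fun n => UC _ (UB n))).
  move=> j [nB Aj]; apply: contrapT => h; apply: nB => n _.
  by apply: contrapT => nBn; apply: h; exists n.
have PU : ProperFilter U.
  split; first by rewrite /U /= set0I => h; apply: h; exact: null0.
  split.
  - by rewrite /U /= setTI.
  - move=> B B' UB UB'; apply: CU; apply: null_sub (null_setU (UC _ UB) (UC _ UB')).
    move=> j [nBB' Aj]; have [Bj|nBj] := pselect (B j); [right|left] => //.
    by split=> // B'j; apply: nBB'.
  - by move=> B B' BB' UB h; apply: UB; apply: null_sub h => j [/BB' ? ?].
have UU : UltraFilter U.
  apply: ultraI => B; have [|/nU h] := pselect (U B); [by left|right].
  by apply: CU; rewrite setCK.
have [j Uj] : exists j, forall B, U B -> B j.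
  apply: contrapT => h; apply: noU; exists U; split=> //.
  apply/seteqP; split=> // j hj; apply: h; exists j => B UB; exact: hj.
have Ujj : U [set j].
  by apply: contrapT => /nU h; have := Uj (~` [set j]); apply; [apply: CU; rewrite setCK|].
exists j.
  have /Uj Aj : U A by rewrite /U /= setIid.
  exact: AS.
by move=> h; apply: Ujj; apply: null_sub h => i [].
Qed.

Hypothesis homG : forall h, G h -> homfam h.
Hypothesis denseG : forall h, homfam h -> forall (l : seq (J * rat)) (e : R), 0 < e ->
  exists2 h', G h' & forall p, p \in l -> cnorm (h' p.1 p.2 - h p.1 p.2) < e.

(** The set [P] of non-null points is finite. Families vanishing on [P] are sequential limits of
    families with 2-power torsion values, so they lie in [G]. On [P] only countably many values
    matter, so density yields a sequence in [G], whose parts outside [P] may be subtracted. *)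
Lemma splitting_full h : homfam h -> G h.
Proof.
pose P : set J := [set j | ~ null [set j]].
have finP : finite_set P.
  apply: contrapT => /infiniteP/card_leTE[f [finj fP]].
  have [m n j /= e1 e2|n] := @null_disjoint (fun n => [set f n]).
    by apply: finj; rewrite -e1 -e2.
  exact: fP.
have nP : null (~` P).
  by apply: contrapT => /nonnull_point[j nPj /nPj].
have off h0 : homfam h0 -> supp (~` P) h0 -> G h0.
  move=> hh0 sh0.
  have /choice[u hu] : forall j, exists u : nat -> rat -> T, [/\ forall n, hom (u n),
      forall n q, tors2 (u n q), P j -> forall n, u n = 0
    & forall q (e : R), 0 < e -> exists N, forall n, (N <= n)%N -> cnorm (u n q - h0 j q) < e].
    move=> j; have [Pj|nPj] := pselect (P j); last first.
      by have [u [h1 h2 h3]] := rat_char_approx (hh0 j); exists u.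
    exists (fun _ => 0); split=> //.
    - by move=> _; exact: homfam0.
    - by move=> n q; exists 0%N; rewrite mul0rn.
    - by move=> q e e0; exists 0%N => n _; rewrite sh0 ?subrr ?cnorm0//; exact.
  apply: (@seqG (fun n j => u j n)) => [n|j q e e0].
    apply: nP => [j|j q|j nj]; have [h1 h2 h3 _] := hu j => //.
    by apply: h3; apply: contrapT.
  by have [_ _ _ h3] := hu j; exact: h3.
move=> hh; have /finite_seqP[p pE] := finP.
have Pp j : P j -> j \in p by rewrite pE.
have [p0|[j0 _]] : p = [::] \/ exists j0, j0 \in p.
  by case: (p) => [|a r]; [left|right; exists a; rewrite mem_head].
  by apply: off => // j /contrapT; rewrite pE p0.
(* An enumeration of the pairs formed by a point of [P] and a rational; codes of nothing give the
   empty list, and [j0] is the default of [nth]. *)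
pose co m : seq (J * rat) := if (unpickle m : option (nat * rat)) is Some a then
  [:: (nth j0 p a.1, a.2)] else [::].
have /choice[g hg] : forall n, exists g, G g /\ forall m, (m < n)%N -> forall c, c \in co m ->
    cnorm (g c.1 c.2 - h c.1 c.2) < n.+1%:R^-1.
  move=> n; have [|g Gg hg] := denseG hh (flatten (mkseq co n)) (_ : 0 < (n.+1%:R : R)^-1).
    by rewrite invr_gt0 ltr0n.
  exists g; split=> // m mn c cm; apply: hg; apply/flattenP; exists (co m) => //.
  by apply: map_f; rewrite mem_iota.
have offg g' : homfam g' -> G (restr (~` P) g').
  move=> hg'; apply: off; first exact: homfam_restr.
  by move=> j nj; rewrite /restr asboolF.
rewrite -(restrC P h); apply: (subgroupD subG); last exact: offg.
apply: (@seqG (fun n => restr P (g n))) => [n|j q e e0].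
  have -> : restr P (g n) = g n - restr (~` P) (g n) by rewrite -{2}(restrC P (g n)) addrK.
  by apply: subG.2; [case: (hg n)|apply: offg; apply: homG; case: (hg n)].
rewrite /restr; case: asboolP => [Pj|_]; last by exists 0%N => n _; rewrite subrr cnorm0.
have [K hK] := archi_small (1 : R) e0.
pose m := pickle (index j p, q).
exists (maxn K m.+1) => n; rewrite geq_max => /andP[Kn mn].
have [_ /(_ m mn (j, q))] := hg n; rewrite /co /m pickleK mem_seq1 /= nth_index ?Pp//.
rewrite eqxx => /(_ isT) h1; apply: lt_trans h1 _; apply: le_lt_trans hK.
by rewrite div1r lef_pV2 ?posrE ?ltr0n// ler_nat.
Qed.

End Splitting.

(** * Coordinates in torsion-free groups *)

Section Coordinates.
Variable X : zmodType.
Hypothesis tfX : torsion_free X.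
Implicit Types (n : X -> int) (s : seq X) (I : set X).

Definition comb s n : X := \sum_(i <- s) i *~ n i.

Lemma comb_ext s s' n : uniq s -> uniq s' -> {subset s <= s'} ->
  (forall i, n i != 0 -> i \in s) -> comb s' n = comb s n.
Proof.
move=> us us' ss' ns; rewrite /comb (bigID (mem s)) /= [X in _ + X]big1 ?addr0; last first.
  by move=> i; case: (n i =P 0) => [-> _|/eqP/ns -> //]; rewrite mulr0z.
rewrite -big_filter; apply: perm_big; apply: uniq_perm => //; first exact: filter_uniq.
by move=> i; rewrite mem_filter andb_idr//; exact: ss'.
Qed.

Definition indep I := forall s n, uniq s -> (forall i, i \in s -> I i) ->
  comb s n = 0 -> forall i, i \in s -> n i = 0.

Lemma max_indep : exists I, indep I /\ forall x, exists N s n,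
  [/\ (0 < N)%N, uniq s, forall i, i \in s -> I i, forall i, n i != 0 -> i \in s
    & x *+ N = comb s n].
Proof.
have [|F [Y0 FY0] Fi Ft|I [iI Imax]] := @Zorn_nonempty X indep set0.
- by move=> [|i s] n _ h _ j; [rewrite in_nil|case: (h i (mem_head _ _))].
- move=> s n us sF; suff [Y FY sY] : exists2 Y, F Y & forall i, i \in s -> Y i.
    exact: Fi FY _ _ us sY.
  elim: s sF {us} => [|i s IH] sF; first by exists Y0.
  have [j js|Y FY sY] := IH; first by apply: sF; rewrite inE js orbT.
  have [Z FZ Zi] := sF i (mem_head _ _).
  have [YZ|ZY] := Ft _ _ FY FZ.
    by exists Z => // j; rewrite inE => /orP[/eqP ->//|/sY/YZ].
  by exists Y => // j; rewrite inE => /orP[/eqP ->|/sY//]; exact: ZY.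
exists I; split=> // x; have [Ix|nIx] := pselect (I x).
  exists 1%N, [:: x], (fun i => (i == x)%:R); split=> //.
  - by move=> i; rewrite mem_seq1 => /eqP ->.
  - by move=> i; rewrite mem_seq1; apply: contraNT => /negPf ->.
  - by rewrite /comb big_seq1 eqxx.
have nI : ~ indep (I `|` [set x]).
  by move=> /Imax h; apply: nIx; apply: h; [left|right].
have [s [n [us sI s0 [i0 i0s ni0]]]] : exists s n, [/\ uniq s,
    forall i, i \in s -> (I `|` [set x]) i, comb s n = 0 & exists2 i, i \in s & n i <> 0].
  apply: contrapT => h; apply: nI => s n us sI s0 i si; apply: contrapT => ni.
  by apply: h; exists s, n; split=> //; exists i.
have remI i : i \in rem x s -> I i.
  rewrite mem_rem_uniq// inE => /andP[/eqP ix /sI[]] //.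
have [xs|nxs] := boolP (x \in s); last first.
  exfalso; apply: ni0; apply: (iI s n us _ s0 _ i0s) => i si.
  by case: (sI i si) => // ix; rewrite -ix si in nxs.
have sE : x *~ n x + comb (rem x s) n = 0 by rewrite -s0 /comb (big_rem x xs).
have nx : n x <> 0.
  move=> nx; have i0x : i0 != x by apply/eqP => e; rewrite e in ni0.
  apply: ni0; apply: (iI (rem x s) n (rem_uniq _ us) remI).
    by rewrite -sE nx mulr0z add0r.
  by rewrite mem_rem_uniq// inE i0x.
pose sg : int := if 0 <= n x then -1 else 1.
exists `|n x|%N, (rem x s), (fun i => if i \in rem x s then n i * sg else 0); split=> //.
- by lia.
- exact: rem_uniq.
- by move=> i; case: ifP.
- have -> : x *+ `|n x| = - (x *~ n x) *~ sg.
    rewrite pmulrn -mulrNz -mulrzA; congr (_ *~ _); rewrite /sg; case: ifP; lia.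
  have -> : - (x *~ n x) = comb (rem x s) n.
    by apply/eqP; rewrite eq_sym -subr_eq0 opprK addrC sE.
  have hm : hom (fun z : X => z *~ sg) by move=> a b; rewrite mulrzDl.
  rewrite /comb; have /= -> := hom_sum hm (rem x s) xpredT (fun i => i *~ n i).
  rewrite big_seq [RHS]big_seq; apply: eq_bigr => i ir.
  by rewrite ir mulrzA.
Qed.

(** Embedding of a torsion-free group in a rational vector space. [rel x v] says that [v] is read
    off from some representation of a positive multiple of [x]; [rel_add] gives additivity and, with
    one summand 0, independence of the representation. *)
Lemma coords_ex : exists (J : choiceType) (e : J -> X) (c : X -> J -> rat) (s : X -> seq J),
  [/\ forall x, uniq (s x) /\ (forall j, c x j != 0 -> j \in s x),
      forall x y j, c (x + y) j = c x j + c y j,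
      forall x, (forall j, c x j = 0) -> x = 0 &
      forall j i, c (e j) i = (i == j)%:R].
Proof.
have [I [iI hI]] := max_indep.
pose rel x (v : X -> rat) := exists N s n, [/\ (0 < N)%N, uniq s, forall i, i \in s -> I i,
    forall i, n i != 0 -> i \in s & x *+ N = comb s n /\ forall i, v i = (n i)%:~R / N%:R].
have rel_add x y z v w u : rel x v -> rel y w -> rel z u -> z = x + y ->
    forall i, u i = v i + w i.
  move=> [N [s [n [N0 us sI sn [xN vE]]]]] [N' [s' [n' [N'0 us' sI' sn' [yN wE]]]]].
  move=> [M [t [m [M0 ut tI tm [zM uE]]]]] zE i.
  pose S := undup (s ++ s' ++ t).
  have uS : uniq S by exact: undup_uniq.
  have SI k : k \in S -> I k.
    by rewrite mem_undup !mem_cat => /or3P[/sI|/sI'|/tI].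
  have sS : {subset s <= S} by move=> k ks; rewrite mem_undup !mem_cat ks.
  have s'S : {subset s' <= S} by move=> k ks; rewrite mem_undup !mem_cat ks orbT.
  have tS : {subset t <= S} by move=> k ks; rewrite mem_undup !mem_cat ks !orbT.
  rewrite -(comb_ext us uS sS sn) in xN; rewrite -(comb_ext us' uS s'S sn') in yN.
  rewrite -(comb_ext ut uS tS tm) in zM.
  pose p k := m k * (N * N')%:Z - (n k * (M * N')%:Z + n' k * (M * N)%:Z).
  have combZ (a : X -> int) (k : int) : comb S (fun i => a i * k) = comb S a *~ k.
    have hm : hom (fun z : X => z *~ k) by move=> a' b'; rewrite mulrzDl.
    rewrite /comb; have /= -> := hom_sum hm S xpredT (fun i => i *~ a i).
    by apply: eq_bigr => j _; rewrite mulrzA.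
  have p0 : comb S p = 0.
    have -> : comb S p = comb S (fun k => m k * (N * N')%:Z) -
        (comb S (fun k => n k * (M * N')%:Z) + comb S (fun k => n' k * (M * N)%:Z)).
      by rewrite /comb -big_split -sumrB; apply: eq_bigr => k _; rewrite mulrzBr mulrzDr.
    rewrite !combZ -xN -yN -zM zE -!pmulrn -!mulrnA.
    have -> : (N * (M * N') = M * (N * N'))%N by rewrite mulnCA.
    have -> : (N' * (M * N) = M * (N * N'))%N by rewrite mulnCA [(N' * N)%N]mulnC.
    by rewrite mulrnDl subrr.
  have pi : p i = 0.
    have [iS|niS] := boolP (i \in S); first exact: iI p0 _ iS.
    have z0 (a : X -> int) (r : seq X) : (forall k, a k != 0 -> k \in r) -> {subset r <= S} -> a i = 0.
      by move=> ar rS; apply/eqP; apply: contraNT niS => /ar/rS.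
    by rewrite /p (z0 _ _ sn sS) (z0 _ _ sn' s'S) (z0 _ _ tm tS) !mul0r.
  have rz k : (0 < k)%N -> (k%:R : rat) != 0 by rewrite pnatr_eq0 lt0n.
  rewrite uE vE wE; have := congr1 (fun k : int => k%:~R : rat) pi.
  rewrite /p intrB intrD !intrM -!pmulrn !natrM => /eqP; rewrite subr_eq0 => /eqP E.
  have [h1 h2 h3] := And3 (rz _ N0) (rz _ N'0) (rz _ M0).
  move: (N%:R : rat) (N'%:R : rat) (M%:R : rat) h1 h2 h3 E => a b d a0 b0 d0.
  move: ((m i)%:~R : rat) ((n i)%:~R : rat) ((n' i)%:~R : rat) => mi ni ni' E.
  have ab : a * b != 0 by rewrite mulf_neq0.
  have -> : ni / a + ni' / b = (ni * b + ni' * a) / (a * b).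
    by field; rewrite a0 b0.
  apply/eqP; rewrite eqr_div//; apply/eqP.
  by rewrite E; ring.
have /choice[c hc] : forall x, exists v, rel x v.
  move=> x; have [N [s [n [N0 us sI sn xN]]]] := hI x.
  by exists (fun i => (n i)%:~R / N%:R), N, s, n; split.
have cD x y i : c (x + y) i = c x i + c y i by apply: rel_add (hc _) (hc _) (hc _) _ _.
have hcs x : exists s : seq X, [/\ uniq s, forall i, i \in s -> I i & forall i, c x i != 0 -> i \in s].
  have [N [s [n [N0 us sI sn [xN cE]]]]] := hc x; exists s; split=> // i.
  by rewrite cE; case: (n i =P 0) => [->|/eqP/sn//]; rewrite mul0r eqxx.
have [s hs] := choice hcs.
pose J := subgrp I.
have /choice[sJ hsJ] : forall x, exists sJ : seq J, uniq sJ /\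
    forall j, c x (sgval j) != 0 -> j \in sJ.
  move=> x; have [us sI sn] := hs x.
  exists (pmap insub (s x)); split; first exact: pmap_sub_uniq.
  by move=> j /sn js; rewrite mem_pmap_sub.
exists J, (fun j => sgval j), (fun x j => c x (sgval j)), sJ; split=> //.
- move=> x cx0; have [N [t [n [N0 ut tI tn [xN cE]]]]] := hc x.
  apply: (tfX N0); rewrite xN /comb big_seq big1// => i it.
  suff -> : n i = 0 by rewrite mulr0z.
  have [j <-] : exists j : J, sgval j = i by exists (Subgrp (asboolT (tI i it))).
  have := cx0 j; rewrite cE => /eqP; rewrite mulf_eq0 invr_eq0 pnatr_eq0 intr_eq0.
  by rewrite -[N == 0%N]negbK -lt0n N0 orbF => /eqP.
- move=> j i; have Ij : I (sgval j) := asboolW (sgP j).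
  have rel0 : rel 0 (fun=> 0).
    exists 1%N, [::], (fun=> 0); split=> //; split; first by rewrite /comb big_nil mul0rn.
    by move=> k; rewrite mul0r.
  have rj : rel (sgval j) (fun k => (k == sgval j)%:R).
    exists 1%N, [:: sgval j], (fun k => (k == sgval j)%:R); split=> //.
    - by move=> k; rewrite mem_seq1 => /eqP ->.
    - by move=> k; rewrite mem_seq1; apply: contraNT => /negPf ->.
    - by split; [rewrite /comb big_seq1 eqxx|move=> k; rewrite divr1; case: eqP].
  have := rel_add _ _ _ _ _ _ rj rel0 (hc (sgval j)) _ (sgval i).
  by rewrite !addr0 => ->//.
Qed.

End Coordinates.

(** * Characters of minimal groups *)

(** The finite-level form of the fact that a 2-adic integer not divisible by [2 ^ i] divides
    [2 ^ i]: the greatest common divisor of [m] and [2 ^ j] is a power of 2 with exponent at most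
    [i]. *)
Lemma pow2_inverse m i j : ~~ (2 ^ i %| m)%N -> exists w, (w * m = 2 ^ i %[mod 2 ^ j])%N.
Proof.
move=> nm; have m0 : (0 < m)%N by case: m nm => //; rewrite dvdn0.
case: (egcdnP (2 ^ j) m0) => u v uv _.
have /(dvdn_pfactor _ _ (isT : prime 2))[k kj gE] := dvdn_gcdr m (2 ^ j).
have ki : (k <= i)%N.
  rewrite leqNgt; apply: contra nm => ik; apply: dvdn_trans (dvdn_gcdl m (2 ^ j)).
  by rewrite gE dvdn_exp2l// ltnW.
exists (u * 2 ^ (i - k))%N.
by rewrite mulnAC uv gE mulnDl -expnD subnKC// mulnAC modnMDl.
Qed.

Section CharGroup.
Variables (R : realType) (G : topologicalZmodType).
Local Notation T := (circle R).
Local Notation N0 := (nbhs (0 : G)).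

Definition cchar : set (G -> T) := [set chi | hom chi /\
  forall e : R, 0 < e -> exists2 V, N0 V & forall v, V v -> cnorm (chi v) < e].

Lemma cchar_subgroup : is_subgroup cchar.
Proof.
split.
  split=> [x y|e e0]; first by rewrite /= [RHS]addr0.
  by exists setT; [exact: filterT|move=> v _; rewrite /= cnorm0].
move=> chi psi [hchi cchi] [hpsi cpsi]; split.
  move=> x y; rewrite /= ![(_ - _) _]/(_ - _) /= hchi hpsi.
  by rewrite opprD addrACA.
move=> e e0; have e20 : 0 < e / 2 by rewrite divr_gt0.
have [V nV hV] := cchi _ e20; have [W nW hW] := cpsi _ e20.
exists (V `&` W); first exact: filterI.
move=> v [/hV h1 /hW h2]; apply: le_lt_trans (cnormB _ _) _.
by rewrite (splitr e) ltrD.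
Qed.

Definition charG := subgrp_of cchar_subgroup.
HB.instance Definition _ := GRing.Zmodule.on charG.
Local Notation X := charG.

Definition ch (x : X) (g : G) : T := sgval x g.

Lemma ch_hom x : hom (ch x).
Proof. by have [] := asboolW (sgP x). Qed.

Lemma ch_cont x (e : R) : 0 < e -> exists2 V, N0 V & forall v, V v -> cnorm (ch x v) < e.
Proof. by have [_] := asboolW (sgP x); exact. Qed.

Lemma chD g : hom (fun x => ch x g). Proof. by []. Qed.

Lemma ch_eq x y : (forall g, ch x g = ch y g) -> x = y.
Proof. by move=> xy; apply: val_inj; apply/funext. Qed.

Lemma ch_ex chi : cchar chi -> exists x, forall g, ch x g = chi g.
Proof. by move=> /(sg_ex cchar_subgroup)[x xE]; exists x => g; rewrite /ch xE. Qed.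

(** Among infinitely many such characters, two differ by less than [1/2] on the finite set of
    centres and by less than [1/4] on [V], hence by less than 1 everywhere. Having no small
    subgroups then makes them equal. *)
Lemma ch_small_finite V : big V ->
  finite_set [set x : X | forall v, V v -> cnorm (ch x v) < 8^-1].
Proof.
move=> [F hF]; apply: contrapT => /infiniteP/card_leTE[f [finj fS]].
have [U [UU UN]] := free_ultra_nat.
have /choice[t ht] : forall a, exists t, tlim U (fun n => ch (f n) a) t.
  by move=> a; exact: ultra_tlim.
have e0 : 0 < (4^-1 : R) by rewrite invr_gt0.
have UA : U [set n | forall a, a \in F -> cnorm (ch (f n) a - t a) < 4^-1].
  elim: (F) => [|a s IHs]; first by apply: filterE.
  apply: filterS (filterI IHs (ht a _ e0)) => n [/= h1 h2] b.
  by rewrite inE => /orP[/eqP ->|/h1].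
have [n /= hn] := filter_ex UA.
have [m [/= hm nm]] := filter_ex (filterI UA (UN n.+1)).
suff /finj : f n = f m by lia.
have bd g : cnorm (ch (f n) g - ch (f m) g) < 1.
  have [a aF Va] := hF g.
  have E x : ch x g = ch x (g - a) + ch x a by rewrite -ch_hom subrK.
  rewrite !E opprD addrACA.
  apply: le_lt_trans (cnormD _ _) _.
  have h1 : cnorm (ch (f n) (g - a) - ch (f m) (g - a)) < 4^-1.
    apply: le_lt_trans (cnormB _ _) _.
    by have := fS n _ Va; have := fS m _ Va; lra.
  have h2 : cnorm (ch (f n) a - ch (f m) a) < 2^-1.
    apply: le_lt_trans (cnorm_tri (t a) _ _) _; rewrite (cnorm_distC (t a)).
    by have := hn _ aF; have := hm _ aF; lra.
  by lra.
apply: ch_eq => g; apply/eqP; rewrite -subr_eq0; apply/eqP/no_small_subgroup => k.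
by rewrite mulrnBl -!(homMn (ch_hom _)).
Qed.

Hypothesis cG : connected [set: G].
Hypothesis mG : minimal_group G.

Lemma ch_sep g : g != 0 -> exists x, ch x g != 0.
Proof.
move=> gn0; have [W nW nWg] := hausdorff_nbhs0 mG.1 gn0.
have [|chi [hchi chig chic]] := @char_ex R G _ (gbase_nbhs G) W g _ nW nWg.
  exact: minimal_precompact R _ cG mG.
have [|x xE] := @ch_ex chi; first by split.
by exists x; rewrite xE.
Qed.

Lemma ch_torsion_free : torsion_free X.
Proof.
move=> x n n0 xn; apply: ch_eq => g.
have n1 : n = n.-1.+1 by rewrite prednK.
have ni : 0 < (n.-1.+1%:R : R)^-1 by rewrite invr_gt0 ltr0n.
have [V nV hV] := ch_cont x ni.
have xgn h : ch x h *+ n = 0 by rewrite -(homMn (chD h)) xn.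
have hker : is_subgroup [set z | ch x z = 0].
  by split=> [|z y /= h1 h2]; rewrite /= ?(hom0 (ch_hom x))// (homB (ch_hom x)) h1 h2 subr0.
have /seteqP[_ /(_ g I)//] : [set z | ch x z = 0] = setT.
apply: (open_subgroup_full cG hker nV) => z Vz /=.
by apply: (@small_torsion _ _ n.-1); [rewrite -n1|exact: hV].
Qed.

Definition cball k (x : nat -> X) (e : R) : set G :=
  [set g | forall i, (i < k)%N -> cnorm (ch (x i) g) < e].

Lemma cball_nbhs k x (e : R) : 0 < e -> N0 (cball k x e).
Proof.
move=> e0; elim: k => [|k IH]; first by apply: filterE.
have [V nV hV] := ch_cont (x k) e0; apply: filterS (filterI IH nV) => g [h1 /hV h2] i.
by rewrite ltnS leq_eqVlt => /orP[/eqP ->|/h1].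
Qed.

(** By [ch_sep] the balls given by finitely many characters define a Hausdorff group topology, which
    minimality identifies with that of [G]. *)
Lemma ch_top W : N0 W -> exists k x (e : R), 0 < e /\ cball k x e `<=` W.
Proof.
move=> nW; apply: contrapT => hn.
pose D := [set S | exists k x (e : R), 0 < e /\ S = cball k x e].
apply: (@not_minimal G D _ _ _ _ mG).
- split.
  + by exists (cball 0 (fun=> 0) 1), 0%N, (fun=> 0), 1.
  + move=> _ _ [k [x [e [e0 ->]]]] [k' [x' [e' [e'0 ->]]]].
    pose y i := if (i < k)%N then x i else x' (i - k)%N.
    exists (cball (k + k') y (Num.min e e')).
      by exists (k + k')%N, y, (Num.min e e'); rewrite lt_min e0.
    move=> g hg; split=> i ik.
      by have := hg i; rewrite /y ik lt_min => /(_ (ltn_addr _ ik))/andP[].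
    have := hg (k + i)%N; rewrite /y ltn_add2l addKn.
    have -> : (k + i < k)%N = false by lia.
    by rewrite lt_min => /(_ ik)/andP[].
  + by move=> _ [k [x [e [e0 ->]]]] i ik; rewrite (hom0 (ch_hom _)) cnorm0.
  + move=> _ [k [x [e [e0 ->]]]]; exists (cball k x (e / 2)).
      by exists k, x, (e / 2); rewrite divr_gt0.
    move=> g g' hg hg' i ik; rewrite (homB (ch_hom _)); apply: le_lt_trans (cnormB _ _) _.
    by rewrite (splitr e) ltrD ?hg ?hg'.
- by move=> _ [k [x [e [e0 ->]]]]; exact: cball_nbhs.
- move=> g /ch_sep[x xg]; exists (cball 1 (fun=> x) (cnorm (ch x g))).
    exists 1%N, (fun=> x), (cnorm (ch x g)); split=> //.
    by rewrite lt_neqAle cnorm_ge0 andbT eq_sym; apply: contraNneq xg => /cnorm_eq0 ->.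
  by move=> /(_ 0%N isT); rewrite ltxx.
exists W => // _ [k [x [e [e0 ->]]]] sub; apply: hn; by exists k, x, e.
Qed.

Hypothesis sG : sequentially_complete G.

(** By [ch_top] a sequence whose characters all converge is Cauchy, so [G] is sequentially closed
    among the homomorphisms from [X] to the circle. *)
Lemma ch_seq_closed (u : nat -> G) (k : X -> T) :
  (forall x, tlim \oo (fun n => ch x (u n)) (k x)) -> exists g, forall x, ch x g = k x.
Proof.
move=> uk; have [W nW|l ul] := sG (u := u).
  have [m [x [e [e0 hW]]]] := ch_top nW.
  have e20 : 0 < e / 2 by rewrite divr_gt0.
  suff [N _ hN] : \oo [set n | forall i, (i < m)%N -> cnorm (ch (x i) (u n) - k (x i)) < e / 2].
    exists N => a b Na Nb; apply: hW => i im; rewrite (homB (ch_hom _)).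
    apply: le_lt_trans (cnorm_tri (k (x i)) _ _) _.
    by rewrite (splitr e) ltrD ?hN// cnorm_distC hN.
  elim: (m) => [|j IHj]; first by apply: filterE.
  apply: filterS (filterI IHj (uk (x j) _ e20)) => n [/= h1 h2] i.
  by rewrite ltnS leq_eqVlt => /orP[/eqP ->|/h1].
exists l => x; apply: tlim_unique (uk x) => e e0.
have [V nV hV] := ch_cont x e0.
have [N _ hN] : \oo [set n | V (u n - l)] := ul _ (nbhs_translate l nV).
by exists N => // n /hN /= /hV; rewrite (homB (ch_hom _)).
Qed.

Lemma ch_tors2 (y : X -> T) : hom y -> (forall x, tors2 (y x)) ->
  exists k g, forall x, ch x g = y x *+ 2 ^ k.
Proof.
move=> hy ty; have [[x0 yx0]|y0] := pselect (exists x, y x != 0); last first.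
  exists 0%N, 0 => x; rewrite (hom0 (ch_hom _)).
  suff -> : y x = 0 by rewrite mul0rn.
  by apply/eqP; apply: contraT => h; case: y0; exists x.
(* The 2-adic multiples of [y]: on the elements where [2 ^ j] kills [y], such a homomorphism is
   multiplication of [y] by an integer depending on [j]. *)
pose N : set (X -> T) := [set n | hom n /\
  forall j, exists m, forall x, y x *+ 2 ^ j = 0 -> n x = y x *+ m].
have NB n n' : N n -> N n' -> N (fun x => n x - n' x).
  move=> [hn Nn] [hn' Nn']; split=> [a b|j]; first by rewrite hn hn' opprD addrACA.
  have [m hm] := Nn j; have [m' hm'] := Nn' j; exists (m + m' * (2 ^ j).-1)%N => x xj.
  rewrite hm// hm'// mulrnDr; congr (_ + _).
  apply/eqP; rewrite eq_sym -subr_eq0 opprK -mulrnDr -mulnSr prednK ?expn_gt0//.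
  by rewrite mulnC mulrnA xj mul0rn.
have Ny m : N (fun x => y x *+ m).
  by split=> [a b|j]; [rewrite hy mulrnDl|exists m].
have N00 : N (fun=> 0) by have := Ny 0%N; under eq_fun do rewrite mulr0n.
pose S k (x : nat -> X) (e : R) : set G :=
  [set g | exists2 n, N n & forall i, (i < k)%N -> cnorm (ch (x i) g - n (x i)) < e].
pose D := [set W | exists k x (e : R), 0 < e /\ W = S k x e].
have SI k x (e : R) k' x' (e' : R) : 0 < e -> 0 < e' -> exists k2 x2 (e2 : R), [/\ 0 < e2,
    S k2 x2 e2 `<=` S k x e `&` S k' x' e' &
    forall (n : X -> T) g, (forall i, (i < k2)%N -> cnorm (ch (x2 i) g - n (x2 i)) < e2) ->
      (forall i, (i < k)%N -> cnorm (ch (x i) g - n (x i)) < e) /\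
      (forall i, (i < k')%N -> cnorm (ch (x' i) g - n (x' i)) < e')].
  move=> e0 e'0; pose z i := if (i < k)%N then x i else x' (i - k)%N.
  have H (n : X -> T) g : (forall i, (i < k + k')%N -> cnorm (ch (z i) g - n (z i)) < Num.min e e') ->
      (forall i, (i < k)%N -> cnorm (ch (x i) g - n (x i)) < e) /\
      (forall i, (i < k')%N -> cnorm (ch (x' i) g - n (x' i)) < e').
    move=> hg; split=> i ik.
      by have := hg i; rewrite /z ik lt_min => /(_ (ltn_addr _ ik))/andP[].
    have := hg (k + i)%N; rewrite /z ltn_add2l addKn.
    have -> : (k + i < k)%N = false by lia.
    by rewrite lt_min => /(_ ik)/andP[].
  exists (k + k')%N, z, (Num.min e e'); split=> //; first by rewrite lt_min e0.
  by move=> g [n Nn /H[h1 h2]]; split; exists n.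
have [g [gn0 Ng]] : exists g, g != 0 /\ N (fun x => ch x g).
  apply: contrapT => hn; apply: (@not_minimal G D _ _ _ _ mG).
  - split.
    + by exists (S 0%N (fun=> 0) 1), 0%N, (fun=> 0), 1.
    + move=> _ _ [k [x [e [e0 ->]]]] [k' [x' [e' [e'0 ->]]]].
      have [k2 [x2 [e2 [e20 h _]]]] := SI k x e k' x' e' e0 e'0.
      by exists (S k2 x2 e2) => //; exists k2, x2, e2.
    + move=> _ [k [x [e [e0 ->]]]]; exists (fun=> 0) => // i ik.
      by rewrite (hom0 (ch_hom _)) subrr cnorm0.
    + move=> _ [k [x [e [e0 ->]]]]; exists (S k x (e / 2)).
        by exists k, x, (e / 2); rewrite divr_gt0.
      move=> g g' [n Nn hg] [n' Nn' hg']; exists (fun x => n x - n' x); first exact: NB.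
      move=> i ik; rewrite (homB (ch_hom _)).
      have -> : ch (x i) g - ch (x i) g' - (n (x i) - n' (x i)) =
        (ch (x i) g - n (x i)) - (ch (x i) g' - n' (x i)) by zmod.
      apply: le_lt_trans (cnormB _ _) _.
      by rewrite (splitr e) ltrD ?hg ?hg'.
  - move=> _ [k [x [e [e0 ->]]]]; apply: filterS (cball_nbhs k x e0) => g hg.
    by exists (fun=> 0) => // i ik; rewrite subr0; exact: hg.
  (* A point in all these neighbourhoods is a limit of elements of [N]. On each level only finitely
     many residues modulo [2 ^ j] are possible, so the limit is in [N], against the assumption that
     no nonzero element of [G] is. *)
  - move=> g gn0; apply: contrapT => hg.
    have {}hg k x (e : R) : 0 < e -> S k x e g.
      move=> e0; apply: contrapT => nS; apply: hg; exists (S k x e) => //.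
      by exists k, x, e.
    pose I3 := (nat * (nat -> X) * R)%type.
    have [|i j Di Dj|i Di|U [UU UB]] := @ultra_base (X -> T) I3 [set i | 0 < i.2]
      (fun i => [set n | N n /\ forall l, (l < i.1.1)%N -> cnorm (ch (i.1.2 l) g - n (i.1.2 l)) < i.2]).
    + by exists (0%N, fun=> 0, 1) => /=.
    + have [k2 [x2 [e2 [e20 _ h]]]] := SI i.1.1 i.1.2 i.2 j.1.1 j.1.2 j.2 Di Dj.
      exists (k2, x2, e2) => // n [Nn /= /h[h1 h2]].
      by split.
    + by have [n Nn hn'] := hg i.1.1 i.1.2 i.2 Di; exists n.
    have UN : U N.
      by apply: filterS (UB (0%N, fun=> 0, 1) ltr01) => n [].
    have Ulim x : tlim U (fun n => n x) (ch x g).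
      move=> e e0; apply: filterS (UB (1%N, fun=> x, e) e0) => n [_ /(_ 0%N isT)] /=.
      by rewrite cnorm_distC.
    apply: hn; exists g; split=> //; split; first by move=> a b; rewrite chD.
    move=> j.
    have [m Um] : exists m, U [set n | N n /\ forall x, y x *+ 2 ^ j = 0 -> n x = y x *+ m].
      apply: contrapT => hm.
      have Uc M : U [set n | forall m, (m < M)%N -> ~ (forall x, y x *+ 2 ^ j = 0 -> n x = y x *+ m)].
        elim: M => [|M IH]; first by apply: filterE.
        have nU : ~ U [set n | forall x, y x *+ 2 ^ j = 0 -> n x = y x *+ M].
          by move=> h; apply: hm; exists M; apply: filterS (filterI UN h).
        apply: filterS (filterI IH (ultra_setN UU nU)) => n [h1 h2] m.
        by rewrite ltnS leq_eqVlt => /orP[/eqP ->|/h1].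
      have [n [/= [_ Nn] hn']] := filter_ex (filterI UN (Uc (2 ^ j)%N)).
      have [m hm'] := Nn j; apply: (hn' (m %% 2 ^ j)%N); first by rewrite ltn_mod expn_gt0.
      move=> x xj; rewrite hm'//; apply: mulrn_eqmod xj _; by rewrite modn_mod.
    exists m => x xj; apply: tlim_unique (Ulim x) _.
    apply: tlim_near (tlim_cst (y x *+ m)).
    by apply: filterS Um => n [_ /(_ x xj) h] /=; rewrite h.
  (* The new topology is strictly coarser: by [char_dense] some [g'] is close to the multiple [m] of
     [y] at the given characters and at [x0]. It is near [N], but its value at [x0] is not within
     [1/2] of 0. *)
  - have [m hm] : exists m, 1 <= cnorm (y x0 *+ m).
      apply: contrapT => h; move/eqP: yx0; apply; apply: no_small_subgroup => m.
      by rewrite ltNge; apply/negP => h'; apply: h; exists m.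
    have h20 : 0 < (2^-1 : R) by rewrite invr_gt0.
    exists (cball 1 (fun=> x0) 2^-1); first exact: cball_nbhs.
    move=> _ [k [x [e [e0 ->]]]] sub.
    pose z i := if (i < k)%N then x i else x0.
    have em : 0 < Num.min e 2^-1 by rewrite lt_min e0.
    have [n hn'|g' hg'] := @char_dense R G k.+1 (fun i => ch (z i)) (fun i => ch_hom (z i))
        (fun i => y (z i) *+ m) _ em.
      have hlc : hom (fun x => y x *+ m) by move=> a b; rewrite hy mulrnDl.
      have -> : lc k.+1 n (fun i => y (z i) *+ m) = y (\sum_(i < k.+1) z i *~ n i) *+ m.
        by rewrite (hom_sum hlc); apply: eq_bigr => i _; rewrite (homMz hlc).
      suff -> : \sum_(i < k.+1) z i *~ n i = 0 by rewrite (hom0 hy) mul0rn.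
      apply: ch_eq => g'; rewrite (hom_sum (chD g')) /= -[RHS](hn' g').
      by apply: eq_bigr => i _; rewrite (homMz (chD g')).
    have /sub/(_ 0%N isT) : S k x e g'.
      exists (fun x => y x *+ m) => // i ik; have := hg' i (ltnW ik).
      by rewrite /z ik lt_min => /andP[].
    have := hg' k (ltnSn k); rewrite /z ltnn lt_min => /andP[_ h1] h2.
    have := cnormB (ch x0 g') (ch x0 g' - y x0 *+ m).
    have -> : ch x0 g' - (ch x0 g' - y x0 *+ m) = y x0 *+ m by zmod.
    by lra.
have [hg /choice[m hm]] := Ng.
(* Since [2 ^ i0] kills [y x1] but [g] does not vanish at [x1], the integers [m j] with [j >= i0]
   are not divisible by [2 ^ i0]. So suitable multiples of [g] agree with [2 ^ i0] times [y] on
   level [j]. *)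
have [x1 x1g] := ch_sep gn0; have [i0 yi0] := ty x1.
have /choice[w hw] : forall j, exists w, (i0 <= j)%N -> (w * m j = 2 ^ i0 %[mod 2 ^ j])%N.
  move=> j; have [ij|] := leqP i0 j; last by exists 0%N.
  have [|w hw] := @pow2_inverse (m j) i0 j; last by exists w.
  apply: contra x1g => /dvdnP[c mc].
  rewrite (hm j x1); first by rewrite mc mulnC mulrnA yi0 mul0rn.
  by rewrite -(subnKC ij) expnD mulrnA yi0 mul0rn.
have [|g' hg'] := @ch_seq_closed (fun j => g *+ w j) (fun x => y x *+ 2 ^ i0); last by exists i0, g'.
move=> x; have [i1 yi1] := ty x.
apply: tlim_near (tlim_cst (y x *+ 2 ^ i0)); exists (maxn i0 i1) => // j /=.
rewrite geq_max => /andP[ij ij1]; have xj : y x *+ 2 ^ j = 0.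
  by rewrite -(subnKC ij1) expnD mulrnA yi1 mul0rn.
rewrite (homMn (ch_hom _)) (hm j x xj) -mulrnA mulnC; apply: mulrn_eqmod xj _.
by rewrite hw.
Qed.

End CharGroup.

(** * Characters of a torsion-free group as families of characters of the rationals *)

Section CoordinateLift.
Variables (R : realType) (X : zmodType) (J : choiceType).
Variables (e : J -> X) (c : X -> J -> rat) (s : X -> seq J).
Hypothesis cs : forall x, uniq (s x) /\ (forall j, c x j != 0 -> j \in s x).
Hypothesis cD : forall x y j, c (x + y) j = c x j + c y j.
Hypothesis c_inj : forall x, (forall j, c x j = 0) -> x = 0.
Hypothesis ce : forall j i, c (e j) i = (i == j)%:R.
Local Notation T := (circle R).
Implicit Type h : J -> rat -> T.

Definition pairing h x : T := \sum_(j <- s x) h j (c x j).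

Lemma pairingE h x (S : seq J) : homfam h -> uniq S -> {subset s x <= S} ->
  pairing h x = \sum_(j <- S) h j (c x j).
Proof.
move=> hh uS sS; have [us ns] := cs x.
rewrite [RHS](bigID (mem (s x))) /= [X in _ = _ + X]big1 ?addr0; last first.
  move=> j; case: (c x j =P 0) => [-> _|/eqP/ns -> //]; exact: hom0.
rewrite -big_filter; apply: perm_big; apply: uniq_perm => //; first exact: filter_uniq.
by move=> j; rewrite mem_filter andb_idr//; exact: sS.
Qed.

Lemma pairing_hom h : homfam h -> hom (pairing h).
Proof.
move=> hh x y; pose S := undup (s x ++ s y ++ s (x + y)).
have uS : uniq S by exact: undup_uniq.
rewrite !(@pairingE _ _ S)//.
- by rewrite -big_split; apply: eq_bigr => j _; rewrite cD hh.
- by move=> j js; rewrite mem_undup !mem_cat js ?orbT.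
- by move=> j js; rewrite mem_undup !mem_cat js ?orbT.
- by move=> j js; rewrite mem_undup !mem_cat js ?orbT.
Qed.

Lemma pairingB h h' x : pairing (h - h') x = pairing h x - pairing h' x.
Proof. by rewrite /pairing -sumrB. Qed.

Lemma pairing_fam_hom x : hom (fun h => pairing h x).
Proof. by move=> h h'; rewrite /pairing -big_split. Qed.

Lemma pairing_e h j : homfam h -> pairing h (e j) = h j 1.
Proof.
move=> hh; have [us ns] := cs (e j).
have js : j \in s (e j) by apply: ns; rewrite ce eqxx oner_eq0.
rewrite /pairing (bigD1_seq j)//= ce eqxx big1 ?addr0// => i ij.
by rewrite ce (negPf ij); exact: hom0.
Qed.

(** The coordinates embed [X] in the divisible group of all functions from [J] to the rationals.
    Transport [k] to the image by a chosen inverse, extend it by [baer_ext], and restrict the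
    extension to each coordinate axis. *)
Lemma pairing_lift (k : X -> T) : hom k -> exists2 h, homfam h & forall x, pairing h x = k x.
Proof.
move=> hk; pose M := J -> rat.
have c_inj2 x y : c x = c y -> x = y.
  move=> xy; apply/eqP; rewrite -subr_eq0; apply/eqP/c_inj => j.
  have := cD (x - y) y j; rewrite subrK xy => /eqP.
  by rewrite -[X in X == _]add0r => /eqP/addIr <-.
have /choice[inv hinv] : forall v : M, exists x, (exists x', c x' = v) -> c x = v.
  move=> v; have [[x xv]|nv] := pselect (exists x', c x' = v); first by exists x.
  by exists 0 => /nv.
have invc x : inv (c x) = x by apply: c_inj2; apply: hinv; exists x.
have c_hom : hom (c : X -> M) by move=> x y; apply/funext => j; rewrite cD.
have divT (t : T) n : (0 < n)%N -> [set: T] t -> exists2 u, [set: T] u & u *+ n = t.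
  by move=> n0 _; have [u un] := circle_div t n0; exists u.
have [|||F [hF _ FE]] := @baer_ext R M setT (conj I (fun _ _ _ _ => I)) divT
    [set v | exists x, c x = v] (fun v => k (inv v)).
- split; first by exists 0; exact: (hom0 c_hom).
  by move=> _ _ [x <-] [y <-]; exists (x - y); rewrite (homB c_hom).
- by move=> _ _ [x <-] [y <-]; rewrite -(homB c_hom) !invc (homB hk).
- by [].
pose del j q : M := fun i => if i == j then q else 0.
exists (fun j q => F (del j q)) => [j q q'|x].
  rewrite -hF; congr F; apply/funext => i; rewrite /del [RHS]/GRing.add/=.
  by case: ifP => // _; rewrite addr0.
have <- : F (c x) = k x by rewrite FE ?invc//; exists x.
rewrite /pairing -(hom_sum hF); congr F; apply/funext => i.
have hi : hom (fun v : M => v i) by [].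
rewrite (hom_sum hi) /del; have [us ns] := cs x.
have [is_|nis] := boolP (i \in s x); last first.
  rewrite big_seq big1; last by move=> j js; case: eqP => // ij; rewrite ij js in nis.
  by apply/eqP; rewrite eq_sym; apply: contraNT nis => /ns.
rewrite (bigD1_seq i)//= eqxx big1 ?addr0// => j.
by rewrite eq_sym => /negPf ->.
Qed.

End CoordinateLift.

(** * From groups to measurable cardinals *)

Lemma ultra_finite (T : choiceType) (F : set_system T) (S : set T) :
  UltraFilter F -> finite_set S -> F S -> exists2 x, S x & F [set x].
Proof.
move=> UF /finite_seqP[s ->]; elim: s => [|a s IH] FS.
  have : F set0 by apply: filterS FS => x /=; rewrite in_nil.
  by move/(@filter_not_empty _ F _).
have [Fa|nFa] := pselect (F [set a]); first by exists a => //=; rewrite mem_head.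
have [|x xs Fx] := IH.
  apply: filterS (filterI FS (ultra_setN UF nFa)) => x [/=]; rewrite inE.
  by case/orP => [/eqP -> []|].
by exists x => //=; rewrite inE; apply/orP; right.
Qed.

(** The image ultrafilter is free because a large fiber, being finite, would contain a large
    singleton. *)
Lemma Ulam_measurable_map (T : choiceType) (A : Type) (f : T -> A) :
  (forall a, finite_set [set x | f x = a]) -> Ulam_measurable T -> Ulam_measurable A.
Proof.
move=> ff [F [UF fF cF]]; exists (f @ F); split.
- exact: ultra_fmap.
- apply/seteqP; split=> // a ha.
  have Fa : F [set x | f x = a].
    apply: contrapT => /(ultra_setN UF) Fn.
    by have := ha (~` [set a]); apply; [exact: Fn|].
  have [x fx Fx] := ultra_finite UF (ff a) Fa.
  have : (\bigcap_(U in F) U) x by move=> U FU; have [y [/= -> Uy]] := filter_ex (filterI Fx FU).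
  by rewrite fF.
- by move=> U FU; exact: (cF (fun n => f @^-1` U n)).
Qed.

Theorem Ulam_of_group (R : realType) (G : topologicalZmodType) (A : Type) :
  ~ compact [set: G] -> connected [set: G] -> sequentially_complete G ->
  minimal_group G -> has_weight G A -> Ulam_measurable A.
Proof.
move=> ncG cG sG mG [[B bB BA] _]; apply: contrapT => noA; apply: ncG.
pose X := charG R G.
have [J [e [c [s [cs cD c_inj ce]]]]] := coords_ex (@ch_torsion_free R G cG).
have einj : injective e.
  move=> i j ij; have := ce i i; rewrite ij ce eqxx; case: eqP => //.
(* Send [j] to a base set at 0 on which the character [e j] is below [1/8]. Base sets are big by
   precompactness, so fibers are finite by [ch_small_finite], and measurability of [J] would pass to
   [A]. *)
have noJ : ~ Ulam_measurable J.
  have h80 : 0 < (8^-1 : R) by rewrite invr_gt0.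
  have /choice[b hb] : forall x : X, exists b : set G, [/\ B b, b 0 &
      forall v, b v -> cnorm (ch x v) < 8^-1].
    move=> x; have [V nV hV] := ch_cont x h80.
    by have [b [Bb b0] bV] := bB.2 _ _ nV; exists b; split=> // v /bV/hV.
  move: BA; rewrite card_eq_le => /andP[/card_leP[f] _].
  have finj : injective f by move=> u v; apply: inj; rewrite inE.
  have bin x : b x \in B by rewrite inE; have [] := hb x.
  pose phi j : A := val (f (SigSub (bin (e j)))).
  apply: contra_not noA; apply: (@Ulam_measurable_map J A phi) => a.
  have [[j0 j0a]|na] := pselect (exists j, phi j = a); last first.
    suff -> : [set j | phi j = a] = set0 by [].
    by apply/seteqP; split=> // j ja; apply: na; exists j.
  have phib j : phi j = a -> b (e j) = b (e j0).
    rewrite -j0a => /val_inj/finj/(congr1 val)//.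
  have nb : nbhs (0 : G) (b (e j0)).
    by have [Bb b0 _] := hb (e j0); apply: open_nbhs_nbhs; split=> //; exact: bB.1.
  have := @ch_small_finite R G _ (minimal_precompact R cG mG nb).
  move=> /(finite_preimage (in2W einj)); apply: sub_finite_set => j /= /phib bE.
  by have [_ _] := hb (e j); rewrite bE.
pose pi := @pairing R X J c s.
pose G' : set (J -> rat -> circle R) :=
  [set h | homfam h /\ exists g, forall x : X, ch x g = pi h x].
have subG' : is_subgroup G'.
  split.
    split; first by move=> j; exact: homfam0.
    exists 0 => x; rewrite (hom0 (ch_hom x)) /pi /pairing big1//.
  move=> h h' [hh [g hg]] [hh' [g' hg']]; split.
    move=> j q q'; have E r : (h - h') j r = h j r - h' j r by [].
    by rewrite !E hh hh' opprD addrACA.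
  by exists (g - g') => x; rewrite (homB (ch_hom x)) hg hg' /pi pairingB.
have full h : homfam h -> G' h.
  apply: (@splitting_full R J G' subG') => //.
  - move=> u h0 Gu ulim.
    have ut j q : tlim \oo (fun n => u n j q) (h0 j q).
      by move=> d d0; have [N hN] := ulim j q d d0; exists N.
    have hh0 : homfam h0.
      move=> j; apply: (@hom_tlim R nat \oo rat (fun n => u n j)); last exact: ut.
      by apply: filterE => n; exact: (Gu n).1.
    split=> //; have /choice[g hg] : forall n, exists g, forall x : X, ch x g = pi (u n) x.
      by move=> n; exact: (Gu n).2.
    have [|g' hg'] := @ch_seq_closed R G cG mG sG g (pi h0); last by exists g'.
    move=> x; apply: (@tlim_near _ _ _ _ (fun n => pi (u n) x)).
      by apply: filterE => n /=; rewrite hg.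
    by apply: tlim_sum => j; exact: ut.
  - move=> h0 hh0 th0.
    have [||k [g hg]] := @ch_tors2 R G cG mG sG (pi h0).
    + exact: pairing_hom.
    + move=> x; rewrite /pi /pairing; apply: (big_ind (@tors2 R)) => //.
      * by exists 0%N; rewrite mul0rn.
      * exact: (subgroupD (tors2_subgroup R)).
    + exists k; split.
        move=> j q q'; have hj : hom (fun f : J -> rat -> circle R => f j) by [].
        have hq r : hom (fun f : rat -> circle R => f r) by [].
        by rewrite (homMn hj) !(homMn (hq _)) hh0 mulrnDl.
      by exists g => x; rewrite hg /pi (homMn (pairing_fam_hom c s x)).
  - by move=> h0 [].
  - move=> h0 hh0 l d d0.
    have [/size0nil ->|[p0 _]] : size l = 0%N \/ exists p0, p0 \in l.
      by case: (l) => [|a r]; [left|right; exists a; rewrite mem_head].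
    + by exists 0; [exact: subG'.1|].
    pose M := subgrp_of subG'.
    pose y i (h : M) : circle R := sgval h (nth p0 l i).1 (nth p0 l i).2.
    have hy i : hom (y i) by [].
    have [n hn|h' hh'] := @char_dense R M (size l) y hy
        (fun i => h0 (nth p0 l i).1 (nth p0 l i).2) d d0; last first.
      exists (sgval h'); first exact: asboolW (sgP h').
      by move=> p pl; have := hh' (index p l); rewrite index_mem /y nth_index// => /(_ pl).
    (* Clearing denominators turns a relation between the coordinate values on [G'] into an element
       [x] of [X] on which all of [G] vanishes, so [x = 0]. Pairing [x] with [h0] rescaled by
       [1 / D] returns the relation for [h0]. *)
    pose D := (\prod_(p <- l) `|denq p.2|)%N.
    have D0 : (0 < D)%N.
      by rewrite /D; apply: prodn_cond_gt0 => i _; rewrite absz_gt0 denq_neq0.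
    have zD i : exists z : int, (i < size l)%N -> (nth p0 l i).2 * D%:R = z%:~R.
      have [il|_] := ltnP i (size l); last by exists 0.
      pose p := nth p0 l i; have pl : p \in l by exact: mem_nth.
      have -> : D = (`|denq p.2| * \prod_(p' <- rem p l) `|denq p'.2|)%N.
        by rewrite /D (big_rem p pl).
      set E := (\prod_(_ <- _) _)%N; exists (numq p.2 * E%:Z) => _.
      rewrite -/p natrM mulrA intrM; congr (_ * _).
      rewrite -{1}(divq_num_den p.2) pmulrn gez0_abs ?ltW ?denq_gt0// mulfVK//.
      by rewrite intr_eq0 denq_neq0.
    have [z hz] := choice zD.
    pose x : X := \sum_(i < size l) e (nth p0 l i).1 *~ (n i * z i).
    have pix h2 : homfam h2 -> pi h2 x = lc (size l) n (fun i => h2 (nth p0 l i).1 (nth p0 l i).2) *+ D.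
      move=> hh2; rewrite /pi (hom_sum (pairing_hom cs cD hh2)) /lc -sumrMnl.
      apply: eq_bigr => i _; rewrite (homMz (pairing_hom cs cD hh2)) (pairing_e cs ce)//.
      rewrite [n i * z i]mulrC mulrzA -(homMz (hh2 _)) -hz//.
      rewrite [_ * D%:R]mulr_natr (homMn (hh2 _)).
      by rewrite !pmulrn mulrzAC.
    have x0 : x = 0.
      apply: ch_eq => g; rewrite (hom0 (chD g)).
      have [h2 hh2 hg] := pairing_lift cs cD c_inj (chD g).
      have Gh : G' h2 by split=> //; exists g.
      have -> : ch x g = pi h2 x by rewrite /pi hg.
      rewrite pix//; have [h' h'E] := sg_ex subG' Gh.
      by have := hn h'; rewrite /y h'E => ->; rewrite mul0rn.
    pose h1 : J -> rat -> circle R := fun j q => h0 j (q / D%:R).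
    have hh1 : homfam h1 by move=> j q q'; rewrite /h1 mulrDl hh0.
    transitivity (pi h1 x); last by rewrite x0; exact: (hom0 (pairing_hom cs cD hh1)).
    rewrite pix//.
    rewrite /lc -sumrMnl; apply: eq_bigr => i _.
    rewrite pmulrn mulrzAC -pmulrn; congr (_ *~ _); rewrite -(homMn (hh0 _)).
    congr (h0 _ _); rewrite -[RHS]mulr_natr mulfVK//.
    by rewrite pnatr_eq0 -lt0n.
rewrite compact_ultra => U UU _.
have /choice[k hk] : forall x : X, exists t, tlim U (ch x) t.
  by move=> x; exact: ultra_tlim.
have hkh : hom k.
  move=> x y; apply: tlim_unique (hk _) _.
  apply: (@tlim_near _ _ _ _ (fun g => ch x g + ch y g)); last exact: tlimD.
  by apply: filterE => g /=; exact/esym/(chD g x y).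
have [h hh hhk] := pairing_lift cs cD c_inj hkh.
have [_ [g hg]] := full h hh.
exists g; split=> // W nW.
have [n [x [d [d0 hW]]]] := @ch_top R G cG mG _ (nbhs_translateN nW).
have Un : U [set g' | forall i, (i < n)%N -> cnorm (ch (x i) g' - k (x i)) < d].
  elim: (n) => [|j IHj]; first by apply: filterE.
  apply: filterS (filterI IHj (hk (x j) _ d0)) => g' [/= h1 h2] i.
  by rewrite ltnS leq_eqVlt => /orP[/eqP ->|/h1].
apply: filterS Un => g' hg'; have <- : g + (g' - g) = g' by rewrite addrC subrK.
apply: (hW (g' - g)).
by move=> i im; rewrite (homB (ch_hom _)) hg /pi hhk; exact: hg'.
Qed.

(** * Cardinal arithmetic *)

Lemma comparable_sets (A : Type) (D E : set A) :
  (exists g : A -> A, (forall a, D a -> E (g a)) /\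
     forall a b, D a -> D b -> g a = g b -> a = b) \/
  (exists g : A -> A, (forall a, E a -> D (g a)) /\
     forall a b, E a -> E b -> g a = g b -> a = b).
Proof.
pose good (G : set (A * A)) := [/\ forall p, G p -> D p.1 /\ E p.2,
  forall a b c, G (a, b) -> G (a, c) -> b = c & forall a b c, G (a, c) -> G (b, c) -> a = b].
have [||G [[GDE Gf Gi] Gmax]] := @Zorn_nonempty _ good set0.
- by split.
- move=> F [X FX] Fg Ft; split.
  + by move=> p [Y FY Yp]; have [h _ _] := Fg _ FY; exact: h.
  + move=> a b c [Y FY Yp] [Z FZ Zp]; have [YZ|ZY] := Ft _ _ FY FZ.
      by have [_ h _] := Fg _ FZ; apply: h Zp; exact: YZ.
    by have [_ h _] := Fg _ FY; apply: h Yp _; exact: ZY.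
  + move=> a b c [Y FY Yp] [Z FZ Zp]; have [YZ|ZY] := Ft _ _ FY FZ.
      by have [_ _ h] := Fg _ FZ; apply: h Zp; exact: YZ.
    by have [_ _ h] := Fg _ FY; apply: h Yp _; exact: ZY.
have [hD|nD] := pselect (forall a, D a -> exists b, G (a, b)).
  left; have /choice[g hg] : forall a, exists b, D a -> G (a, b).
    by move=> a; have [/hD[b Gb]|?] := pselect (D a); [exists b|exists a].
  exists g; split=> [a /hg/GDE[]//|a b Da Db gab].
  by apply: Gi (hg a Da) _; rewrite gab; exact: hg.
have [hE|nE] := pselect (forall b, E b -> exists a, G (a, b)).
  right; have /choice[g hg] : forall b, exists a, E b -> G (a, b).
    by move=> a; have [/hE[b Gb]|?] := pselect (E a); [exists b|exists a].
  exists g; split=> [a /hg/GDE[]//|a b Da Db gab].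
  by apply: Gf (hg a Da) _; rewrite gab; exact: hg.
have [a Da na] : exists2 a, D a & ~ exists b, G (a, b).
  by apply: contrapT => h; apply: nD => a Da; apply: contrapT => h'; apply: h; exists a.
have [b Eb nb] : exists2 b, E b & ~ exists a, G (a, b).
  by apply: contrapT => h; apply: nE => c Ec; apply: contrapT => h'; apply: h; exists c.
exfalso; apply: (na); exists b; apply: (Gmax (G `|` [set (a, b)])).
- split.
  + by move=> p [/GDE//|->].
  + move=> x y z [G1|e1] [G2|e2]; first exact: Gf G1 G2.
    * by case: e2 => xa _; case: na; exists y; rewrite -xa.
    * by case: e1 => xa _; case: na; exists z; rewrite -xa.
    * by case: e1 => _ ->; case: e2 => _ ->.
  + move=> x y z [G1|e1] [G2|e2]; first exact: Gi G1 G2.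
    * by case: e2 => _ zb; case: nb; exists x; rewrite -zb.
    * by case: e1 => _ zb; case: nb; exists y; rewrite -zb.
    * by case: e1 => -> _; case: e2 => -> _.
- by left.
- by right.
Qed.

Section Square.
Variable A : Type.
Hypothesis A_inf : ([set: nat] #<= [set: A])%card.

(** Zorn's lemma on graphs of injections from [D * D] to [D], for [D] containing a copy of [nat]. If
    the complement of a maximal [D] embeds in [D], then so does [A]; otherwise the complement
    contains a copy of [D], and the graph can be extended. *)
Lemma square_inj : exists f : A * A -> A, injective f.
Proof.
have /card_leTE[iota [iinj _]] := A_inf.
pose dom (G : set (A * A * A)) a := exists c, G (a, a, c).
pose G0 : set (A * A * A) := [set p | exists m n : nat, p = (iota m, iota n, iota (pickle (m, n)))].
pose good (G : set (A * A * A)) := [/\ forall a b c, G (a, b, c) -> [/\ dom G a, dom G b & dom G c],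
  forall a b, dom G a -> dom G b -> exists c, G (a, b, c),
  forall a b c d, G (a, b, c) -> G (a, b, d) -> c = d,
  forall a b a' b' c, G (a, b, c) -> G (a', b', c) -> (a, b) = (a', b') & G0 `<=` G].
have [||G [[Gd Gt Gf Gi GG0] Gmax]] := @Zorn_nonempty _ good G0.
- have d0 n : dom G0 (iota n) by exists (iota (pickle (n, n))), n, n.
  split=> //.
  + by move=> a b c [m [n [-> -> ->]]].
  + move=> a b [_ [m [_ [-> _ _]]]] [_ [n [_ [-> _ _]]]].
    by exists (iota (pickle (m, n))), m, n.
  + by move=> a b c d [m [n [-> -> ->]]] [m' [n' [/iinj -> /iinj -> ->]]].
  + move=> a b a' b' c [m [n [-> -> ->]]] [m' [n' [-> -> /iinj e]]].
    by move: e => /(pcan_inj pickleK)[-> ->].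
- move=> F [X FX] Fg Ft.
  have up Y Z p : F Y -> F Z -> Y p -> exists W, [/\ F W, Y `<=` W & Z `<=` W].
    by move=> FY FZ _; have [YZ|ZY] := Ft _ _ FY FZ; [exists Z; split=> // ?|exists Y; split=> // ?].
  have dU Y a : F Y -> dom Y a -> dom (\bigcup_(X in F) X) a.
    by move=> FY [c Yc]; exists c; exists Y.
  split.
  + move=> a b c [Y FY Yp]; have [h _ _ _ _] := Fg _ FY.
    by have [h1 h2 h3] := h _ _ _ Yp; split; exact: dU FY _.
  + move=> a b [c [Y FY Yc]] [d [Z FZ Zd]].
    have [W [FW YW ZW]] := up _ _ _ FY FZ Yc.
    have [_ h _ _ _] := Fg _ FW.
    have [||k Wk] := h a b; [by exists c; exact: YW|by exists d; exact: ZW|].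
    by exists k; exists W.
  + move=> a b c d [Y FY Yc] [Z FZ Zd]; have [W [FW YW ZW]] := up _ _ _ FY FZ Yc.
    by have [_ _ h _ _] := Fg _ FW; apply: (h a b); [exact: YW|exact: ZW].
  + move=> a b a' b' c [Y FY Yc] [Z FZ Zd]; have [W [FW YW ZW]] := up _ _ _ FY FZ Yc.
    by have [_ _ _ h _] := Fg _ FW; apply: (h a b a' b' c); [exact: YW|exact: ZW].
  + by have [_ _ _ _ h] := Fg _ FX => p /h; exists X.
pose D := dom G.
have Di n : D (iota n) by exists (iota (pickle (n, n))); apply: GG0; exists n, n.
have /choice[f hf] : forall p : A * A, exists c, D p.1 -> D p.2 -> G (p.1, p.2, c).
  move=> [a b] /=; have [Da|?] := pselect (D a); last by exists a.
  have [Db|?] := pselect (D b); last by exists a.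
  by have [c Gc] := Gt _ _ Da Db; exists c.
have fD a b : D a -> D b -> D (f (a, b)).
  by move=> Da Db; have [_ _] := Gd _ _ _ (hf (a, b) Da Db).
have finj a b a' b' : D a -> D b -> D a' -> D b' -> f (a, b) = f (a', b') -> a = a' /\ b = b'.
  move=> Da Db Da' Db' e; have := hf (a, b) Da Db; rewrite /= e => h.
  by case: (Gi _ _ _ _ _ h (hf (a', b') Da' Db')).
case: (comparable_sets D (~` D)) => -[g [gE ginj]]; last first.
  (* The tags [iota 0] and [iota 1] keep the images of [D] and of its complement apart. *)
  pose k a := if `[< D a >] then f (a, iota 0%N) else f (g a, iota 1%N).
  have kD a : D (k a).
    by rewrite /k; case: asboolP => [Da|nDa]; apply: fD => //; exact: gE.
  have kinj : injective k.
    move=> a b; rewrite /k; case: asboolP => [Da|nDa]; case: asboolP => [Db|nDb] e.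
    - by have [//||||] := finj _ _ _ _ _ _ _ _ e.
    - by have [||||_ /iinj] := finj _ _ _ _ _ _ _ _ e => //; exact: gE.
    - by have [||||_ /iinj] := finj _ _ _ _ _ _ _ _ e => //; exact: gE.
    - have [||||/ginj e1 _] := finj _ _ _ _ _ _ _ _ e => //; try exact: gE.
      exact: e1.
  exists (fun p => f (k p.1, k p.2)) => -[a b] [a' b'] /= e.
  by have [||||/kinj -> /kinj ->] := finj _ _ _ _ _ _ _ _ e.
exfalso.
pose E : set A := [set a | exists2 d, D d & a = g d].
have nDE a : E a -> ~ D a by move=> [d Dd ->]; exact: gE.
have /choice[u hu] : forall a, exists d, (D a -> d = a) /\ (E a -> D d /\ a = g d).
  move=> a; have [Da|nDa] := pselect (D a).
    by exists a; split=> // /nDE.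
  have [[d Dd e]|nEa] := pselect (E a); first by exists d; split.
  by exists a; split.
pose D' a := D a \/ E a.
have uD a : D' a -> D (u a) by move=> [Da|/(hu a).2[]//]; rewrite (hu a).1.
(* For pairs not inside [D], the tag records which of the two entries lie in [D]; [u] replaces an
   entry of the copy [E] by its original in [D]. *)
pose tag a b : nat := if `[< D a >] then 2 else if `[< D b >] then 1 else 3.
pose val a b := g (f (f (u a, u b), iota (tag a b))).
pose G' : set (A * A * A) := G `|` [set p | [/\ D' p.1.1, D' p.1.2, ~ (D p.1.1 /\ D p.1.2)
  & p.2 = val p.1.1 p.1.2]].
have valE a b : D' a -> D' b -> E (val a b).
  move=> Da Db; exists (f (f (u a, u b), iota (tag a b))) => //.
  by apply: (fD) => //; apply: (fD); exact: uD.
have domG' a : dom G' a <-> D' a.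
  split=> [[c [Gc|[/= h _ _ _]]]|[Da|Ea]] //.
  - by left; exists c.
  - by have [c Gc] := Da; exists c; left.
  - exists (val a a); right; split; [by right|by right| |by []].
    by move=> [Da _]; exact: nDE Ea Da.
have /Gmax sub : good G'.
  split.
  - move=> a b c [/Gd[Da Db Dc]|[/= Da Db _ ->]].
      by split; apply/domG'; left.
    by split; apply/domG' => //; right; exact: valE.
  - move=> a b /domG' Da /domG' Db; have [[Da' Db']|nD] := pselect (D a /\ D b).
      by have [c Gc] := Gt _ _ Da' Db'; exists c; left.
    by exists (val a b); right.
  - move=> a b c d [G1|[/= _ _ n1 ->]] [G2|[/= _ _ n2 ->]] //.
    + exact: Gf G1 G2.
    + by case: n2; have [] := Gd _ _ _ G1.
    + by case: n1; have [] := Gd _ _ _ G2.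
  - move=> a b a' b' c [G1|[/= Da Db n1 ->]] [G2|[/= Da' Db' n2 e]] //.
    + exact: Gi G1 G2.
    + by exfalso; apply: (nDE (val a' b')); [exact: valE|rewrite -e; have [] := Gd _ _ _ G1].
    + by exfalso; apply: (nDE (val a b)); [exact: valE|have [] := Gd _ _ _ G2].
    + have Du := uD; have De := fD.
      have Df x y : D' x -> D' y -> D (f (u x, u y)) by move=> /uD ? /uD ?; exact: fD.
      have /ginj e1 := e.
      have {}e1 := e1 (fD _ _ (Df _ _ Da Db) (Di _)) (fD _ _ (Df _ _ Da' Db') (Di _)).
      have [||||e2 /iinj e3] := finj _ _ _ _ _ _ _ _ e1 => //; try exact: Df.
      have [||||ua ub] := finj _ _ _ _ _ _ _ _ e2; try exact: uD.
      have key x x' : D' x -> D' x' -> `[< D x >] = `[< D x' >] -> u x = u x' -> x = x'.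
        move=> D'x D'x'; case: asboolP => [Dx|nDx]; case: asboolP => [Dx'|nDx'] // _ ux.
          by rewrite -[x](hu x).1// -[x'](hu x').1.
        have [//|Ex] := D'x; have [//|Ex'] := D'x'.
        by rewrite ((hu x).2 Ex).2 ((hu x').2 Ex').2 ux.
      have [e4 e5] : `[< D a >] = `[< D a' >] /\ `[< D b >] = `[< D b' >].
        move: e3 n1 n2; rewrite /tag.
        case: (asboolP (D a)) => h1; case: (asboolP (D b)) => h2;
        case: (asboolP (D a')) => h3; case: (asboolP (D b')) => h4 // _ n1 n2; exfalso;
        by [apply: n1|apply: n2].
      by rewrite (key _ _ Da Da' e4 ua) (key _ _ Db Db' e5 ub).
  - by move=> p /GG0; left.
have /domG' : D' (g (iota 0%N)) by right; exists (iota 0%N).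
move=> [c /(sub (fun p h => or_introl h))] Gc.
by apply: (gE (iota 0%N)) => //; exists c.
Qed.

Lemma seq_inj : exists f : seq A -> A, injective f.
Proof.
have [f finj] := square_inj; have /card_leTE[iota [iinj _]] := A_inf.
pose enc := fix enc s := if s is a :: s' then f (a, enc s') else iota 0%N.
exists (fun s => f (iota (size s), enc s)) => s t /finj[/iinj].
elim: s t => [|a s IH] [|b t] //= [st] /finj[-> e].
by rewrite (IH t).
Qed.

End Square.

(** An element is coded by its image and its number in the fiber; [B] is infinite because [A] is, so
    pairs can be coded in [B]. *)
Lemma card_le_finite_fibers (A B : Type) (f : A -> B) :
  ([set: nat] #<= [set: A])%card -> (forall b, finite_set [set a | f a = b]) ->
  exists g : A -> B, injective g.
Proof.
move=> A_inf ff.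
have B_inf : ([set: nat] #<= [set: B])%card.
  apply: contrapT => /finite_setPn finB; apply/finite_setPn: A_inf.
  have -> : [set: A] = \bigcup_(b in [set: B]) [set a | f a = b].
    by apply/seteqP; split=> // a _; exists (f a).
  exact: bigcup_finite.
have [sq sqinj] := square_inj B_inf; have /card_leTE[iota [iinj _]] := B_inf.
have /choice[ix hix] : forall b, exists ix : A -> nat, forall a a', f a = b -> f a' = b ->
    ix a = ix a' -> a = a'.
  move=> b; have /finite_set_countable/countable_injP[ix ixinj] := ff b.
  by exists ix => a a' fa fa'; apply: ixinj; rewrite inE.
exists (fun a => sq (f a, iota (ix (f a) a))) => a a' /sqinj[e /iinj].
by rewrite -e => e2; apply: (hix (f a)).
Qed.

(** * The group attached to an ultrafilter *)

Section Construction.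
Variables (R : realType) (A : choiceType) (F : set_system A).
Hypothesis UF : UltraFilter F.
Hypothesis freeF : free_filter F.
Local Notation T := (circle R).

Definition Fsub : set (A -> rat -> T) := [set x | homfam x /\ F [set i | x i 1 = 0]].

Lemma Fsub_subgroup : is_subgroup Fsub.
Proof.
split; first by split=> [j|]; [exact: homfam0|exact: filterE].
move=> x y [hx Fx] [hy Fy]; have E i q : (x - y) i q = x i q - y i q by [].
split; first by move=> i q q'; rewrite !E hx hy opprD addrACA.
by apply: filterS (filterI Fx Fy) => i [/= h1 h2]; rewrite E h1 h2 subrr.
Qed.

Local Notation W := (subgrp_of Fsub_subgroup).

Definition fball (l : seq (A * rat)) (e : R) : set W :=
  [set x | forall p, p \in l -> cnorm (sgval x p.1 p.2) < e].
Definition fbase : set_system W := [set S | exists l (e : R), 0 < e /\ S = fball l e].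

Lemma fbase_gbase : gbase fbase.
Proof.
split.
- by exists (fball [::] 1), [::], 1.
- move=> _ _ [l [e [e0 ->]]] [l' [e' [e'0 ->]]].
  exists (fball (l ++ l') (Num.min e e')).
    by exists (l ++ l'), (Num.min e e'); rewrite lt_min e0.
  move=> x hx; split=> p pl; have := hx p; rewrite mem_cat pl ?orbT lt_min => /(_ isT);
    by case/andP.
- by move=> _ [l [e [e0 ->]]] p pl; rewrite /= cnorm0.
- move=> _ [l [e [e0 ->]]]; exists (fball l (e / 2)).
    by exists l, (e / 2); rewrite divr_gt0.
  move=> x y hx hy p pl; apply: le_lt_trans (cnormB _ _) _.
  by rewrite (splitr e) ltrD ?hx ?hy.
Qed.

Local Notation FG := (gtopType fbase_gbase).

Definition co (x : FG) (i : A) (q : rat) : T := sgval (x : W) i q.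

Lemma coD x y i q : co (x + y) i q = co x i q + co y i q. Proof. by []. Qed.
Lemma coB x y i q : co (x - y) i q = co x i q - co y i q. Proof. by []. Qed.
Lemma co0 i q : co 0 i q = 0. Proof. by []. Qed.
Lemma co_hom i q : hom (fun x => co x i q). Proof. by []. Qed.

Lemma co_homfam x : homfam (co x).
Proof. by have [] := asboolW (sgP (x : W)). Qed.

Lemma co_F x : F [set i | co x i 1 = 0].
Proof. by have [] := asboolW (sgP (x : W)). Qed.

Lemma co_inj x y : (forall i q, co x i q = co y i q) -> x = y.
Proof.
move=> xy; suff : (x : W) = (y : W) by []; apply: val_inj.
by apply/funext => i; apply/funext => q; exact: xy.
Qed.

Lemma co_ex h : homfam h -> F [set i | h i 1 = 0] -> exists x, co x = h.
Proof. by move=> hh Fh; have [x xE] := sg_ex Fsub_subgroup (conj hh Fh); exists x. Qed.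

Lemma FG_nbhs (x : FG) (S : set FG) : nbhs x S <-> exists (l : seq (A * rat)) (e : R),
  0 < e /\ forall y, (forall p, p \in l -> cnorm (co y p.1 p.2 - co x p.1 p.2) < e) -> S y.
Proof.
have H := @gtop_nbhs _ _ fbase_gbase x S.
split=> [/H[_ [l [e [e0 ->]]] h]|[l [e [e0 h]]]].
  exists l, e; split=> // y hy.
  have <- : x + (y - x) = y by rewrite addrC subrK.
  exact: (h (y - x)).
apply/H; exists (fball l e); first by exists l, e.
move=> y hy; apply: h => p pl; rewrite [co (x + y) _ _]coD addrC addKr; exact: hy.
Qed.

Lemma FG_nbhs0 (S : set FG) : nbhs (0 : FG) S <-> exists (l : seq (A * rat)) (e : R),
  0 < e /\ forall y, (forall p, p \in l -> cnorm (co y p.1 p.2) < e) -> S y.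
Proof.
rewrite FG_nbhs; split=> -[l [e [e0 h]]]; exists l, e; split=> // y hy; apply: h => p pl.
  by rewrite co0 subr0; exact: hy.
by have := hy p pl; rewrite co0 subr0.
Qed.

Lemma FG_cvg (U : set_system FG) (x : FG) : Filter U ->
  (forall i q, tlim U (fun y => co y i q) (co x i q)) -> U --> x.
Proof.
move=> FU Ux S /FG_nbhs[l [e [e0 hS]]].
suff h : U [set y | forall p, p \in l -> cnorm (co y p.1 p.2 - co x p.1 p.2) < e].
  exact: filterS h.
elim: (l) => [|a s IH]; first by apply: filterE.
apply: filterS (filterI IH (Ux a.1 a.2 e e0)) => y [/= h1 h2] p.
by rewrite inE => /orP[/eqP ->|/h1].
Qed.

Lemma FG_tlim (U : set_system FG) (x : FG) i q : Filter U -> U --> x ->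
  tlim U (fun y => co y i q) (co x i q).
Proof.
move=> FU Ux e e0; apply: Ux; apply/FG_nbhs; exists [:: (i, q)], e; split=> // y hy.
exact: (hy (i, q)) (mem_head _ _).
Qed.

Lemma F_notin (s : seq A) : F [set i | i \notin s].
Proof.
apply: contrapT => /(ultra_setN UF) Fs.
have [x _ Fx] : exists2 x, [set` s] x & F [set x].
  apply: ultra_finite => //.
  by apply: filterS Fs => i /= /negP; rewrite negbK.
have : (\bigcap_(U in F) U) x.
  by move=> U FU; have [y [/= -> Uy]] := filter_ex (filterI Fx FU).
by rewrite freeF.
Qed.

Lemma F_inhab S : F S -> exists i, S i.
Proof. by move=> FS; exact: filter_ex FS. Qed.

Lemma FG_hausdorff : hausdorff_space FG.
Proof.
apply: gtop_hausdorff => x xn0.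
have [i [q xiq]] : exists i q, co x i q != 0.
  apply: contrapT => h; move/eqP: xn0; apply; apply: co_inj => i q.
  by apply/eqP; apply: contraT => hiq; case: h; exists i, q.
exists (fball [:: (i, q)] (cnorm (co x i q))).
  exists [:: (i, q)], (cnorm (co x i q)); split=> //.
  by rewrite lt_neqAle cnorm_ge0 andbT eq_sym; apply: contraNneq xiq => /cnorm_eq0 ->.
by move=> /(_ (i, q) (mem_head _ _)); rewrite ltxx.
Qed.

Lemma homfam_divn (h : A -> rat -> T) i q n : (0 < n)%N -> homfam h ->
  h i (q / n%:R) *+ n = h i q.
Proof.
move=> n0 hh; rewrite -(homMn (hh i)); congr (h i _).
by rewrite -[LHS]mulr_natr mulfVK// pnatr_eq0 -lt0n.
Qed.

Lemma FG_torsion_free : torsion_free FG.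
Proof.
move=> x n n0 xn; apply: co_inj => i q; rewrite co0 -(homfam_divn i q n0 (co_homfam x)).
by rewrite -(homMn (co_hom i _)) xn.
Qed.

Definition expq (s : R) (q : rat) : T := expi (s * ratr q).

Lemma expq_hom s : hom (expq s).
Proof. by move=> q q'; rewrite /expq rmorphD mulrDr expiD. Qed.

Lemma expq0 : expq 0 = 0.
Proof.
by apply/funext => q; rewrite /expq mul0r (hom0 (@expiD R)).
Qed.

Lemma antipode : exists s : T, [/\ s != 0, s *+ 2 = 0 & cnorm s = 2].
Proof.
have [|s [rs is_]] := @circle_ex R (-1) 0.
  by rewrite sqrrN expr1n expr0n addr0.
exists s; split.
- apply/eqP => s0; move: rs; rewrite s0 re0; lra.
- apply: re_eq1; rewrite mulr2n reD rs is_; lra.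
- by rewrite /cnorm rs; rewrite (_ : 2 - 2 * -1 = 2 ^+ 2 :> R); [rewrite sqrtr_sqr ger0_norm|lra].
Qed.

Lemma rat_char_value (s : T) : exists2 f : rat -> T, hom f & f 1 = s.
Proof.
have [x xs] := expi_surj s; exists (expq x); first exact: expq_hom.
by rewrite /expq rmorph1 mulr1.
Qed.

(** Elements equal to [f] on larger and larger finite sets could only converge to the constant
    family [f], whose value at 1 is nowhere 0. *)
Lemma FG_noncompact : ~ compact [set: FG].
Proof.
rewrite compact_ultra => cFG; have [s [s0 _ _]] := antipode.
have [f hf f1] := rat_char_value s.
pose B (l : seq A) : set FG := [set x | forall i, i \in l -> co x i = f].
have [|l l' _ _|l _|U [UU UB]] := @ultra_base FG (seq A) setT B.
- by exists [::].
- exists (l ++ l') => // x hx; split=> i il; apply: hx; rewrite mem_cat il ?orbT//.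
- have [||x xE] := @co_ex (fun i => if i \in l then f else 0).
  + by move=> i; case: ifP => // _; exact: homfam0.
  + by apply: filterS (F_notin l) => i /= /negPf ->.
  + by exists x => i il; rewrite xE il.
have [x [_ Ux]] := cFG U UU filterT.
have xf i : co x i 1 = s.
  apply: tlim_unique (FG_tlim i 1 _ Ux) _; apply: tlim_near (tlim_cst s).
  by apply: filterS (UB [:: i] I) => y /(_ i (mem_head _ _)) /= ->.
have [i /=] := F_inhab (co_F x).
by rewrite xf => /eqP; apply/negP.
Qed.

Lemma expi_scale_small (c e : R) : 0 < e -> exists2 d : R, 0 < d &
  forall x, `|x| < d -> cnorm (expi (x * c)) < e.
Proof.
move=> e0; have [d d0 hd] := expi_small e0.
have c1 : 0 < `|c| + 1 by rewrite ltr_wpDl.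
exists (d / (`|c| + 1)); first by rewrite divr_gt0.
move=> x xd; apply: hd; rewrite normrM; apply: (@le_lt_trans _ _ (`|x| * (`|c| + 1))).
  by rewrite ler_wpM2l// lerDl.
by rewrite -ltr_pdivlMr.
Qed.

Lemma FG_line (v : A -> R) (s : seq A) : (forall i, i \notin s -> v i = 0) ->
  exists g : R -> FG, [/\ continuous g, g 0 = 0 & forall t i q, co (g t) i q = expq (t * v i) q].
Proof.
move=> vs.
have /choice[g hg] : forall t : R, exists x, co x = fun i => expq (t * v i).
  move=> t; apply: co_ex; first by move=> i; exact: expq_hom.
  by apply: filterS (F_notin s) => i /vs vi /=; rewrite vi mulr0 expq0.
exists g; split.
- move=> t S /FG_nbhs[l [e [e0 hS]]].
  suff [d d0 hd] : exists2 d : R, 0 < d & forall x, `|x| < d -> forall p, p \in l ->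
      cnorm (expi (x * (v p.1 * ratr p.2))) < e.
    apply/nbhs_ballP; exists d => //= t' tt'.
    apply: hS => p pl.
    rewrite !hg /expq -(homB (@expiD R)).
    have -> : t' * v p.1 * ratr p.2 - t * v p.1 * ratr p.2 = (t' - t) * (v p.1 * ratr p.2) by ring.
    by apply: hd => //; rewrite distrC; exact: tt'.
  elim: (l) => [|a r [d d0 hd]]; first by exists 1.
  have [d' d'0 hd'] := expi_scale_small (v a.1 * ratr a.2) e0.
  exists (Num.min d d'); first by rewrite lt_min d0.
  move=> x; rewrite lt_min => /andP[xd xd'] p; rewrite inE => /orP[/eqP ->|pr].
    exact: hd'.
  exact: hd.
- by apply: co_inj => i q; rewrite hg mul0r expq0.
- by move=> t i q; rewrite hg.
Qed.

Lemma common_denom (l : seq (A * rat)) : exists2 N, (0 < N)%N &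
  forall p, p \in l -> exists z : int, p.2 * N%:R = z%:~R.
Proof.
elim: l => [|a l [N N0 hN]]; first by exists 1%N.
exists (N * `|denq a.2|)%N; first by rewrite muln_gt0 N0 absz_gt0 denq_neq0.
have dE : (`|denq a.2|%N%:R : rat) = (denq a.2)%:~R by rewrite pmulrn gez0_abs// ltW// denq_gt0.
move=> p; rewrite inE natrM dE => /orP[/eqP ->|/hN[z hz]].
  by exists (numq a.2 * N%:Z); rewrite intrM numqE -pmulrn mulrCA mulrC.
by exists (z * denq a.2); rewrite mulrA hz intrM.
Qed.

(** The lines with finitely many nonzero coordinates are dense: if [N] is a common denominator of
    the finitely many arguments, a line through the value of [x] at [1 / N] agrees with [x] at all
    of them at time 1. *)
Lemma FG_connected : connected [set: FG].
Proof.
pose P : set (R -> FG) := [set g | continuous g /\ g 0 = 0].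
have -> : [set: FG] = closure (\bigcup_(g in P) range g).
  apply/seteqP; split=> // x _ S /FG_nbhs[l [e [e0 hS]]].
  have [N N0 hN] := common_denom l.
  have /choice[th hth] : forall i, exists th : R, expi th = co x i N%:R^-1.
    by move=> i; exact: expi_surj.
  pose v i := if i \in map fst l then th i * N%:R else 0.
  have [|g [gc g0 gE]] := @FG_line v (map fst l); first by move=> i /negPf; rewrite /v => ->.
  exists (g 1); split; first by exists g => //; exists 1.
  apply: hS => p pl; rewrite gE mul1r /v map_f//.
  have [z hz] := hN p pl.
  have NR : (N%:R : rat) != 0 by rewrite pnatr_eq0 -lt0n.
  have -> : co x p.1 p.2 = co x p.1 N%:R^-1 *~ z.
    rewrite -(homMz (co_homfam x p.1)); congr (co x _ _).
    by rewrite -mulrzr -hz mulrC mulfK.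
  rewrite -hth -(homMz (@expiD R)) /expq -mulrA.
  have -> : (N%:R : R) * ratr p.2 = z%:~R.
    by rewrite -(ratr_nat R N) -rmorphM /= mulrC hz ratr_int.
  by rewrite mulrzr subrr cnorm0.
apply: connected_closure; apply: bigcup_connected.
  by exists 0 => g [_ g0]; exists 0.
move=> g [gc _]; apply: connected_continuous_connected; last exact: continuous_subspaceT.
by apply/connected_intervalP.
Qed.

End Construction.

Section RetopologizedGroup.
Variables (G : zmodType) (t : topology_on G).

(** The alias carries the proof [gt], from which the topological group instance is built, so that
    the lemmas on neighbourhoods of 0 apply to the coarser topology. *)
Definition retopG (gt : is_group_topology t) : Type := retopologized t.

Variable gt : is_group_topology t.
HB.instance Definition _ := GRing.Zmodule.on (retopG gt).
HB.instance Definition _ := Topological.on (retopG gt).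
Fact retopG_add : continuous (fun x : retopG gt * retopG gt => x.1 + x.2).
Proof. exact: gt.1. Qed.
Fact retopG_opp : continuous (-%R : retopG gt -> retopG gt).
Proof. exact: gt.2. Qed.
HB.instance Definition _ :=
  PreTopologicalNmodule_isTopologicalNmodule.Build (retopG gt) retopG_add.
HB.instance Definition _ :=
  TopologicalNmodule_isTopologicalZmodule.Build (retopG gt) retopG_opp.

End RetopologizedGroup.

(** * Minimality, boundedness and weight of the group of a countably complete ultrafilter *)

Section Properties.
Variables (R : realType) (A : choiceType) (F : set_system A).
Hypothesis UF : UltraFilter F.
Hypothesis freeF : free_filter F.
Hypothesis ccF : countably_complete F.
Local Notation T := (circle R).
Local Notation FG := (gtopType (@fbase_gbase R A F UF)).

(* A countably complete ultrafilter makes every family of characters of [rat]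
   constant almost everywhere, which reduces the claim to one character. *)
Lemma FG_essential (N : set (A -> rat -> T)) : is_subgroup N ->
  (forall h, N h -> homfam h) ->
  (forall (U : set_system nat) (u : nat -> A -> rat -> T) h, UltraFilter U ->
     (forall j, N (u j)) -> (forall i q, tlim U (fun j => u j i q) (h i q)) -> N h) ->
  (exists k i q, N k /\ k i q != 0) ->
  exists x : FG, x != 0 /\ N (co x).
Proof.
move=> sN hN clN [k [i0 [q0 [Nk kn0]]]].
have /choice[t ht] : forall q, exists t, tlim F (fun i => k i q) t.
  by move=> q; exact: ultra_tlim.
have Fq q : F [set i | k i q = t q].
  have h : F (\bigcap_n [set i | cnorm (k i q - t q) < n.+1%:R^-1]).
    by apply: ccF => n; apply: ht; rewrite invr_gt0 ltr0n.
  apply: filterS h => i hi /=; apply/eqP; rewrite -subr_eq0; apply/eqP/cnorm_eq0/le_anti.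
  rewrite cnorm_ge0 andbT; apply/ler_addgt0Pr => e e0; rewrite add0r.
  have [n hn] := archi_small (1 : R) e0; rewrite div1r in hn.
  exact/ltW/(lt_trans (hi n I) hn).
have FJ : F [set i | forall q, k i q = t q].
  have h : F (\bigcap_n [set i | if unpickle n is Some q then k i q = t q else True]).
    by apply: ccF => n; case: unpickle => [q|]; [exact: Fq|exact: filterE].
  by apply: filterS h => i hi q; have := hi (pickle q) I; rewrite /mkset pickleK.
have nz h i q : N h -> h i q != 0 -> F [set i | h i 1 = 0] -> exists x : FG, x != 0 /\ N (co x).
  move=> Nh hiq Fh; have [x xE] := co_ex UF (hN _ Nh) Fh.
  exists x; split; last by rewrite xE.
  by apply/eqP => x0; move: hiq; rewrite -xE x0 co0 eqxx.
(* If the almost constant value at 1 has finite order [m], then [m] times [k] vanishes at 1 almost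
   everywhere. It is nonzero, because its value at [q0 / m] is that of [k] at [q0]. *)
have [[m m0 tm]|ntor] := pselect (exists2 m, (0 < m)%N & t 1 *+ m = 0).
  have hk j q : (k *+ m) j q = k j q *+ m.
    have h1 : hom (fun f : A -> rat -> T => f j) by [].
    have h2 : hom (fun f : rat -> T => f q) by [].
    by rewrite (homMn h1) (homMn h2).
  apply: (nz (k *+ m) i0 (q0 / m%:R)).
  - exact: subgroupMn.
  - by rewrite hk homfam_divn//; exact: hN.
  - by apply: filterS FJ => i hi /=; rewrite hk hi.
have [s [s0 s2 _]] := antipode R.
have kz z j q : (k *~ z) j q = k j q *~ z.
  have h1 : hom (fun f : A -> rat -> T => f j) by [].
  have h2 : hom (fun f : rat -> T => f q) by [].
  by rewrite (homMz h1) (homMz h2).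
(* Otherwise the multiples of that value are dense, and some of them converge to the element [s] of
   order 2. *)
have /choice[z hz] : forall n : nat, exists z : int, cnorm (t 1 *~ z - s) < n.+1%:R^-1.
  move=> n; have e0 : 0 < (n.+1%:R : R)^-1 by rewrite invr_gt0 ltr0n.
  have hy (i : nat) : hom (fun z : int => t 1 *~ z) by move=> a b; rewrite mulrzDr.
  have [m hm|z hz] := @char_dense R int 1 (fun _ z => t 1 *~ z) hy (fun=> s) _ e0; last first.
    by exists z; exact: (hz 0%N).
  have := hm 1; rewrite /lc !big_ord1 mulr1z => tm.
  have [->|mn0] := eqVneq (m 0%N) 0; first by rewrite mulr0z.
  case: ntor; exists `|m 0%N|%N; first by rewrite absz_gt0.
  have [h|h] := leP 0 (m 0%N); first by rewrite pmulrn gez0_abs.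
  by rewrite pmulrn ltz0_abs// mulrNz tm oppr0.
have [U [UU UN]] := free_ultra_nat.
have /choice[w hw] : forall p : A * rat, exists w, tlim U (fun n => k p.1 p.2 *~ z n) w.
  by move=> p; exact: ultra_tlim.
pose W j q := w (j, q).
have NW : N W.
  apply: (clN U (fun n => k *~ z n)) => // [n|j q]; first exact: subgroupMz.
  have := hw (j, q); apply: tlim_near.
  by apply: filterE => n /=; rewrite kz.
have WJ i : (forall q, k i q = t q) -> W i 1 = s.
  move=> hi; apply: tlim_unique (hw (i, 1)) _ => e e0 /=.
  have [n hn] := archi_small (1 : R) e0; rewrite div1r in hn.
  apply: filterS (UN n) => m /= nm; rewrite hi; apply: lt_trans (hz m) _.
  by apply: le_lt_trans hn; rewrite lef_pV2 ?posrE ?ltr0n// ler_nat.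
have W2 j q : (W *+ 2) j q = W j q *+ 2 by [].
have [i Ji] := F_inhab UF FJ.
(* Doubling the limit [W] kills its values at 1 almost everywhere, but the double at [1 / 2] is [W]
   at 1, which is [s] at the coordinate [i]. *)
apply: (nz (W *+ 2) i (1 / 2%:R)).
- exact: subgroupMn.
- by rewrite W2 homfam_divn ?WJ//; exact: hN.
- by apply: filterS FJ => j Jj /=; rewrite W2 WJ.
Qed.

(** Let [N] be the intersection, in the product of all families, of the closures of the
    neighbourhoods of 0 of the coarser topology [t]. If [t] were strictly coarser, compactness of
    the product would give [N] a nonzero element, and essentiality a nonzero one in the group. That
    one would lie in all neighbourhoods of 0 of [t], which is Hausdorff. *)
Lemma FG_minimal : minimal_group FG.
Proof.
split; first exact: FG_hausdorff.
move=> [t [gt ht [tsub tne]]].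
pose Gt := retopG gt; pose Nb : set_system Gt := nbhs (0 : Gt).
have [_ DI D0 DB] := gbase_nbhs Gt.
have NbFG O : Nb O -> nbhs (0 : FG) O.
  rewrite /Nb nbhsE => -[O' [oO' O'0] O'O]; rewrite nbhsE; exists O' => //.
  by split=> //; exact: tsub.
suff key : forall (l : seq (A * rat)) (e : R), 0 < e -> exists2 O, Nb O &
    forall y : FG, O y -> forall p, p \in l -> cnorm (co y p.1 p.2) < e.
  apply: tne => O oO; suff : @open Gt O by [].
  rewrite openE => x Ox.
  have : nbhs (x : FG) O by apply: open_nbhs_nbhs; split.
  move=> /FG_nbhs[l [e [e0 hO]]]; have [P NP hP] := key l e e0.
  apply: filterS (@nbhs_translate Gt x P NP) => y /= Py.
  by apply: hO => p pl; rewrite -coB; exact: hP.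
move=> l e e0; apply: contrapT => hn.
have {}hn O : Nb O -> exists y : FG, O y /\ exists2 p, p \in l & e <= cnorm (co y p.1 p.2).
  move=> NO; apply: contrapT => h; apply: hn; exists O => // y Oy p pl.
  by rewrite ltNge; apply/negP => ep; apply: h; exists y; split=> //; exists p.
pose N : set (A -> rat -> T) := [set h | homfam h /\ forall O, Nb O ->
  forall (l : seq (A * rat)) (e : R), 0 < e -> exists2 x : FG, O x &
  forall p, p \in l -> cnorm (co x p.1 p.2 - h p.1 p.2) < e].
have sN : is_subgroup N.
  split.
    split; first by move=> j; exact: homfam0.
    move=> O NO l' e' e'0; exists 0; first exact: D0.
    by move=> p _; rewrite co0 subrr cnorm0.
  move=> h h' [hh Nh] [hh' Nh']; have E i q : (h - h') i q = h i q - h' i q by [].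
  split; first by move=> i q q'; rewrite !E hh hh' opprD addrACA.
  move=> O NO l' e' e'0; have e2 : 0 < e' / 2 by rewrite divr_gt0.
  have [O' NO' hO'] := DB _ NO.
  have [x Ox hx] := Nh _ NO' l' _ e2; have [x' Ox' hx'] := Nh' _ NO' l' _ e2.
  exists (x - x'); first exact: hO'.
  move=> p pl; rewrite coB E.
  have -> : co x p.1 p.2 - co x' p.1 p.2 - (h p.1 p.2 - h' p.1 p.2) =
    (co x p.1 p.2 - h p.1 p.2) - (co x' p.1 p.2 - h' p.1 p.2) by zmod.
  by apply: le_lt_trans (cnormB _ _) _; rewrite (splitr e') ltrD ?hx ?hx'.
have fin (I : Type) (U : set_system I) (u : I -> A -> rat -> T) h (l' : seq (A * rat)) (e' : R) :
    Filter U -> 0 < e' -> (forall i q, tlim U (fun j => u j i q) (h i q)) ->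
    U [set j | forall p, p \in l' -> cnorm (u j p.1 p.2 - h p.1 p.2) < e'].
  move=> FU e'0 uh; elim: l' => [|a s IH]; first by apply: filterE.
  apply: filterS (filterI IH (uh a.1 a.2 e' e'0)) => y [/= h1 h2] p.
  by rewrite inE => /orP[/eqP ->|/h1].
have [|||x [xn0 [_ Nx]]] := @FG_essential N sN.
- by move=> h [].
- move=> U u h UU Nu uh; split.
    by move=> i; apply: (hom_tlim (u := fun j => u j i) _ _ (uh i)); apply: filterE => j; exact: (Nu j).1.
  move=> O NO l' e' e'0; have e2 : 0 < e' / 2 by rewrite divr_gt0.
  have [j /= hj] := filter_ex (fin _ U u h l' _ _ e2 uh).
  have [x Ox hx] := (Nu j).2 O NO l' _ e2; exists x => // p pl.
  apply: le_lt_trans (cnorm_tri (u j p.1 p.2) _ _) _.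
  by rewrite (splitr e') ltrD ?hx ?hj.
- have [|O O' NO NO'|O NO|U [UU UB]] := @ultra_base FG (set Gt) Nb
      (fun O => [set y | O y /\ exists2 p, p \in l & e <= cnorm (co y p.1 p.2)]).
  + by exists setT; exact: filterT.
  + by exists (O `&` O'); [exact: filterI|move=> y [[Oy O'y] h]].
  + by have [y hy] := hn O NO; exists y.
  have /choice[w hw] : forall p : A * rat, exists w, tlim U (fun y => co y p.1 p.2) w.
    by move=> p; exact: ultra_tlim.
  pose k i q := w (i, q).
  have kl i q : tlim U (fun y => co y i q) (k i q) by exact: (hw (i, q)).
  have Nk : N k.
    split.
      move=> i; apply: (hom_tlim (u := fun y => co y i) _ _ (kl i)).
      by apply: filterE => y; exact: co_homfam.
    move=> O NO l' e' e'0.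
    have [y [/= [Oy _] hy]] := filter_ex (filterI (UB O NO) (fin _ U (@co R A F UF) k l' _ _ e'0 kl)).
    by exists y.
  have [y [/= [_ [p pl ep]] hy]] := filter_ex (filterI (UB setT filterT)
    (fin _ U (@co R A F UF) k l _ _ e0 kl)).
  exists k, p.1, p.2; split=> //; apply/eqP => k0.
  by have := hy p pl; rewrite k0 subr0 ltNge ep.
have xO O : Nb O -> O x.
  move=> NO; have [O' NO' hO'] := DB _ NO.
  have /FG_nbhs0[l' [e' [e'0 hl']]] := NbFG _ NO'.
  have [y O'y hy] := Nx _ NO' l' e' e'0.
  have -> : x = y - (y - x) by rewrite opprB addrC subrK.
  by apply: hO' => //; apply: hl' => p pl; rewrite coB; exact: hy.
move/eqP: xn0; apply; apply: (ht x 0) => P Q nP nQ.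
by exists x; split; [exact: nbhs_singleton nP|exact: xO].
Qed.

Definition compl_for (B : Type) := forall U : B -> set A, (forall b, F (U b)) -> F [set i | forall b, U b i].

(** The elements of [S] vanish at 1 on a common large set [J], and the families vanishing at 1 on
    [J] form a closed subgroup of the compact product of all families. *)
Lemma FG_bounded (B : cardinal) : compl_for B -> card_bounded B FG.
Proof.
move=> cB S SB.
have [[b0]|nB] := pselect (inhabited B); last first.
  exists [set 0]; split.
  - by split=> // x y -> ->; rewrite subr0.
  - exact: compact_set1.
  - have [f] := card_leP SB.
    by move=> x Sx; case: nB; split; exact: (val (f (SigSub (mem_set Sx)))).
have /card_leP[f] := SB.
have finj : injective f by move=> u v; apply: inj; rewrite inE.
have /choice[g hg] : forall b, exists x : FG, forall y (Sy : S y), val (f (SigSub (mem_set Sy))) = b -> x = y.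
  move=> b; have [[y [Sy yb]]|n] := pselect (exists y (Sy : S y), val (f (SigSub (mem_set Sy))) = b).
    exists y => y' Sy' y'b; have : f (SigSub (mem_set Sy)) = f (SigSub (mem_set Sy')).
      by apply: val_inj; rewrite yb y'b.
    by move=> /finj/(congr1 val).
  by exists 0 => y Sy yb; case: n; exists y, Sy.
pose J := [set i | forall b, co (g b) i 1 = 0].
have FJ : F J by apply: cB => b; exact: co_F.
pose K : set FG := [set x | forall i, J i -> co x i 1 = 0].
exists K; split.
- split; first by move=> i _; rewrite co0.
  by move=> x y Kx Ky i Ji; rewrite coB Kx// Ky// subrr.
- rewrite compact_ultra => U UU UK.
  have /choice[w hw] : forall p : A * rat, exists w, tlim U (fun y => co y p.1 p.2) w.
    by move=> p; exact: ultra_tlim.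
  pose k i q := w (i, q).
  have kl i q : tlim U (fun y => co y i q) (k i q) by exact: (hw (i, q)).
  have kJ i : J i -> k i 1 = 0.
    move=> Ji; apply: tlim_unique (kl i 1) _; apply: tlim_near (tlim_cst 0).
    by apply: filterS UK => y /(_ i Ji) /= ->.
  have [||x xE] := @co_ex R A F UF k.
  + move=> i; apply: (hom_tlim (u := fun y => co y i) _ _ (kl i)).
    by apply: filterE => y; exact: co_homfam.
  + by apply: filterS FJ => i /kJ.
  exists x; split; first by move=> i Ji; rewrite xE kJ.
  by apply: FG_cvg => i q; rewrite xE; exact: kl.
- move=> x Sx i Ji; have <- : g (val (f (SigSub (mem_set Sx)))) = x by exact: hg.
  exact: Ji.
Qed.

(** From below: send [i] to a base set at 0 where the value at coordinate [i] and argument 1 is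
    small. A base set restricts finitely many coordinates, so this has finite fibers. From above:
    there is a base described by finite data from [A]. *)
Lemma FG_weight : ([set: nat] #<= [set: A])%card -> has_weight FG A.
Proof.
move=> A_inf.
have low (B : set (set FG)) : basis B -> ([set: A] #<= B)%card.
  move=> [Bo Bb].
  have /choice[b hb] : forall i, exists b : set FG, [/\ B b, b 0 &
      forall x : FG, b x -> cnorm (co x i 1) < 1].
    move=> i; have n0 : nbhs (0 : FG) [set x : FG | cnorm (co x i 1) < 1].
      by apply/FG_nbhs0; exists [:: (i, 1)], 1; split=> // y /(_ (i, 1) (mem_head _ _)).
    by have [b [Bbb b0] bs] := Bb 0 _ n0; exists b; split.
  have [g ginj] : exists g : A -> {x | B x}, injective g.
    pose f i : {x | B x} := let: And3 h _ _ := hb i in exist _ (b i) h.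
    have fE i : sval (f i) = b i by rewrite /f; case: (hb i).
    apply: (card_le_finite_fibers (f := f)) => // -[c Bc].
    have [[i1 fi1]|n] := pselect (exists i, f i = exist _ c Bc); last first.
      suff -> : [set a | f a = exist _ c Bc] = set0 by [].
      by apply/seteqP; split=> // a fa; apply: n; exists a.
    have cE : c = b i1 by rewrite -fE fi1.
    have c0 : nbhs (0 : FG) c.
      by apply: open_nbhs_nbhs; split; [exact: Bo|rewrite cE; case: (hb i1)].
    have /FG_nbhs0[l [e [e0 hl]]] := c0.
    apply: (@sub_finite_set _ _ [set` map fst l]); last exact: finite_seq.
    move=> i fi /=; have ci : c = b i by rewrite -fE fi.
    apply: contraT => il; have [s [s0 _ s2]] := antipode R.
    have [f1 hf1 f11] := rat_char_value s.
    have [||x xE] := @co_ex R A F UF (fun j => if j == i then f1 else 0).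
    - by move=> j; case: ifP => // _; exact: homfam0.
    - by apply: filterS (F_notin UF freeF [:: i]) => j /=; rewrite mem_seq1 => /negPf ->.
    have [_ _ /(_ x)] := hb i; rewrite -ci xE eqxx f11 s2.
    have cx : c x.
      apply: hl => p pl; rewrite xE; case: eqP => [pi|_]; last by rewrite cnorm0.
      by move: il; rewrite -pi map_f.
    by move=> /(_ cx); lra.
  apply/card_leTE; exists (fun i => sval (g i)); split=> [i j|i]; last exact: svalP.
  move=> e; apply: ginj; case: (g i) (g j) e => [u Bu] [v Bv] /= uv.
  by move: Bu; rewrite uv => Bu; congr exist; exact: Prop_irrelevance.
split=> //.
(* A code is a list of coordinates, each with a rational argument and a rational angle as centre,
   and a number [n] for the radius [1 / (n + 1)]; [seq_inj] codes all this in [A]. *)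
pose code := (seq (A * (rat * rat)) * nat)%type.
pose bset (c : code) : set FG := [set x | forall p, p \in c.1 ->
  cnorm (co x p.1 p.2.1 - expi (ratr p.2.2)) < c.2.+1%:R^-1].
have aux (u v d : R) : u < v -> u + Num.min d ((v - u) / 2) < v.
  move=> uv; apply: (@le_lt_trans _ _ (u + (v - u) / 2)); last by lra.
  by rewrite lerD2l ge_min lexx orbT.
have bas : basis (range bset).
  split.
    move=> _ [c _ <-]; rewrite openE => x hx; apply/FG_nbhs.
    have [d d0 hd] : exists2 d : R, 0 < d & forall p, p \in c.1 ->
        cnorm (co x p.1 p.2.1 - expi (ratr p.2.2)) + d < c.2.+1%:R^-1.
      have : forall p, p \in c.1 -> cnorm (co x p.1 p.2.1 - expi (ratr p.2.2)) < c.2.+1%:R^-1 by [].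
      elim: (c.1) => [|a s IH] h; first by exists 1.
      have [p ps|d d0 hd] := IH; first by apply: h; rewrite inE ps orbT.
      have ha := h a (mem_head _ _).
      exists (Num.min d ((c.2.+1%:R^-1 - cnorm (co x a.1 a.2.1 - expi (ratr a.2.2))) / 2)).
        by rewrite lt_min d0 divr_gt0// subr_gt0.
      move=> p; rewrite inE => /orP[/eqP ->|/hd].
        exact: aux.
      by apply: le_lt_trans; rewrite lerD2l ge_min lexx.
    exists (map (fun p => (p.1, p.2.1)) c.1), d; split=> // y hy p pc.
    apply: le_lt_trans (cnorm_tri (co x p.1 p.2.1) _ _) _.
    rewrite addrC; apply: lt_trans (hd p pc); rewrite ltrD2l.
    by apply: (hy (p.1, p.2.1)); apply: (map_f (fun p => (p.1, p.2.1))).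
  move=> x S /FG_nbhs[l [e [e0 hS]]].
  have e20 : 0 < e / 2 by rewrite divr_gt0.
  have [n hn] := archi_small (1 : R) e20; rewrite div1r in hn.
  have n0 : 0 < (n.+1%:R : R)^-1 by rewrite invr_gt0 ltr0n.
  have /choice[r hr] : forall p : A * rat, exists r : rat,
      cnorm (co x p.1 p.2 - expi (ratr r)) < n.+1%:R^-1.
    move=> p; have [th <-] := expi_surj (co x p.1 p.2).
    have [d d0 hd] := expi_small n0.
    have thd : th < th + d by rewrite ltrDl.
    have [r /andP[]] := rat_in_itvoo thd.
    rewrite !bnd_simp => r1 r2; exists r; rewrite -(homB (@expiD R)); apply: hd.
    by rewrite ltr_norml; lra.
  pose c : code := (map (fun p => (p.1, (p.2, r p))) l, n).
  exists (bset c).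
    by split; [exists c|move=> _ /mapP[p pl ->]; exact: hr].
  move=> y hy; apply: hS => p pl; apply: le_lt_trans (cnorm_tri (expi (ratr (r p))) _ _) _.
  have h1 : cnorm (co y p.1 p.2 - expi (ratr (r p))) < n.+1%:R^-1.
    exact: (hy (p.1, (p.2, r p)) (map_f (fun p => (p.1, (p.2, r p))) pl)).
  rewrite (cnorm_distC (expi _)) (splitr e) ltrD//; first exact: lt_trans h1 hn.
  exact: lt_trans (hr p) hn.
exists (range bset) => //; rewrite card_eq_le low// andbT.
apply: card_le_trans (card_image_le _ _) _.
have [sq sqinj] := square_inj A_inf; have [sf sfinj] := seq_inj A_inf.
have /card_leTE[iota [iinj _]] := A_inf.
apply/card_leTE; exists (fun c : code => sf (iota c.2 ::
  map (fun p => sq (p.1, iota (pickle p.2))) c.1)); split=> // -[l n] [l' n'] /sfinj[/iinj -> e].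
congr (_, _); move: e; apply: inj_map => -[a q] [a' q'] /sqinj[-> /iinj e].
by rewrite (pcan_inj pickleK e).
Qed.

End Properties.

(* The equivalences and the least measurable cardinal *)
From mathcomp Require Import Rstruct.
(** A compact set containing the range provides a cluster point, to which a Cauchy sequence
    converges. *)
Lemma bounded_sequentially_complete (G : topologicalZmodType) :
  card_bounded nat G -> sequentially_complete G.
Proof.
move=> bG u cu.
have [|K [_ cK uK]] := bG (range u); first exact: card_image_le.
have uo : (u @ \oo) K by exists 0%N => // n _; apply: uK; exists n.
have [p [_ pu]] := cK (u @ \oo) _ uo.
exists p => W nW; have [V nV [_ VV]] := gbaseD (gbase_nbhs G) (nbhs_translateN nW).
have [N hN] := cu V nV.
have [|y [[m Nm <-] Vy]] := pu [set u m | m in [set m | (N <= m)%N]] _ _ (nbhs_translate p nV).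
  by exists N => // m Nm; exists m.
exists N => // n Nn /=.
have <- : p + ((u n - u m) + (u m - p)) = u n by zmod.
by apply: VV => //; exact: hN.
Qed.

Lemma group_of_Ulam (R : realType) (A : Type) (F : set_system A) :
  ([set: nat] #<= [set: A])%card -> UltraFilter F -> free_filter F ->
  countably_complete F ->
  exists G : topologicalZmodType,
    [/\ hausdorff_space G, connected [set: G] & ~ compact [set: G]] /\
    [/\ minimal_group G, torsion_free G, has_weight G A &
      forall B : cardinal, (forall U : B -> set A, (forall b, F (U b)) ->
        F [set i | forall b, U b i]) -> card_bounded B G].
Proof.
(* The construction needs decidable choice on the index type; an arbitrary type is replaced by a
   [choiceType] here. *)
elim/Pchoice: A F => A F A_inf UF freeF ccF.
exists (gtopType (@fbase_gbase R A F UF)); split; split.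
- exact: FG_hausdorff.
- exact: FG_connected.
- exact: FG_noncompact.
- exact: FG_minimal.
- exact: FG_torsion_free.
- exact: FG_weight.
- by move=> B cB; exact: FG_bounded.
Qed.

(* Below the least measurable cardinal, a family of large sets with small
   intersection would push the ultrafilter forward to its index set. *)
Lemma least_complete (A B : cardinal) (F : set_system A) : least_Ulam_measurable A ->
  UltraFilter F -> countably_complete F -> card_lt B A ->
  forall U : B -> set A, (forall b, F (U b)) -> F [set i | forall b, U b i].
Proof.
move=> [_ leastA] UF ccF [_ nAB] U FU; apply: contrapT => nF.
have FC := ultra_setN UF nF.
have [i0 hi0] := filter_ex FC.
have [b0 _] : exists b, ~ U b i0 by apply: contrapT => h; apply: hi0 => b; apply: contrapT => hb; apply: h; exists b.
have /choice[f hf] : forall i, exists b, (exists b, ~ U b i) -> ~ U b i.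
  move=> i; have [[b nb]|n] := pselect (exists b, ~ U b i); first by exists b.
  by exists b0 => /n.
have Ff : F [set i | ~ U (f i) i].
  apply: filterS FC => i hi; apply: hf; apply: contrapT => h; apply: hi => b.
  by apply: contrapT => hb; apply: h; exists b.
apply: nAB; apply: leastA; exists (f @ F); split.
- exact: ultra_fmap.
- apply/seteqP; split=> // b hb.
  have h : F (f @^-1` (~` [set b])).
    apply: filterS (filterI Ff (FU b)) => i [/= nU Ui] fib.
    by apply: nU; rewrite fib.
  exact: (hb (~` [set b]) h erefl).
- by move=> V FV; exact: (ccF (fun n => f @^-1` V n)).
Qed.

Local Open Scope card_scope.

Theorem theoremB (A : cardinal) (A_inf : [set: nat] #<= [set: A]) :
  [/\ Ulam_measurable A <->
      (exists G : topologicalZmodType,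
         hausdorff_space G /\
         [/\ ~ compact [set: G], connected [set: G],
             sequentially_complete G, minimal_group G & has_weight G A]),
      Ulam_measurable A <->
      (exists G : topologicalZmodType,
         [/\ hausdorff_space G, ~ compact [set: G] & connected [set: G]] /\
         [/\ card_bounded nat G, minimal_group G, torsion_free G
           & has_weight G A])
    & least_Ulam_measurable A ->
      exists G : topologicalZmodType,
        [/\ hausdorff_space G, connected [set: G] & ~ compact [set: G]] /\
        [/\ minimal_group G, torsion_free G, has_weight G A
          & forall B : cardinal, card_lt B A -> card_bounded B G]].
Proof.
(* The statement mentions no real numbers, so a concrete real field is fixed for the circle
   group. *)
pose R : realType := Rdefinitions.R.
have exG : Ulam_measurable A -> exists G : topologicalZmodType,
    [/\ hausdorff_space G, ~ compact [set: G] & connected [set: G]] /\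
    [/\ card_bounded nat G, minimal_group G, torsion_free G & has_weight G A].
  move=> [F [UF freeF ccF]].
  have [G [[h1 h2 h3] [h4 h5 h6 h7]]] := group_of_Ulam R A_inf UF freeF ccF.
  exists G; do 2!split=> //; apply: h7 => U FU.
  by apply: filterS (ccF U FU) => i hi n; exact: hi.
split.
- split=> [/exG[G [[h1 h2 h3] [h4 h5 h6 h7]]]|[G [_ [h1 h2 h3 h4 h5]]]].
    by exists G; split=> //; split=> //; exact: bounded_sequentially_complete.
  exact: (@Ulam_of_group R G).
- split=> [/exG//|[G [[h1 h2 h3] [h4 h5 h6 h7]]]].
  by apply: (@Ulam_of_group R G) => //; exact: bounded_sequentially_complete.
- move=> lA; have [[F [UF freeF ccF]] _] := lA.
  have [G [h1 [h4 h5 h6 h7]]] := group_of_Ulam R A_inf UF freeF ccF.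
  exists G; do 2!split=> //; move=> B BA; apply: h7 => U FU.
  exact: (least_complete lA UF ccF BA).
Qed.
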